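(* For every real $z\ge 0$, $$E\Bigl(-\frac{z^2}{3},0,z\Bigr)=\frac{\sqrt\pi}{3}\exp\Bigl(\frac{\mathrm{i}z^3}{27}\Bigr)\biggl\{\frac{1}{\Gamma(\frac56)}\,{}_2F_2\Bigl(\tfrac16,\tfrac12;\tfrac13,\tfrac23\,\Big|\,-\tfrac{8}{27}\mathrm{i}z^3\Bigr)-\frac{\mathrm{i}z}{3\Gamma(\frac76)}\,{}_2F_2\Bigl(\tfrac12,\tfrac56;\tfrac23,\tfrac43\,\Big|\,-\tfrac{8}{27}\mathrm{i}z^3\Bigr)\biggr\}.$$
   Context: For real $x,y,z$ the elliptic umbilic integral is $$E(x,y,z)=\frac{1}{2\pi}\iint_{\mathbb{R}^2}\exp\bigl\{-\mathrm{i}(x\xi+y\eta)-\mathrm{i}z(\xi^2+\eta^2)+\mathrm{i}(\xi^3-3\xi\eta^2)\bigr\}\,\mathrm{d}\xi\,\mathrm{d}\eta ,$$ understood as an oscillatory integral, i.e. as the limit $\varepsilon\to0^+$ of the integral with the additional factor $\mathrm{e}^{-\varepsilon(\xi^2+\eta^2)}$. Here ${}_2F_2(a_1,a_2;b_1,b_2\,|\,w)=\sum_{n\ge0}\frac{(a_1)_n(a_2)_n}{(b_1)_n(b_2)_n}\frac{w^n}{n!}$, where $(a)_n=a(a+1)\cdots(a+n-1)$. *)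

(* Defs.v *)
From HB Require Import structures.
From mathcomp Require Export all_boot all_order all_algebra.
From mathcomp Require Export complex.
From mathcomp Require Export all_classical all_reals all_analysis.

Set Implicit Arguments.
Unset Strict Implicit.
Unset Printing Implicit Defensive.

Import Order.TTheory GRing.Theory Num.Theory.
Import numFieldNormedType.Exports.

Local Open Scope classical_set_scope.
Local Open Scope ring_scope.
Local Open Scope complex_scope.

(* The topology and norm of [R[i]] are those given by its modulus. *)
HB.instance Definition _ (R : rcfType) := NormedModule.copy R[i] R[i]^o.

Definition cexp (R : realType) (w : R[i]) : R[i] :=
  (expR (complex.Re w))%:C * (cos (complex.Im w) +i* sin (complex.Im w)).

Definition cintegral (d : measure_display) (T : measurableType d) (R : realType)
    (mu : {measure set T -> \bar R}) (f : T -> R[i]) : R[i] :=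
  (\int[mu]_t complex.Re (f t)) +i* (\int[mu]_t complex.Im (f t)).

(* Euler's integral, which is the Gamma function for [0 < s]. *)
Definition Gamma (R : realType) (s : R) : R :=
  \int[lebesgue_measure]_(t in `]0, +oo[) (t `^ (s - 1) * expR (- t)).

Definition pochhammer (K : fieldType) (a : K) (n : nat) : K :=
  \prod_(k < n) (a + k%:R).

Definition hyp2F2 (R : realType) (a1 a2 b1 b2 w : R[i]) : R[i] :=
  limn (series (fun n =>
    (pochhammer a1 n * pochhammer a2 n) / (pochhammer b1 n * pochhammer b2 n)
      * (w ^+ n / n`!%:R))).

(* ['i%C] is needed because multiplication reads its arguments in [ring_scope],
   where ['i] is the imaginary unit of an abstract [numClosedFieldType]. *)
Definition elliptic_umbilic_reg (R : realType) (x y z eps : R) : R[i] :=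
  (2 * pi)^-1%:C *
  cintegral (lebesgue_measure \x lebesgue_measure)%E (fun p : R * R =>
    let: (xi, eta) := p in
    cexp (- 'i%C * (x * xi + y * eta)%:C
          - 'i%C * (z * (xi ^+ 2 + eta ^+ 2))%:C
          + 'i%C * (xi ^+ 3 - 3 * xi * eta ^+ 2)%:C)
    * (expR (- eps * (xi ^+ 2 + eta ^+ 2)))%:C).

(* The limit is only meaningful when it exists; existence has to be asserted
   separately. *)
Definition elliptic_umbilic (R : realType) (x y z : R) : R[i] :=
  lim (elliptic_umbilic_reg x y z eps @[eps --> 0^'+]).

(* Main.v *)
(* With a = 2z/3 and u = xi + z/3 the phase is i (u - a)^3 + i z^3/27 - 3 i u eta^2.
   The Gaussian integral over eta leaves, up to a constant factor, the integral
   over xi of e^(i (u - a)^3 - eps xi^2) / sigma, where sigma^2 = eps + 3 i u.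
   Along this contour d xi / sigma is proportional to d sigma and u to
   sigma^2 - eps, so the integrand becomes entire in sigma. The contour is one
   branch of a hyperbola; it is opened up to the branch with asymptotes in the
   directions e^(+-i pi/3), where the cubic term gives absolute convergence
   uniformly in eps. As eps -> 0 it degenerates to two rays, and there remain
   two integrals over the real line of exp (- (x^2 - mu a)^3) with mu^3 = - i.

   As functions of a both solve F''' = - 3 i (a^2 F'' + 3 a F' + 3/4 F), whose
   power series solutions with exponents 0 and 1 are the two 2F2 series. The
   partial sums of these series solve the equation up to a small error, so
   Gronwall's inequality identifies F. Its initial values are moments of
   e^(-x^6), which are Gamma (5/6) and Gamma (7/6) up to rational factors; the
   product of the two moments is found from a double integral. *)

(* The choice x = - z^2/3 completes the cube: xi^3 - z xi^2 + z^2 xi / 3 = (xi - z/3)^3 + z^3/27. On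
   the original contour sigma tends to the directions e^(+-i pi/4), where sigma^6 is imaginary, so
   only e^(- eps xi^2) makes the integrand decay and eps -> 0 cannot be taken under the integral. In
   the directions e^(+-i pi/3), sigma^6 is positive. Contours are moved by differentiating in the
   deformation parameter l: if w is analytic in sigma, then d/dl (sigma_x w(sigma)) = d/dx (sigma_l
   w(sigma)), and the integral of the right side is 0. Gaussian majorants uniform in the parameter
   justify every such step. The third-order equation has one more solution, with exponent 2. It is
   absent because the contributions of the two rays to the second derivative at a = 0 cancel. The
   two moments appear as factors, while the theorem has reciprocals of the other Gamma value; the
   known product of the moments exchanges the one form for the other. *)
Require Import Defs.
From mathcomp Require Import measurable_realfun.
From mathcomp Require Import ring lra.
Set Implicit Arguments.
Unset Strict Implicit.
Unset Printing Implicit Defensive.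

Import Order.TTheory GRing.Theory Num.Theory.
Import numFieldNormedType.Exports.
Import ComplexField.Normc.

Local Open Scope classical_set_scope.
Local Open Scope ring_scope.
Local Open Scope complex_scope.

(** * Integration on the real line *)

Section RealLine.
Context {R : realType}.
Implicit Types (f g F G : R -> R).
Let mu := @lebesgue_measure R.

Definition lintegrable f := mu.-integrable setT (EFin \o f).

Lemma lintegrableP f g : measurable_fun setT f -> lintegrable g ->
  (forall x, `|f x| <= g x) -> lintegrable f.
Proof.
move=> mf ig fg; apply: (le_integrable _ _ _ ig) => //.
  exact/measurable_EFinP.
move=> x _ /=; rewrite lee_fin; apply: le_trans (fg x) _.
exact: ler_norm.
Qed.

Lemma lintegrableD f g : lintegrable f -> lintegrable g ->
  lintegrable (fun x => f x + g x).
Proof. by move=> fi gi; have := integrableD measurableT fi gi. Qed.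

Lemma lintegrableZ (c : R) f : lintegrable f -> lintegrable (fun x => c * f x).
Proof. by move=> fi; have := integrableZl measurableT c fi. Qed.

Lemma integral_EFin f : lintegrable f ->
  (\int[mu]_x (f x)%:E)%E = (\int[mu]_x f x)%:E.
Proof. by move=> fi; rewrite /Rintegral fineK//; exact: integrable_fin_num fi. Qed.

Lemma RintegralZ (c : R) f : lintegrable f ->
  \int[mu]_x (c * f x) = c * \int[mu]_x f x.
Proof. by move=> fi; rewrite RintegralZl. Qed.

Lemma cvg_Rintegral_itv f (a b : nat -> R) : lintegrable f ->
  a n @[n --> \oo] --> -oo -> b n @[n --> \oo] --> +oo ->
  \int[mu]_(x in `[a n, b n]) f x @[n --> \oo] --> \int[mu]_x f x.
Proof.
move=> fi aNy byy.
have mf : measurable_fun setT f by case/integrableP : fi => /measurable_EFinP.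
have [] := @dominated_convergence _ _ _ mu setT measurableT
  (fun n x => (f \_ `[a n, b n] x)%:E) (EFin \o f) (fun x => `|(f x)%:E|%E).
- move=> n; apply/measurable_EFinP; apply/measurable_restrict => //.
  by rewrite setTI; exact: measurable_funTS.
- exact/measurable_EFinP.
- apply: aeW => x _; apply: cvg_near_cst.
  have A : \forall n \near \oo, a n <= x.
    by move/cvgrNyPle : aNy; exact.
  have B : \forall n \near \oo, x <= b n.
    by move/cvgryPge : byy; exact.
  near=> n; rewrite patchE mem_set//= in_itv/=; apply/andP; split; near: n => //.
- exact: integrable_abse.
- apply: aeW => x n _; rewrite patchE; case: ifPn => _ //=.
  by rewrite lee_fin normr0.
move=> _ _.
rewrite -(fineK (integrable_fin_num _ fi))// => /fine_cvg h.
apply: cvg_trans; last exact: h.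
apply: near_eq_cvg; apply: nearW => n /=.
by rewrite Rintegral_mkcond.
Unshelve. all: end_near. Qed.

Lemma is_derive1_continuous f (f' : R -> R) : (forall x : R, is_derive x 1 f (f' x)) ->
  continuous f.
Proof.
move=> df x; apply: differentiable_continuous; apply/derivable1_diffP.
by have [] := df x.
Qed.

Lemma Rintegral_itv_FTC F f (a b : R) : a < b ->
  (forall x : R, is_derive x 1 F (f x)) -> continuous f ->
  \int[mu]_(x in `[a, b]) f x = F b - F a.
Proof.
move=> ab dF cf.
have cF := is_derive1_continuous dF.
rewrite /Rintegral (continuous_FTC2 (F := F) ab)//.
- exact: continuous_subspaceT.
- split.
  + by move=> x _; have [] := dF x.
  + by apply: cvg_at_right_filter; exact: cF.
  + by apply: cvg_at_left_filter; exact: cF.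
- by move=> x _; rewrite derive1E; have [_ ->] := dF x.
Qed.

Lemma Rintegral_derive_vanish F f : (forall x : R, is_derive x 1 F (f x)) ->
  continuous f -> lintegrable f ->
  F x @[x --> +oo] --> 0 -> F x @[x --> -oo] --> 0 ->
  \int[mu]_x f x = 0.
Proof.
move=> dF cf fi Fy FNy.
(* The endpoints are n + 1 and not n, so that no interval is degenerate: the fundamental theorem
   above asks for a < b. *)
have ny : (n.+1%:R : R) @[n --> \oo] --> +oo.
  by apply/cvgryPge => A; near=> n; apply: le_trans (_ : n%:R <= _);
    [near: n; exact: nbhs_infty_ger|rewrite ler_nat].
have nNy : - (n.+1%:R : R) @[n --> \oo] --> -oo.
  by move/cvgNrNy : ny.
have := cvg_Rintegral_itv fi nNy ny.
have -> : (fun n => \int[mu]_(x in `[- n.+1%:R, n.+1%:R]) f x) =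
   (fun n => F n.+1%:R - F (- n.+1%:R)).
  apply/funext => n; apply: Rintegral_itv_FTC => //.
  by rewrite gtrN.
move=> h.
have h2 : (fun n => F n.+1%:R - F (- n.+1%:R)) @ \oo --> (0 - 0 : R).
  apply: cvgB.
  - exact: cvg_comp ny Fy.
  - exact: cvg_comp nNy FNy.
have := cvg_unique _ h h2.
rewrite subr0; apply.
exact: norm_hausdorff.
Unshelve. all: end_near. Qed.

(** [G] may change sign, so the substitution is made on [-n-1, n+1], where it needs only continuity.
    The intervals and their images exhaust the line, and integrability of both sides gives the
    limits. *)
Lemma Rintegral_change_of_variable G F (F' : R -> R) :
  {homo F : x y / x < y} -> (forall x : R, is_derive x 1 F (F' x)) ->
  continuous F' -> continuous G ->
  F x @[x --> +oo] --> +oo -> F x @[x --> -oo] --> -oo ->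
  lintegrable G -> lintegrable (fun x => G (F x) * F' x) ->
  \int[mu]_x G x = \int[mu]_x (G (F x) * F' x).
Proof.
move=> incF dF cF' cG Fy FNy Gi GFi.
have ny : (n.+1%:R : R) @[n --> \oo] --> +oo.
  by apply/cvgryPge => A; near=> n; apply: le_trans (_ : n%:R <= _);
    [near: n; exact: nbhs_infty_ger|rewrite ler_nat].
have nNy : - (n.+1%:R : R) @[n --> \oo] --> -oo.
  by move/cvgNrNy : ny.
have h := cvg_Rintegral_itv GFi nNy ny.
have h2 : \int[mu]_(x in `[F (- n.+1%:R), F n.+1%:R]) G x @[n --> \oo]
    --> \int[mu]_x G x.
  apply: cvg_Rintegral_itv => //.
  - exact: cvg_comp nNy FNy.
  - exact: cvg_comp ny Fy.
have cF := is_derive1_continuous dF.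
have F'E : derive1 F = F'.
  by apply/funext => x; rewrite derive1E; have [_ ->] := dF x.
move: h2; rewrite (_ : (fun n => _) =
   (fun n => \int[mu]_(x in `[- n.+1%:R, n.+1%:R]) (G (F x) * F' x))); last first.
  apply/funext => n; rewrite /Rintegral integration_by_substitution_increasing ?F'E//.
  - by rewrite lerNl (le_trans _ (ler0n _ _))// oppr_le0.
  - by move=> x y _ _; exact: incF.
  - apply/cvg_ex; exists (F' (- n.+1%:R)).
    by apply: cvg_at_right_filter; exact: cF'.
  - apply/cvg_ex; exists (F' (n.+1%:R)).
    by apply: cvg_at_left_filter; exact: cF'.
  - split.
    + by move=> x _; have [] := dF x.
    + by apply: cvg_at_right_filter; exact: cF.
    + by apply: cvg_at_left_filter; exact: cF.
  - exact: continuous_subspaceT.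
by move=> h2; apply: cvg_unique h2 h; exact: norm_hausdorff.
Unshelve. all: end_near. Qed.

(** Stated for the extended integral of a nonnegative function, hence usable before integrability is
    known; integrability of the Gaussians is obtained from it. *)
Lemma integral_scale f (c : R) : 0 < c -> continuous f ->
  (forall x, 0 <= f x) ->
  (\int[mu]_x (f x)%:E = \int[mu]_x (f (c * x) * c)%:E)%E.
Proof.
move=> c0 cf f0.
have dF (x : R) : is_derive x 1 (fun x => c * x) c.
  have : is_derive x 1 (c \*: id) (c *: 1) by exact: is_deriveZ.
  by rewrite /GRing.scale/= mulr1.
have F'E : derive1 (fun x : R => c * x) = cst c.
  by apply/funext => x; rewrite derive1E; have [_ ->] := dF x.
rewrite (@increasing_ge0_integration_by_substitutionT _ (fun x => c * x) f).
- by apply: eq_integral => x _; rewrite F'E.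
- by move=> x y xy; rewrite ltr_pM2l.
- by rewrite F'E; exact: cst_continuous.
- by rewrite F'E; exact: is_cvg_cst.
- by rewrite F'E; exact: is_cvg_cst.
- by move=> x; have [] := dF x.
- exact: gt0_cvgMrNy.
- exact: gt0_cvgMry.
- exact: cf.
- exact: f0.
Qed.

End RealLine.

(** * Complex-valued functions of a real variable *)

Section ComplexParts.
Context {R : realType}.
Implicit Types (x y w : R[i]).
Local Notation Re := complex.Re.
Local Notation Im := complex.Im.

Lemma complex_ext x y : Re x = Re y -> Im x = Im y -> x = y.
Proof. by case: x y => [a b] [c d] /= -> ->. Qed.
Lemma cReD x y : Re (x + y) = Re x + Re y. Proof. by case: x y => [? ?] []. Qed.
Lemma cImD x y : Im (x + y) = Im x + Im y. Proof. by case: x y => [? ?] []. Qed.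
Lemma cReN x : Re (- x) = - Re x. Proof. by case: x. Qed.
Lemma cImN x : Im (- x) = - Im x. Proof. by case: x. Qed.
Lemma cReM x y : Re (x * y) = Re x * Re y - Im x * Im y.
Proof. by case: x y => [? ?] []. Qed.
Lemma cImM x y : Im (x * y) = Re x * Im y + Im x * Re y.
Proof. by case: x y => [? ?] []. Qed.
Lemma cReRM (a : R) x : Re (a%:C * x) = a * Re x.
Proof. by rewrite cReM/= mul0r subr0. Qed.
Lemma cImRM (a : R) x : Im (a%:C * x) = a * Im x.
Proof. by rewrite cImM/= mul0r addr0. Qed.
Definition ReImE := (cReRM, cImRM, cReM, cImM, cReD, cImD, cReN, cImN).

Lemma normcD x y : normc (x + y) <= normc x + normc y.
Proof. by rewrite -lecR rmorphD/=; exact: (@ComplexField.lec_normD R x y). Qed.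

Lemma normcN x : normc (- x) = normc x.
Proof. by case: x => a b /=; rewrite !sqrrN. Qed.

Lemma normc_ge0 x : 0 <= normc x.
Proof. by case: x => a b; exact: sqrtr_ge0. Qed.

Lemma normcR (a : R) : normc a%:C = `|a|.
Proof. by rewrite /= expr0n/= addr0 sqrtr_sqr. Qed.

Lemma normcI : normc ('i%C : R[i]) = 1.
Proof. by rewrite /= expr0n/= expr1n add0r sqrtr1. Qed.

Lemma normcX x n : normc (x ^+ n) = normc x ^+ n.
Proof. by elim: n => [|n ih]; rewrite ?expr0 ?normc1// !exprS normcM ih. Qed.

Lemma normc_nat n : normc (n%:R : R[i]) = n%:R.
Proof. by rewrite -(rmorph_nat (real_complex R)) normcR normr_nat. Qed.

Lemma sqr_normc_ReIm x : normc x ^+ 2 = Re x ^+ 2 + Im x ^+ 2.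
Proof. by case: x => a b /=; rewrite sqr_sqrtr// addr_ge0 ?sqr_ge0. Qed.

Lemma normr_Re_le x : `|Re x| <= normc x.
Proof.
by case: x => a b /=; rewrite -sqrtr_sqr ler_wsqrtr// lerDl sqr_ge0.
Qed.

Lemma normr_Im_le x : `|Im x| <= normc x.
Proof.
by case: x => a b /=; rewrite -sqrtr_sqr ler_wsqrtr// lerDr sqr_ge0.
Qed.

Lemma normc_le_ReIm x : normc x <= `|Re x| + `|Im x|.
Proof.
case: x => a b /=; rewrite -[leRHS]ger0_norm ?addr_ge0//.
rewrite -sqrtr_sqr ler_wsqrtr// sqrrD !real_normK ?num_real//.
by rewrite -addrA lerD2l lerDr mulrn_wge0// mulr_ge0.
Qed.

Lemma normc_cexp w : normc (cexp w) = expR (Re w).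
Proof.
rewrite /cexp normcM normcR ger0_norm ?expR_ge0//.
by rewrite /= cos2Dsin2 sqrtr1 mulr1.
Qed.

Lemma cexpD x y : cexp (x + y) = cexp x * cexp y.
Proof.
rewrite /cexp !cReD !cImD expRD rmorphM/= cosD sinD.
by apply: complex_ext; rewrite !ReImE/=; ring.
Qed.

Lemma cexp_real (a : R) : cexp a%:C = (expR a)%:C.
Proof. by rewrite /cexp/= cos0 sin0 mulr1. Qed.

End ComplexParts.

Section ComplexCalculus.
Context {R : realType}.
Implicit Types (f g : R -> R[i]) (x : R).
Local Notation Re := complex.Re.
Local Notation Im := complex.Im.

(* [R[i]] is not a normed module over [R], so differentiability of a curve is
   stated componentwise. *)
Definition cderiv f x (d : R[i]) :=
  is_derive x 1 (fun t => Re (f t)) (Re d) /\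
  is_derive x 1 (fun t => Im (f t)) (Im d).

Definition ccont f :=
  continuous (fun t => Re (f t)) /\ continuous (fun t => Im (f t)).

Lemma cderiv_eq f x d d' : cderiv f x d -> d = d' -> cderiv f x d'.
Proof. by move=> h <-. Qed.

Lemma cderiv_ext f g x d : f =1 g -> cderiv f x d -> cderiv g x d.
Proof. by move=> /funext ->. Qed.

Lemma cderiv_cst (c : R[i]) x : cderiv (fun=> c) x 0.
Proof. by split; exact: is_derive_cst. Qed.

Lemma cderivD f g x df dg : cderiv f x df -> cderiv g x dg ->
  cderiv (fun t => f t + g t) x (df + dg).
Proof.
move=> [f1 f2] [g1 g2]; split; rewrite !ReImE.
- rewrite (_ : (fun t => _) = (fun t => Re (f t)) \+ (fun t => Re (g t))).
    exact: is_deriveD.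
  by apply/funext => t; rewrite cReD.
- rewrite (_ : (fun t => _) = (fun t => Im (f t)) \+ (fun t => Im (g t))).
    exact: is_deriveD.
  by apply/funext => t; rewrite cImD.
Qed.

Lemma cderivN f x df : cderiv f x df -> cderiv (fun t => - f t) x (- df).
Proof.
move=> [f1 f2]; split; rewrite !ReImE.
- rewrite (_ : (fun t => _) = - (fun t => Re (f t))); first exact: is_deriveN.
  by apply/funext => t; rewrite cReN.
- rewrite (_ : (fun t => _) = - (fun t => Im (f t))); first exact: is_deriveN.
  by apply/funext => t; rewrite cImN.
Qed.

Lemma cderivB f g x df dg : cderiv f x df -> cderiv g x dg ->
  cderiv (fun t => f t - g t) x (df - dg).
Proof. by move=> hf hg; apply: cderivD => //; exact: cderivN. Qed.

Lemma cderivM f g x df dg : cderiv f x df -> cderiv g x dg ->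
  cderiv (fun t => f t * g t) x (df * g x + f x * dg).
Proof.
move=> [f1 f2] [g1 g2]; split.
- rewrite (_ : (fun t => _) = ((fun t => Re (f t)) * (fun t => Re (g t)))
     - ((fun t => Im (f t)) * (fun t => Im (g t)))); last first.
    by apply/funext => t; rewrite cReM.
  apply: is_derive_eq; rewrite !ReImE /= /GRing.scale/=; ring.
- rewrite (_ : (fun t => _) = ((fun t => Re (f t)) * (fun t => Im (g t)))
     + ((fun t => Im (f t)) * (fun t => Re (g t)))); last first.
    by apply/funext => t; rewrite cImM.
  apply: is_derive_eq; rewrite !ReImE /= /GRing.scale/=; ring.
Qed.

Lemma cderivZ (c : R[i]) f x df : cderiv f x df ->
  cderiv (fun t => c * f t) x (c * df).
Proof.
move=> hf; apply: cderiv_eq; first exact: cderivM (cderiv_cst c x) hf.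
by rewrite mul0r add0r.
Qed.

Lemma cderivX f n x df : cderiv f x df ->
  cderiv (fun t => f t ^+ n) x (n%:R * f x ^+ n.-1 * df).
Proof.
move=> hf; elim: n => [|n ih].
  by rewrite !mul0r; exact: cderiv_cst.
apply: (@cderiv_ext (fun t => f t * f t ^+ n)); first by move=> t; rewrite exprS.
apply: cderiv_eq; first exact: cderivM hf ih.
case: n {ih} => [|n] /=; first by rewrite !mul0r mulr0 expr0; ring.
rewrite -natr1 !exprS; ring.
Qed.

Lemma cderiv_real (h : R -> R) x dh : is_derive x 1 h dh ->
  cderiv (fun t => (h t)%:C) x dh%:C.
Proof. by move=> hh; split => //=; exact: is_derive_cst. Qed.

Lemma cderiv_id x : cderiv (fun t => t%:C) x 1.
Proof. exact: cderiv_real (is_derive_id x 1). Qed.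

Lemma cderiv_cexp f x df : cderiv f x df ->
  cderiv (fun t => cexp (f t)) x (df * cexp (f x)).
Proof.
move=> [f1 f2].
have e1 : is_derive x 1 (fun t => expR (Re (f t))) (expR (Re (f x)) * Re df).
  exact: is_derive1_comp (is_derive_expR _) f1.
have c1 : is_derive x 1 (fun t => cos (Im (f t))) (- sin (Im (f x)) * Im df).
  exact: is_derive1_comp (is_derive_cos _) f2.
have s1 : is_derive x 1 (fun t => sin (Im (f t))) (cos (Im (f x)) * Im df).
  exact: is_derive1_comp (is_derive_sin _) f2.
have h1 := cderiv_real e1.
have h2 : cderiv (fun t => cos (Im (f t)) +i* sin (Im (f t))) x
  ((- sin (Im (f x)) * Im df) +i* (cos (Im (f x)) * Im df)) by split.
apply: cderiv_eq; first exact: cderivM h1 h2.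
by rewrite /cexp; apply: complex_ext; rewrite !ReImE/=; ring.
Qed.

Lemma cderiv_ccont f df : (forall x, cderiv f x (df x)) -> ccont f.
Proof.
move=> h; split.
- by apply: (is_derive1_continuous (f' := fun x => Re (df x))) => x; case: (h x).
- by apply: (is_derive1_continuous (f' := fun x => Im (df x))) => x; case: (h x).
Qed.

Lemma ccont_ext f g : f =1 g -> ccont f -> ccont g.
Proof. by move=> /funext ->. Qed.

Lemma ccont_cst (c : R[i]) : ccont (fun=> c).
Proof. by split; exact: cst_continuous. Qed.

Lemma ccontD f g : ccont f -> ccont g -> ccont (fun t => f t + g t).
Proof.
move=> [f1 f2] [g1 g2]; split => x; under eq_fun do rewrite !ReImE.
  by apply: cvgD; [exact: f1|exact: g1].
by apply: cvgD; [exact: f2|exact: g2].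
Qed.

Lemma ccontN f : ccont f -> ccont (fun t => - f t).
Proof.
move=> [f1 f2]; split => x; under eq_fun do rewrite !ReImE.
  by apply: cvgN; exact: f1.
by apply: cvgN; exact: f2.
Qed.

Lemma ccontM f g : ccont f -> ccont g -> ccont (fun t => f t * g t).
Proof.
move=> [f1 f2] [g1 g2]; split => x; under eq_fun do rewrite !ReImE.
  by apply: cvgB; apply: cvgM; [exact: f1|exact: g1|exact: f2|exact: g2].
by apply: cvgD; apply: cvgM; [exact: f1|exact: g2|exact: f2|exact: g1].
Qed.

Lemma ccontX f n : ccont f -> ccont (fun t => f t ^+ n).
Proof.
move=> hf; elim: n => [|n ih]; first exact: ccont_cst.
by apply: ccont_ext (ccontM hf ih) => t; rewrite exprS.
Qed.

Lemma ccont_real (h : R -> R) : continuous h -> ccont (fun t => (h t)%:C).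
Proof. by move=> ch; split => //=; exact: cst_continuous. Qed.

Lemma ccont_cexp f : ccont f -> ccont (fun t => cexp (f t)).
Proof.
move=> [f1 f2]; apply: ccontM.
  apply: ccont_real => x; apply: continuous_comp; first exact: f1.
  exact: continuous_expR.
split => /= x; apply: continuous_comp; try exact: f2.
  exact: continuous_cos.
exact: continuous_sin.
Qed.

End ComplexCalculus.

Section Gaussian.
Context {R : realType}.
Let mu := @lebesgue_measure R.

Lemma integral_gauss_scale (c : R) : 0 < c ->
  (\int[mu]_x (expR (- (c ^+ 2 * x ^+ 2)))%:E = (Num.sqrt pi / c)%:E)%E.
Proof.
move=> c0.
have := @integralT_gauss R.
rewrite (integral_scale c0 (@continuous_gauss_fun R) (@gauss_fun_ge0 R)) => h.
rewrite EFinM -h muleC -ge0_integralZl//=.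
- apply: eq_integral => x _; rewrite -EFinM; congr EFin.
  by rewrite /gauss_fun exprMn [RHS]mulrCA mulVf ?gt_eqF// mulr1.
- apply/measurable_EFinP; apply: measurable_funM => //.
  apply: measurableT_comp; first exact: measurable_gauss_fun.
  exact: measurable_funM.
- by move=> x _; rewrite lee_fin mulr_ge0 ?gauss_fun_ge0// ltW.
- by rewrite lee_fin invr_ge0 ltW.
Qed.

Lemma Rintegral_gauss_scale (c : R) : 0 < c ->
  \int[mu]_x expR (- (c ^+ 2 * x ^+ 2)) = Num.sqrt pi / c.
Proof. by move=> c0; rewrite /Rintegral integral_gauss_scale. Qed.

Lemma continuous_gauss_scale (c : R) : continuous (fun x : R => expR (- (c * x ^+ 2))).
Proof.
move=> x; apply: continuous_comp; last exact: continuous_expR.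
apply: cvgN; apply: cvgM; first exact: cvg_cst.
exact: exprn_continuous.
Qed.

Lemma lintegrable_gauss (c : R) : 0 < c ->
  lintegrable (fun x : R => expR (- (c * x ^+ 2))).
Proof.
move=> c0; apply/integrableP; split.
  apply/measurable_EFinP; apply: continuous_measurable_fun.
  exact: continuous_gauss_scale.
under eq_integral => x _ do rewrite /= ger0_norm ?expR_ge0//.
have := @integral_gauss_scale (Num.sqrt c).
rewrite sqr_sqrtr ?ltW// => ->; last by rewrite sqrtr_gt0.
by rewrite ltry.
Qed.

Lemma cvg_gauss_scale (c : R) : 0 < c ->
  expR (- (c * x ^+ 2) : R) @[x --> +oo] --> 0.
Proof.
move=> c0; apply: (cvg_comp (fun x => c * x ^+ 2) (fun x => expR (- x))).
  by apply: gt0_cvgMry => //; exact: cvgr_expr2.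
exact: cvgr_expR.
Qed.

Lemma cvgNy_gauss_scale (c : R) : 0 < c ->
  expR (- (c * x ^+ 2) : R) @[x --> -oo] --> 0.
Proof.
move=> c0; have := cvg_gauss_scale c0.
move/cvgy_compNP; apply: cvg_trans; apply: near_eq_cvg; apply: nearW => x /=.
by rewrite sqrrN.
Qed.

End Gaussian.

(** * Integrals of complex-valued functions with Gaussian majorants *)

Section ComplexIntegral.
Context {R : realType}.
Implicit Types (f g : R -> R[i]).
Local Notation Re := complex.Re.
Local Notation Im := complex.Im.
Let mu := @lebesgue_measure R.
Definition cint f := cintegral (@lebesgue_measure R) f.

Definition cintegrable f :=
  lintegrable (fun t => Re (f t)) /\ lintegrable (fun t => Im (f t)).

Lemma eq_cint f g : f =1 g -> cint f = cint g.
Proof. by move=> /funext ->. Qed.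

Lemma cintegrableD f g : cintegrable f -> cintegrable g ->
  cintegrable (fun t => f t + g t).
Proof.
move=> [f1 f2] [g1 g2]; split; under eq_fun do rewrite ReImE.
  exact: lintegrableD.
exact: lintegrableD.
Qed.

Lemma cintegrableZ (c : R[i]) f : cintegrable f -> cintegrable (fun t => c * f t).
Proof.
move=> [f1 f2]; split.
  under eq_fun do rewrite cReM -mulNr.
  by apply: lintegrableD; exact: lintegrableZ.
under eq_fun do rewrite cImM.
by apply: lintegrableD; exact: lintegrableZ.
Qed.

Lemma cintD f g : cintegrable f -> cintegrable g ->
  cint (fun t => f t + g t) = cint f + cint g.
Proof.
move=> [f1 f2] [g1 g2]; apply: complex_ext; rewrite !ReImE /=.
  by under eq_Rintegral do rewrite cReD; rewrite RintegralD.
by under eq_Rintegral do rewrite cImD; rewrite RintegralD.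
Qed.

Lemma cintZ (c : R[i]) f : cintegrable f -> cint (fun t => c * f t) = c * cint f.
Proof.
move=> [f1 f2]; apply: complex_ext; rewrite !ReImE /=.
  under eq_Rintegral do rewrite cReM -mulNr.
  rewrite RintegralD//; [|exact: lintegrableZ..].
  by rewrite !RintegralZl// mulNr.
under eq_Rintegral do rewrite cImM.
rewrite RintegralD//; [|exact: lintegrableZ..].
by rewrite !RintegralZl.
Qed.

(** A single condition that gives integrability when imposed on an integrand and decay at both ends
    when imposed on a primitive. *)
Definition gdom f := exists C c : R, 0 < c /\
  forall x, normc (f x) <= C * expR (- (c * x ^+ 2)).

Lemma lintegrable_gdom (C c : R) : 0 < c ->
  lintegrable (fun x => C * expR (- (c * x ^+ 2))).
Proof. by move=> c0; apply: lintegrableZ; exact: lintegrable_gauss. Qed.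

Lemma gdom_cintegrable f : ccont f -> gdom f -> cintegrable f.
Proof.
move=> [f1 f2] [C [c [c0 fC]]]; have gi := lintegrable_gdom C c0; split.
- apply: lintegrableP gi _; first exact: continuous_measurable_fun.
  by move=> x; rewrite (le_trans (normr_Re_le _)).
- apply: lintegrableP gi _; first exact: continuous_measurable_fun.
  by move=> x; rewrite (le_trans (normr_Im_le _)).
Qed.

Lemma cvg0_gauss (h : R -> R) (C c : R) : 0 < c ->
  (forall x, `|h x| <= C * expR (- (c * x ^+ 2))) ->
  h x @[x --> +oo] --> 0 /\ h x @[x --> -oo] --> 0.
Proof.
move=> c0 hC; split; apply: norm_cvg0.
- apply: (@squeeze_cvgr _ _ _ _ (cst 0) (fun x => C * expR (- (c * x ^+ 2)))).
  + by apply: nearW => x /=; rewrite normr_ge0 hC.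
  + exact: cvg_cst.
  + by rewrite -(mulr0 C); apply: cvgM; [exact: cvg_cst|exact: cvg_gauss_scale].
- apply: (@squeeze_cvgr _ _ _ _ (cst 0) (fun x => C * expR (- (c * x ^+ 2)))).
  + by apply: nearW => x /=; rewrite normr_ge0 hC.
  + exact: cvg_cst.
  + by rewrite -(mulr0 C); apply: cvgM; [exact: cvg_cst|exact: cvgNy_gauss_scale].
Qed.

Lemma cint_derive_vanish f F : (forall x, cderiv F x (f x)) -> ccont f ->
  gdom f -> gdom F -> cint f = 0.
Proof.
move=> dF cf gf [C [c [c0 FC]]]; have [fi1 fi2] := gdom_cintegrable cf gf.
case: cf => cf1 cf2.
have [||F1 F2] := @cvg0_gauss (fun t => Re (F t)) C c => //.
  by move=> x; rewrite (le_trans (normr_Re_le _)).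
have [||F3 F4] := @cvg0_gauss (fun t => Im (F t)) C c => //.
  by move=> x; rewrite (le_trans (normr_Im_le _)).
apply: complex_ext => /=.
  by apply: Rintegral_derive_vanish F1 F2 => // x; case: (dF x).
by apply: Rintegral_derive_vanish F3 F4 => // x; case: (dF x).
Qed.

Lemma is_derive_Rintegral (h h' : R -> R -> R) (g : R -> R) (u v t0 : R) :
  u < t0 < v ->
  (forall t, u < t < v -> lintegrable (h t)) ->
  (forall t x, u < t < v -> is_derive t 1 (h ^~ x) (h' t x)) ->
  (forall t x, u < t < v -> `|h' t x| <= g x) -> lintegrable g ->
  is_derive t0 1 (fun t => \int[mu]_x h t x) (\int[mu]_x h' t0 x).
Proof.
move=> uv hi dh hg gi.
have uvI t : `]u, v[%classic t -> u < t < v by rewrite /= in_itv.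
have I0 : `]u, v[%classic t0 by rewrite /= in_itv.
have p1E t x : u < t < v -> partial1of2 h t x = h' t x.
  by move=> tuv; rewrite partial1of2E; have [_ ->] := dh t x tuv.
have g0 x : 0 <= g x by rewrite (le_trans _ (hg _ x uv)).
apply: DeriveDef.
  apply: (@derivable_under_integral _ _ _ mu h setT measurableT t0 u v I0 _ _ g g0 gi).
  - by move=> t /uvI; exact: hi.
  - by move=> t x /uvI tuv _; have [] := dh t x tuv.
  - by move=> t x /uvI tuv _; rewrite p1E// hg.
rewrite -derive1E (@differentiation_under_integral _ _ _ mu h setT measurableT t0 u v I0 _ _ g g0 gi).
- by apply: eq_Rintegral => x _; exact: p1E.
- by move=> t /uvI; exact: hi.
- by move=> t x /uvI tuv _; have [] := dh t x tuv.
- by move=> t x /uvI tuv _; rewrite p1E// hg.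
Qed.

Lemma cderiv_cint (h h' : R -> R -> R[i]) (u v t0 C c : R) :
  u < t0 < v ->
  (forall t, u < t < v -> cintegrable (h t)) ->
  (forall t x, u < t < v -> cderiv (h ^~ x) t (h' t x)) ->
  0 < c ->
  (forall t x, u < t < v -> normc (h' t x) <= C * expR (- (c * x ^+ 2))) ->
  cderiv (fun t => cint (h t)) t0 (cint (h' t0)).
Proof.
move=> uv hi dh c0 hC; have gi := lintegrable_gdom C c0; split => /=.
- apply: (@is_derive_Rintegral (fun t x => Re (h t x))
    (fun t x => Re (h' t x)) _ u v t0 uv _ _ _ gi).
  + by move=> t tuv; have [] := hi t tuv.
  + by move=> t x tuv; have [] := dh t x tuv.
  + by move=> t x tuv; rewrite (le_trans (normr_Re_le _))// hC.
- apply: (@is_derive_Rintegral (fun t x => Im (h t x))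
    (fun t x => Im (h' t x)) _ u v t0 uv _ _ _ gi).
  + by move=> t tuv; have [] := hi t tuv.
  + by move=> t x tuv; have [] := dh t x tuv.
  + by move=> t x tuv; rewrite (le_trans (normr_Im_le _))// hC.
Qed.

Lemma is_derive0_const_oo (h : R -> R) (u v s t : R) :
  (forall x, u < x < v -> is_derive x 1 h 0) -> u < s < v -> u < t < v ->
  h s = h t.
Proof.
move=> dh; wlog st : s t / s < t => [wl|].
  by case: (ltgtP s t) => [st|ts|-> //] su tu; [exact: wl|symmetry; exact: wl].
move=> /andP[us sv] /andP[ut tv].
have itv x : s <= x <= t -> u < x < v.
  by move=> /andP[sx xt]; rewrite (lt_le_trans us sx) (le_lt_trans xt tv).
have dh' x : x \in `]s, t[ -> is_derive x 1 h (cst 0 x).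
  by rewrite in_itv/= => /andP[sx xt]; apply: dh; apply: itv; rewrite !ltW.
have [|c _] := MVT st dh'.
  apply: derivable_within_continuous => x; rewrite in_itv/= => xst.
  by have [] := dh x (itv _ xst).
by rewrite /= mul0r => /eqP; rewrite subr_eq0 => /eqP ->.
Qed.

End ComplexIntegral.

(** * Bounds uniform in a parameter, and deformation of integrals *)

Section Bounds.
Context {R : realType}.
Implicit Types (x : R).

(** Polynomial growth, uniformly over parameters in [D]. The base 1 + x^2 is at least 1, so two
    bounds with different exponents can be brought to a common exponent and added. *)
Definition pbound (T : Type) (D : T -> Prop) (f : T -> R -> R[i]) :=
  exists C n, forall t x, D t -> normc (f t x) <= C * (1 + x ^+ 2) ^+ n.

Definition gbound (T : Type) (D : T -> Prop) (f : T -> R -> R[i]) :=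
  exists C c : R, 0 < c /\
    forall t x, D t -> normc (f t x) <= C * expR (- (c * x ^+ 2)).

Lemma ge1_1Dsqr x : 1 <= 1 + x ^+ 2.
Proof. by rewrite lerDl sqr_ge0. Qed.

(** Each factor 1 + x^2 is paid for with half of the remaining exponent, through 1 + u <= e^u. *)
Lemma expR_absorb (c : R) n : 0 < c ->
  exists C : R, 0 <= C /\ forall x, (1 + x ^+ 2) ^+ n <= C * expR (c * x ^+ 2).
Proof.
elim: n c => [|n ih] c c0.
  exists 1; split => // x; rewrite expr0 mul1r -expR0 ler_expR.
  by rewrite mulr_ge0 ?sqr_ge0// ltW.
have c20 : 0 < c / 2 by rewrite divr_gt0.
have [C [C0 hC]] := ih _ c20.
exists (C * (1 + (c / 2)^-1)); split.
  by rewrite mulr_ge0// addr_ge0// invr_ge0 ltW.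
move=> x; rewrite exprSr (_ : c * x ^+ 2 = c / 2 * x ^+ 2 + c / 2 * x ^+ 2); last first.
  by rewrite -mulrDl -splitr.
rewrite expRD mulrACA; apply: ler_pM => //.
- by rewrite exprn_ge0// (le_trans _ (ge1_1Dsqr x)).
- by rewrite (le_trans _ (ge1_1Dsqr x)).
have e1 := expR_ge1Dx (c / 2 * x ^+ 2).
have x2 := sqr_ge0 x.
have e2 : 0 <= c / 2 * x ^+ 2 by rewrite mulr_ge0// ltW.
rewrite mulrDl mul1r lerD//; first by lra.
rewrite -ler_pdivrMl ?invr_gt0// invrK; lra.
Qed.

Section Closure.
Variables (T : Type) (D : T -> Prop).
Implicit Types f g : T -> R -> R[i].

Lemma pboundP f : pbound D f -> exists C n, 0 <= C /\
  forall t x, D t -> normc (f t x) <= C * (1 + x ^+ 2) ^+ n.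
Proof.
move=> [C [n h]]; exists `|C|, n; split => // t x Dt.
rewrite (le_trans (h t x Dt))// ler_wpM2r ?ler_norm//.
by rewrite exprn_ge0// (le_trans _ (ge1_1Dsqr x)).
Qed.

Lemma pbound_param f (M : R) : (forall t x, D t -> normc (f t x) <= M) -> pbound D f.
Proof. by move=> h; exists M, 0 => t x Dt; rewrite expr0 mulr1 h. Qed.

Lemma pbound_cst (c : R[i]) : pbound D (fun _ _ => c).
Proof. by apply: (@pbound_param _ (normc c)). Qed.

Lemma pbound_le f (h : T -> R -> R) : pbound D (fun t x => (h t x)%:C) ->
  (forall t x, D t -> normc (f t x) <= h t x) -> pbound D f.
Proof.
move=> [C [n hC]] fh; exists C, n => t x Dt; rewrite (le_trans (fh t x Dt))//.
by rewrite (le_trans _ (hC t x Dt))// normcR ler_norm.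
Qed.

Lemma pbound_id : pbound D (fun _ x => x%:C).
Proof.
exists 1, 1%N => _ x _; rewrite normcR expr1 mul1r.
have := sqr_ge0 (`|x| - 1); rewrite sqrrB real_normK ?num_real//.
have := sqr_ge0 x; lra.
Qed.

Lemma pboundD f g : pbound D f -> pbound D g -> pbound D (fun t x => f t x + g t x).
Proof.
move=> /pboundP[C [n [C0 hC]]] /pboundP[C' [n' [C'0 hC']]].
exists (C + C'), (n + n')%N => t x Dt.
rewrite (le_trans (normcD _ _))// mulrDl lerD//.
- rewrite (le_trans (hC t x Dt))// ler_wpM2l// ler_weXn2l ?ge1_1Dsqr//.
  exact: leq_addr.
- rewrite (le_trans (hC' t x Dt))// ler_wpM2l// ler_weXn2l ?ge1_1Dsqr//.
  exact: leq_addl.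
Qed.

Lemma pboundM f g : pbound D f -> pbound D g -> pbound D (fun t x => f t x * g t x).
Proof.
move=> /pboundP[C [n [C0 hC]]] /pboundP[C' [n' [C'0 hC']]].
exists (C * C'), (n + n')%N => t x Dt.
by rewrite normcM exprD mulrACA ler_pM ?normc_ge0 ?hC ?hC'.
Qed.

Lemma pboundN f : pbound D f -> pbound D (fun t x => - f t x).
Proof. by move=> [C [n h]]; exists C, n => t x Dt; rewrite normcN h. Qed.

Lemma pboundB f g : pbound D f -> pbound D g -> pbound D (fun t x => f t x - g t x).
Proof. by move=> hf hg; apply: pboundD => //; exact: pboundN. Qed.

Lemma pboundX f n : pbound D f -> pbound D (fun t x => f t x ^+ n).
Proof.
move=> hf; elim: n => [|n ih]; first exact: pbound_cst.
have [C [m h]] := pboundM hf ih.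
by exists C, m => t x Dt; rewrite exprS h.
Qed.

Lemma pbound_gbound f g : pbound D f -> gbound D g ->
  gbound D (fun t x => f t x * g t x).
Proof.
move=> /pboundP[C [n [C0 hC]]] [K [c [c0 hK]]].
have c20 : 0 < c / 2 by rewrite divr_gt0.
have [C' [C'0 hC']] := expR_absorb n c20.
exists (C * C' * `|K|), (c / 2); split => // t x Dt.
rewrite normcM.
have h1 : normc (f t x) <= C * (C' * expR (c / 2 * x ^+ 2)).
  by rewrite (le_trans (hC t x Dt))// ler_wpM2l.
have h2 : normc (g t x) <= `|K| * expR (- (c * x ^+ 2)).
  by rewrite (le_trans (hK t x Dt))// ler_wpM2r ?expR_ge0// ler_norm.
rewrite (le_trans (ler_pM (normc_ge0 _) (normc_ge0 _) h1 h2))//.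
have -> : - (c / 2 * x ^+ 2) = c / 2 * x ^+ 2 - c * x ^+ 2 by lra.
rewrite expRD le_eqVlt; apply/orP; left; apply/eqP; ring.
Qed.

Lemma gbound_gdom f t : gbound D f -> D t -> gdom (f t).
Proof. by move=> [C [c [c0 h]]] Dt; exists C, c; split => // x; exact: h. Qed.

Lemma gbound_ext f g : (forall t x, D t -> f t x = g t x) -> gbound D f -> gbound D g.
Proof.
by move=> fg [C [c [c0 h]]]; exists C, c; split => // t x Dt; rewrite -fg// h.
Qed.

End Closure.

Lemma cderiv_cint_gbound (h h' : R -> R -> R[i]) (u v t0 : R) :
  u < t0 < v ->
  (forall t, u < t < v -> cintegrable (h t)) ->
  (forall t x, u < t < v -> cderiv (h ^~ x) t (h' t x)) ->
  gbound (fun t => u < t < v) h' ->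
  cderiv (fun t => cint (h t)) t0 (cint (h' t0)).
Proof. by move=> uv hi dh [C [c [c0 hC]]]; exact: (cderiv_cint uv hi dh c0 hC). Qed.

(** This takes the place of Cauchy's theorem. The parameter derivative [h'] of the integrand is also
    the x-derivative of a decaying [G], so the derivative of the integral in the parameter is 0. *)
Lemma cint_homotopy (h h' G : R -> R -> R[i]) (u v : R) :
  (forall t, u < t < v -> ccont (h t)) ->
  (forall t, u < t < v -> ccont (h' t)) ->
  (forall t x, u < t < v -> cderiv (h ^~ x) t (h' t x)) ->
  (forall t x, u < t < v -> cderiv (G t) x (h' t x)) ->
  gbound (fun t => u < t < v) h ->
  gbound (fun t => u < t < v) h' ->
  gbound (fun t => u < t < v) G ->
  forall s t, u < s < v -> u < t < v -> cint (h s) = cint (h t).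
Proof.
move=> ch ch' dh dG hC h'C GC s t sI tI.
have d0 r : u < r < v -> cderiv (fun r => cint (h r)) r 0.
  move=> rI; apply: cderiv_eq.
    apply: (cderiv_cint_gbound rI _ dh h'C) => q qI.
    apply: gdom_cintegrable; [exact: ch|exact: gbound_gdom hC qI].
  apply: (@cint_derive_vanish _ _ (G r)).
  - by move=> x; exact: dG.
  - exact: ch'.
  - exact: gbound_gdom h'C rI.
  - exact: gbound_gdom GC rI.
apply: complex_ext.
  by apply: (@is_derive0_const_oo _ (fun r => complex.Re (cint (h r))) u v) => // r /d0[].
by apply: (@is_derive0_const_oo _ (fun r => complex.Im (cint (h r))) u v) => // r /d0[].
Qed.

End Bounds.

(** * The Gaussian integral with a complex coefficient *)

Section ComplexGaussian.
Context {R : realType}.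

Lemma normcRe_gt0 (a b : R) : 0 < a -> (a +i* b) != 0 :> R[i].
Proof. by move=> a0; rewrite eq_complex/= negb_and gt_eqF. Qed.

(* The integral [\int sigma e^(- sigma^2 y^2) dy] does not change when [sigma]
   moves away from the real axis. *)
Lemma cint_gauss (a b : R) : `|b| < a ->
  cint (fun y => cexp (- ((a +i* b) ^+ 2 * (y ^+ 2)%:C))) =
  (Num.sqrt pi)%:C / (a +i* b).
Proof.
move=> ba; have a0 : 0 < a by rewrite (le_lt_trans _ ba).
(* A margin strictly between |b| and a: for |t| < r the real part of (a + i t)^2 is at least a^2 -
   r^2 > 0, which gives one Gaussian majorant for all these t. *)
pose r := (`|b| + a) / 2.
have br : `|b| < r by rewrite /r; lra.
have ra : r < a by rewrite /r; lra.
have r0 : 0 < r by rewrite (le_lt_trans _ br).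
pose s (t : R) : R[i] := a%:C + 'i%C * t%:C.
have sE t : s t = a +i* t by apply: complex_ext; rewrite /s !ReImE/=; ring.
pose e t (y : R) := cexp (- (s t ^+ 2 * (y%:C) ^+ 2)).
pose D (t : R) := - r < t < r.
have ge : gbound D e.
  exists 1, (a ^+ 2 - r ^+ 2); split.
    by rewrite subr_gt0 ltr_pXn2r// nnegrE ltW.
  move=> t y /andP[t1 t2]; rewrite mul1r normc_cexp ler_expR.
  have -> : - (s t ^+ 2 * y%:C ^+ 2) =
      (- ((a ^+ 2 - t ^+ 2) * y ^+ 2)) +i* (- (2 * a * t * y ^+ 2)).
    by rewrite sE; apply: complex_ext; rewrite !expr2 !ReImE /=; ring.
  rewrite /= lerN2 ler_wpM2r ?sqr_ge0// lerD2l lerN2.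
  by rewrite -[t ^+ 2]real_normK ?num_real// ler_pXn2r// ?nnegrE ?ltW// ltr_norml t1.
have pbs : pbound D (fun t y => s t).
  apply: (@pbound_param _ _ _ _ (`|a| + `|r|)) => t y /andP[t1 t2].
  rewrite /s (le_trans (normcD _ _))// normcM normcI mul1r !normcR lerD2l.
  by rewrite [leRHS]gtr0_norm// ler_norml !ltW.
have pby : pbound D (fun _ y => (y%:C : R[i])) by exact: pbound_id.
have ds t : cderiv s t 'i%C.
  apply: cderiv_eq.
    by apply: cderivD; [exact: cderiv_cst|apply: cderivZ; exact: cderiv_id].
  by rewrite add0r mulr1.
have de t y : cderiv (e ^~ y) t (- (2 * s t * 'i%C * y%:C ^+ 2) * e t y).
  apply: cderiv_cexp; apply: cderivN; apply: cderiv_eq.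
    by apply: cderivM; [exact: cderivX (ds t)|exact: cderiv_cst].
  by rewrite mulr0 addr0 /= expr1.
have dey t y : cderiv (e t) y (- (s t ^+ 2 * (2 * y%:C)) * e t y).
  apply: cderiv_cexp; apply: cderivN; apply: cderivZ; apply: cderiv_eq.
    by apply: cderivX; exact: cderiv_id.
  by rewrite /= expr1 mulr1.
have ce t : ccont (e t) by exact: cderiv_ccont (dey t).
have cid : ccont (fun y : R => y%:C : R[i]) by apply: ccont_real => ?; exact: cvg_id.
have I0 : - r < 0 < r by rewrite oppr_lt0 r0.
have Ib : - r < b < r by rewrite -ltr_norml.
(* With s = a + i t, the t-derivative of s e^(- s^2 y^2) is i (1 - 2 s^2 y^2) e^(- s^2 y^2), which
   is the y-derivative of i y e^(- s^2 y^2). *)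
have h : cint (fun y => s 0 * e 0 y) = cint (fun y => s b * e b y).
  apply: (@cint_homotopy _ (fun t y => s t * e t y)
    (fun t y => ('i%C * (1 - 2 * s t ^+ 2 * y%:C ^+ 2)) * e t y)
    (fun t y => ('i%C * y%:C) * e t y) (- r) r) => //.
  - by move=> t _; apply: ccontM => //; exact: ccont_cst.
  - move=> t _; apply: ccontM => //; apply: ccontM; first exact: ccont_cst.
    apply: ccontD; first exact: ccont_cst.
    apply: ccontN; apply: ccontM; first exact: ccont_cst.
    exact: ccontX.
  - move=> t y _; apply: cderiv_eq; first exact: cderivM (ds t) (de t y).
    rewrite /=; ring.
  - move=> t y _; apply: cderiv_eq.
      apply: cderivM; last exact: dey.
      by apply: cderivZ; exact: cderiv_id.
    rewrite /=; ring.
  - exact: pbound_gbound.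
  - apply: pbound_gbound => //; apply: pboundM; first exact: pbound_cst.
    apply: pboundB; first exact: pbound_cst.
    by apply: pboundM; [apply: pboundM; [exact: pbound_cst|exact: pboundX]|exact: pboundX].
  - by apply: pbound_gbound => //; apply: pboundM => //; exact: pbound_cst.
have gi t : D t -> cintegrable (e t).
  by move=> Dt; apply: gdom_cintegrable => //; exact: gbound_gdom ge Dt.
rewrite !cintZ in h; [|exact: gi..].
have e0 : cint (e 0) = (Num.sqrt pi / a)%:C.
  have eE y : e 0 y = (expR (- (a ^+ 2 * y ^+ 2)))%:C.
    rewrite /e -cexp_real; congr cexp.
    by rewrite sE -rmorphXn/= complexr0 -rmorphXn -rmorphM -rmorphN.
  rewrite (eq_cint eE) /cint /cintegral /=.
  rewrite Rintegral_gauss_scale// Rintegral_cst//= mul0r.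
  by apply: complex_ext.
have sb0 : s b != 0 by rewrite sE normcRe_gt0.
rewrite (_ : (fun y => _) = e b); last first.
  by apply/funext => y; rewrite /e sE rmorphXn.
apply: (mulfI sb0); rewrite -h e0 sE complexr0 -sE -rmorphM/=.
by rewrite mulrCA divff ?gt_eqF// mulr1 mulrCA divff// mulr1.
Qed.

End ComplexGaussian.

Section Horner.
Context {R : realType}.
Implicit Types (Q : {poly R[i]}).

Lemma cderiv_horner Q (f : R -> R[i]) x d : cderiv f x d ->
  cderiv (fun t => Q.[f t]) x (Q^`().[f x] * d).
Proof.
move=> df; elim/poly_ind: Q => [|Q c ih].
  apply: (@cderiv_ext _ (fun=> 0)); first by move=> t; rewrite horner0.
  by rewrite deriv0 horner0 mul0r; exact: cderiv_cst.
apply: (@cderiv_ext _ (fun t => Q.[f t] * f t + c)).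
  by move=> t; rewrite !hornerE.
apply: cderiv_eq.
  by apply: cderivD; [exact: cderivM ih df|exact: cderiv_cst].
by rewrite derivMXaddC !hornerE; ring.
Qed.

Lemma ccont_horner Q (f : R -> R[i]) : ccont f -> ccont (fun t => Q.[f t]).
Proof.
move=> cf; elim/poly_ind: Q => [|Q c ih].
  by apply: (@ccont_ext _ (fun=> 0)); [move=> t; rewrite horner0|exact: ccont_cst].
apply: (@ccont_ext _ (fun t => Q.[f t] * f t + c)).
  by move=> t; rewrite !hornerE.
by apply: ccontD; [exact: ccontM|exact: ccont_cst].
Qed.

Lemma pbound_horner T (D : T -> Prop) Q (f : T -> R -> R[i]) : pbound D f ->
  pbound D (fun t x => Q.[f t x]).
Proof.
move=> hf; elim/poly_ind: Q => [|Q c ih].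
  by have [C [n h]] := pbound_cst D (0 : R[i]); exists C, n => t x /(h t x); rewrite horner0.
have [C [n h]] := pboundD (pboundM ih hf) (pbound_cst D c).
by exists C, n => t x /(h t x); rewrite !hornerE.
Qed.

End Horner.

(** * The integrals of [Q e^(-(x^2 - mu a)^3)] and their differential equation *)

Section CubicIntegral.
Context {R : realType}.
Implicit Types (Q : {poly R[i]}) (a x : R).

(** The left side is the real part of - (X - b)^3 for b = b1 + i b2. With X = x^2 the bound becomes
    a Gaussian majorant that depends on b only through [B]. *)
Lemma cubic_bound (B b1 b2 X : R) : `|b1| <= B -> `|b2| <= B -> 0 <= X ->
  - (X - b1) ^+ 3 + 3 * (X - b1) * b2 ^+ 2 <=
  B ^+ 3 + (3 * B ^+ 2 + 1) * B + (3 * B ^+ 2 + 1) ^+ 2 + B - X.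
Proof.
move=> h1 h2 X0; have B0 : 0 <= B by rewrite (le_trans _ h1).
have hb1 : b1 <= B by rewrite (le_trans (ler_norm _)).
have hb2 : b2 ^+ 2 <= B ^+ 2.
  by rewrite -[b2 ^+ 2]real_normK ?num_real// ler_pXn2r// nnegrE.
have hw : - B <= X - b1 by lra.
have hX : X <= (X - b1) + B by lra.
move: hw hX; move: (X - b1) => w hw hX.
have b20 := sqr_ge0 b2.
(* For w >= 0 the linear terms 3 w b2^2 + w are at most M w. This is at most M^2 if w <= M, and at
   most w^3 otherwise, since then w^2 >= M. *)
set M := 3 * B ^+ 2 + 1.
have M1 : 1 <= M by rewrite /M; have := sqr_ge0 B; lra.
suff : - w ^+ 3 + 3 * w * b2 ^+ 2 + w <= B ^+ 3 + M * B + M ^+ 2 by lra.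
have B3 : 0 <= B ^+ 3 by rewrite exprn_ge0.
have MB : 0 <= M * B by rewrite mulr_ge0//; lra.
have [w0|w0] := leP 0 w.
  have h3 : w * b2 ^+ 2 <= w * B ^+ 2 by rewrite ler_wpM2l.
  have h4 : 3 * w * b2 ^+ 2 + w <= M * w by rewrite /M; lra.
  have [wM|wM] := leP w M.
    have h5 : M * w <= M ^+ 2 by rewrite expr2 ler_wpM2l//; lra.
    have h6 : 0 <= w ^+ 3 by rewrite exprn_ge0.
    lra.
  have h5 : M * w <= w ^+ 3.
    rewrite exprSr ler_wpM2r// expr2 (le_trans (ltW wM))//.
    by rewrite ler_peMl//; lra.
  have := sqr_ge0 M; lra.
have h5 : (- w) ^+ 3 <= B ^+ 3 by rewrite ler_pXn2r ?nnegrE//; lra.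
have h6 : w * b2 ^+ 2 <= 0 by rewrite mulr_le0_ge0// ltW.
have h7 : (- w) ^+ 3 = - w ^+ 3 by ring.
have := sqr_ge0 M; lra.
Qed.

Variable mu : R[i].

Definition cubarg a x : R[i] := (x ^+ 2)%:C - mu * a%:C.
Definition cubexp a x : R[i] := cexp (- cubarg a x ^+ 3).
Definition cubint Q a := cint (fun x => Q.[cubarg a x] * cubexp a x).
(** With p = [cubarg a x], the p-derivative of Q(p) e^(- p^3) is - ([cubop Q])(p) e^(- p^3). As
    dp/da = - mu, differentiation in a applies [cubop] and multiplies by mu. *)
Definition cubop Q : {poly R[i]} := 3 *: ('X^2 * Q) - Q^`().

Lemma cubexp_gbound A : gbound (fun a => - A < a < A) cubexp.
Proof.
pose B := normc mu * A.
pose K := B ^+ 3 + (3 * B ^+ 2 + 1) * B + (3 * B ^+ 2 + 1) ^+ 2 + B.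
exists (expR K), 1; split => // a x aA.
rewrite normc_cexp -expRD ler_expR mul1r.
have nb : normc (mu * a%:C) <= B.
  rewrite normcM normcR ler_wpM2l ?normc_ge0// ler_norml.
  by case/andP: aA => *; rewrite !ltW.
have := @cubic_bound B (complex.Re (mu * a%:C)) (complex.Im (mu * a%:C)) (x ^+ 2).
rewrite (le_trans (normr_Re_le _))// (le_trans (normr_Im_le _))// sqr_ge0.
move=> /(_ isT isT isT); apply: le_trans.
rewrite /cubarg; case: (mu * a%:C) => b1 b2.
rewrite le_eqVlt; apply/orP; left; apply/eqP.
rewrite !exprS expr0 !ReImE/=; ring.
Qed.

Lemma cubarg_pbound A : pbound (fun a => - A < a < A) cubarg.
Proof.
apply: pboundB.
  have [C [n h]] := pboundX 2 (@pbound_id R _ (fun a : R => - A < a < A)).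
  by exists C, n => t x /(h t x); rewrite -rmorphXn.
apply: (@pbound_param _ _ _ _ (normc mu * A)) => a _ aA.
rewrite normcM normcR ler_wpM2l ?normc_ge0// ler_norml.
by case/andP: aA => *; rewrite !ltW.
Qed.

Lemma cubint_gbound A Q :
  gbound (fun a => - A < a < A) (fun a x => Q.[cubarg a x] * cubexp a x).
Proof.
apply: pbound_gbound; last exact: cubexp_gbound.
by apply: pbound_horner; exact: cubarg_pbound.
Qed.

Lemma cderiv_cubarg_r a x : cderiv (cubarg a) x (2 * x%:C).
Proof.
apply: (@cderiv_ext _ (fun x => x%:C ^+ 2 - mu * a%:C)).
  by move=> t; rewrite -rmorphXn.
apply: cderiv_eq.
  by apply: cderivB; [apply: cderivX; exact: cderiv_id|exact: cderiv_cst].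
by rewrite subr0 mulr1.
Qed.

Lemma cderiv_cubarg_l a x : cderiv (cubarg ^~ x) a (- mu).
Proof.
apply: cderiv_eq.
  by apply: cderivB; [exact: cderiv_cst|apply: cderivZ; exact: cderiv_id].
by rewrite sub0r mulr1.
Qed.

Lemma ccont_cubarg a : ccont (cubarg a).
Proof. exact: cderiv_ccont (cderiv_cubarg_r a). Qed.

Lemma ccont_cubexp a : ccont (cubexp a).
Proof. by apply: ccont_cexp; apply: ccontN; apply: ccontX; exact: ccont_cubarg. Qed.

Lemma ccont_cubint Q a : ccont (fun x => Q.[cubarg a x] * cubexp a x).
Proof.
apply: ccontM; last exact: ccont_cubexp.
by apply: ccont_horner; exact: ccont_cubarg.
Qed.

Lemma cintegrable_cubint Q a : cintegrable (fun x => Q.[cubarg a x] * cubexp a x).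
Proof.
apply: gdom_cintegrable; first exact: ccont_cubint.
apply: (gbound_gdom (cubint_gbound (`|a| + 1) Q)).
have := ler_norm a; have := ler_norm (- a); rewrite normrN => ? ?.
by apply/andP; split; lra.
Qed.

Lemma cderiv_cubint Q a : cderiv (cubint Q) a (mu * cubint (cubop Q) a).
Proof.
have aI : - (`|a| + 1) < a < `|a| + 1.
  have := ler_norm a; have := ler_norm (- a); rewrite normrN => ? ?.
  by apply/andP; split; lra.
rewrite /cubint -cintZ; last exact: cintegrable_cubint.
apply: (@cderiv_cint_gbound _ (fun a x => Q.[cubarg a x] * cubexp a x)
  (fun a x => mu * ((cubop Q).[cubarg a x] * cubexp a x)) _ _ _ aI).
- by move=> t _; exact: cintegrable_cubint.
- move=> t x _; apply: cderiv_eq.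
    apply: cderivM; first by apply: cderiv_horner; exact: cderiv_cubarg_l.
    by apply: cderiv_cexp; apply: cderivN; apply: cderivX; exact: cderiv_cubarg_l.
  rewrite /cubop -/(cubexp t x) !hornerE/=; ring.
- have := pbound_gbound (pbound_cst (fun t => - (`|a| + 1) < t < `|a| + 1) mu)
    (cubint_gbound (`|a| + 1) (cubop Q)).
  exact: gbound_ext.
Qed.

Lemma cubop1E : cubop 1 = 3 *: 'X^2.
Proof. by rewrite /cubop mulr1 (derivC 1) subr0. Qed.

Lemma cubop2E : cubop (cubop 1) = 9 *: 'X^4 - 6 *: 'X.
Proof.
rewrite cubop1E /cubop derivZ derivXn -!mul_polyC !rmorph_nat/= -mulr_natr; ring.
Qed.

Lemma cubop3E : cubop (cubop (cubop 1)) = 27 *: 'X^6 - 54 *: 'X^3 + 6%:P.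
Proof.
have E : 3 * ('X^2 * (9 * 'X^4 - 6 * 'X)) - (9 * ('X^3 * 4) - 6) =
  27 * 'X^6 - 54 * 'X^3 + 6 :> {poly R[i]} by ring.
rewrite cubop2E /cubop derivB !derivZ derivXn derivX -!mul_polyC !rmorph_nat/=.
by rewrite -[_ *+ 4]mulr_natr mulr1 E.
Qed.

(** The third-order equation with powers of mu stripped off: the j-th derivative of [cubint 1] is
    mu^j times the j-th iterate, so multiplying by mu^3 gives F''' = 3 mu^3 (a^2 F'' + 3 a F' + 3/4
    F). The difference of the two sides is the integral of an exact derivative. *)
Lemma cubint_residual a :
  let b := mu * a%:C in
  cubint (cubop (cubop (cubop 1))) a =
  3 * (b ^+ 2 * cubint (cubop (cubop 1)) a + 3 * b * cubint (cubop 1) a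
       + 3 / 4 * cubint 1 a).
Proof.
move=> b; apply/eqP; rewrite -subr_eq0; apply/eqP.
pose S := cubop (cubop (cubop 1)) - 3 *: (b ^+ 2 *: cubop (cubop 1)
   + (3 * b) *: cubop 1 + (3 / 4) *: 1).
transitivity (cubint S a).
  have ci := cintegrable_cubint.
  rewrite /cubint.
  under [in RHS]eq_cint => x.
    rewrite (_ : S.[_] * _ = (cubop (cubop (cubop 1))).[cubarg a x] * cubexp a x
     + ((- 3 * b ^+ 2) * ((cubop (cubop 1)).[cubarg a x] * cubexp a x)
     + ((- 9 * b) * ((cubop 1).[cubarg a x] * cubexp a x)
     + (- 9 / 4) * ((1 : {poly R[i]}).[cubarg a x] * cubexp a x)))); last first.
      by rewrite /S !(hornerD, hornerN, hornerZ); field.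
  over.
  rewrite !cintD ?cintZ; do ?[exact: ci|exact: cintegrableZ|apply: cintegrableD].
  by field.
have xE x : (x ^+ 2)%:C = x%:C ^+ 2 :> R[i] by rewrite rmorphXn.
(* The antiderivative comes from two integrations by parts in the variable x^2. *)
apply: (@cint_derive_vanish _ _ (fun x => (9 / 2 * x%:C ^+ 3 * cubarg a x ^+ 2
   + 15 / 4 * x%:C - 9 * x%:C * cubarg a x ^+ 3) * cubexp a x)).
- move=> x; have did := @cderiv_id R x.
  have dp := cderiv_cubarg_r a x.
  apply: cderiv_eq.
    apply: cderivM; last first.
      by apply: cderiv_cexp; apply: cderivN; apply: cderivX; exact: dp.
    apply: cderivB; last first.
      by apply: cderivM; [exact: cderivZ did|exact: cderivX dp].
    apply: cderivD; last exact: cderivZ did.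
    apply: cderivM; last exact: cderivX dp.
    by apply: cderivZ; exact: cderivX did.
  rewrite -/(cubexp a x) /S cubop3E cubop2E cubop1E.
  rewrite !(hornerD, hornerN, hornerZ, hornerXn, hornerX, hornerC)/=.
  (* Eliminating b leaves a polynomial identity in the two independent quantities x and
     [cubarg a x]. *)
  have -> : b = x%:C ^+ 2 - cubarg a x by rewrite /b /cubarg xE; ring.
  by field.
- exact: ccont_cubint.
- apply: (gbound_gdom (cubint_gbound (`|a| + 1) S)).
  have := ler_norm a; have := ler_norm (- a); rewrite normrN => ? ?.
  by apply/andP; split; lra.
- have aI : - (`|a| + 1) < a < `|a| + 1.
    have := ler_norm a; have := ler_norm (- a); rewrite normrN => ? ?.
    by apply/andP; split; lra.
  pose D a' := - (`|a| + 1) < a' < `|a| + 1.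
  have pid := @pbound_id R R D.
  have parg : pbound D cubarg by exact: cubarg_pbound.
  have h : gbound D (fun a x => (9 / 2 * x%:C ^+ 3 * cubarg a x ^+ 2
     + 15 / 4 * x%:C - 9 * x%:C * cubarg a x ^+ 3) * cubexp a x).
    apply: pbound_gbound; last exact: cubexp_gbound.
    apply: pboundB.
      apply: pboundD; last by apply: pboundM => //; exact: pbound_cst.
      apply: pboundM; last exact: pboundX.
      by apply: pboundM; [exact: pbound_cst|exact: pboundX].
    apply: pboundM; last exact: pboundX.
    by apply: pboundM => //; exact: pbound_cst.
  exact: (gbound_gdom h aI).
Qed.

End CubicIntegral.

(** * Power series solutions *)

Section ComplexLimits.
Context {R : realType}.
Local Notation Re := complex.Re.
Local Notation Im := complex.Im.

(** Componentwise, so that real dominated convergence and comparison tests apply; [ccvg_cvg] passes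
    to the topology of the modulus. *)
Definition ccvg (T : Type) (F : set_system T) (u : T -> R[i]) (l : R[i]) :=
  (Re (u t) @[t --> F] --> Re l) /\ (Im (u t) @[t --> F] --> Im l).

Lemma ccvg_cvg (T : Type) (F : set_system T) {FF : Filter F} (u : T -> R[i]) l :
  ccvg F u l -> u t @[t --> F] --> l.
Proof.
move=> [h1 h2]; apply/cvgrPdist_lt => e e0.
have [e1 e2] : Im e = 0 /\ 0 < Re e by move: e0; rewrite ltcE/= => /andP[/eqP].
have eE : e = (Re e)%:C by apply: complex_ext => //=.
have e20 : 0 < Re e / 2 by rewrite divr_gt0.
move/cvgrPdist_lt : h1 => /(_ _ e20) h1.
move/cvgrPdist_lt : h2 => /(_ _ e20) h2.
near=> t.
have h3 : normc (l - u t) < Re e.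
  rewrite (le_lt_trans (normc_le_ReIm _))// (splitr (Re e)) ltrD//.
    by rewrite !ReImE; near: t.
  by rewrite !ReImE; near: t.
by rewrite eE (_ : `|_| = (normc (l - u t))%:C)// ltcR.
Unshelve. all: end_near. Qed.

Lemma ccvg_lim (T : Type) (F : set_system T) {FF : ProperFilter F} (u : T -> R[i]) l :
  ccvg F u l -> lim (u t @[t --> F]) = l.
Proof. by move=> /ccvg_cvg h; apply: cvg_lim => //; exact: norm_hausdorff. Qed.

Lemma ccvg_unique (T : Type) (F : set_system T) {FF : ProperFilter F}
  (u : T -> R[i]) l l' : ccvg F u l -> ccvg F u l' -> l = l'.
Proof.
move=> [h1 h2] [h3 h4]; apply: complex_ext.
  by apply: cvg_unique h1 h3; exact: norm_hausdorff.
by apply: cvg_unique h2 h4; exact: norm_hausdorff.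
Qed.

Lemma ccvgD (T : Type) (F : set_system T) {FF : Filter F} (u v : T -> R[i]) l l' :
  ccvg F u l -> ccvg F v l' -> ccvg F (fun t => u t + v t) (l + l').
Proof.
move=> [h1 h2] [h3 h4]; split; under eq_fun do rewrite ReImE;
  by rewrite ReImE; apply: cvgD.
Qed.

Lemma ccvgZ (T : Type) (F : set_system T) {FF : Filter F} (c : R[i]) (u : T -> R[i]) l :
  ccvg F u l -> ccvg F (fun t => c * u t) (c * l).
Proof.
move=> [h1 h2]; split.
  under eq_fun do rewrite cReM.
  by rewrite cReM; apply: cvgB; apply: cvgM => //; exact: cvg_cst.
under eq_fun do rewrite cImM.
by rewrite cImM; apply: cvgD; apply: cvgM => //; exact: cvg_cst.
Qed.

Lemma ccvg_normc (T : Type) (F : set_system T) {FF : Filter F} (u : T -> R[i]) l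
    (d : T -> R) : (\forall t \near F, normc (l - u t) <= d t) ->
  d t @[t --> F] --> 0 -> ccvg F u l.
Proof.
move=> h /cvgrPdist_lt d0; split; apply/cvgrPdist_lt => e /d0 {}d0; near=> t.
- rewrite -cReN -cReD (le_lt_trans (normr_Re_le _))//.
  rewrite (le_lt_trans (_ : _ <= d t))//; first by near: t.
  rewrite (le_lt_trans (ler_norm _))//.
  by rewrite -normrN -sub0r; near: t.
- rewrite -cImN -cImD (le_lt_trans (normr_Im_le _))//.
  rewrite (le_lt_trans (_ : _ <= d t))//; first by near: t.
  rewrite (le_lt_trans (ler_norm _))//.
  by rewrite -normrN -sub0r; near: t.
Unshelve. all: end_near. Qed.

Lemma ccvg_shiftS (u : nat -> R[i]) l : ccvg \oo u l -> ccvg \oo (fun n => u n.+1) l.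
Proof.
move=> [h1 h2]; split; first by rewrite (cvg_shiftS (fun n => Re (u n))).
by rewrite (cvg_shiftS (fun n => Im (u n))).
Qed.

Lemma Re_series (u : nat -> R[i]) n : Re (series u n) = series (fun k => Re (u k)) n.
Proof.
rewrite /series/=; elim: n => [|n ih]; first by rewrite !big_geq.
by rewrite !big_nat_recr//= cReD ih.
Qed.

Lemma Im_series (u : nat -> R[i]) n : Im (series u n) = series (fun k => Im (u k)) n.
Proof.
rewrite /series/=; elim: n => [|n ih]; first by rewrite !big_geq.
by rewrite !big_nat_recr//= cImD ih.
Qed.

Lemma ccvg_series (u : nat -> R[i]) (r : R) : 0 <= r ->
  (forall n, normc (u n) <= exp_coeff r n) ->
  ccvg \oo (series u) (limn (series u)).
Proof.
move=> r0 h.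
have [l hl] : exists l, ccvg \oo (series u) l.
  have c1 : cvgn (series (fun k => Re (u k))).
    apply: normed_cvg; apply: series_le_cvg (is_cvg_series_exp_coeff r) => n.
    - exact: normr_ge0.
    - exact: exp_coeff_ge0.
    - by rewrite (le_trans (normr_Re_le _)).
  have c2 : cvgn (series (fun k => Im (u k))).
    apply: normed_cvg; apply: series_le_cvg (is_cvg_series_exp_coeff r) => n.
    - exact: normr_ge0.
    - exact: exp_coeff_ge0.
    - by rewrite (le_trans (normr_Im_le _)).
  exists (limn (series (fun k => Re (u k))) +i* limn (series (fun k => Im (u k)))).
  split => /=; first by under eq_fun do rewrite Re_series.
  by under eq_fun do rewrite Im_series.
by rewrite (ccvg_lim hl).
Qed.

End ComplexLimits.

(** * A Gronwall estimate for the third-order equation *)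

Section Gronwall.
Context {R : realType}.
Local Notation Re := complex.Re.
Local Notation Im := complex.Im.

Lemma is_derive_funD (f g : R -> R) (x df dg : R) : is_derive x 1 f df ->
  is_derive x 1 g dg -> is_derive x 1 (fun t => f t + g t) (df + dg).
Proof. by move=> hf hg; exact: is_deriveD. Qed.

Lemma is_derive_funM (f g : R -> R) (x df dg : R) : is_derive x 1 f df ->
  is_derive x 1 g dg -> is_derive x 1 (fun t => f t * g t) (df * g x + f x * dg).
Proof.
move=> hf hg.
have h : is_derive x 1 (f * g) (f x *: dg + g x *: df) by exact: is_deriveM.
rewrite (_ : df * g x + _ = f x *: dg + g x *: df)//.
by rewrite /GRing.scale/= addrC [g x * _]mulrC.
Qed.

Lemma is_derive_sqr (f : R -> R) (x df : R) : is_derive x 1 f df ->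
  is_derive x 1 (fun t => f t ^+ 2) (2 * (f x * df)).
Proof.
move=> hf; under eq_fun do rewrite expr2.
rewrite (_ : 2 * _ = df * f x + f x * df); last by ring.
exact: is_derive_funM.
Qed.

(** [M] is chosen before the functions and the defect [d], so that one constant serves all the
    partial sums of a series. The energy is |D|^2 + |D1|^2 + |D2|^2. *)
Lemma gronwall_ode (k : R[i]) (A : R) : 0 <= A -> exists M : R, 0 <= M /\
  forall (D D1 D2 D3 : R -> R[i]) (d : R),
  (forall a, cderiv D a (D1 a)) -> (forall a, cderiv D1 a (D2 a)) ->
  (forall a, cderiv D2 a (D3 a)) -> D 0 = 0 -> D1 0 = 0 -> D2 0 = 0 -> 0 <= d ->
  (forall a, 0 <= a <= A -> normc (D3 a -
     k * (a%:C ^+ 2 * D2 a + 3 * a%:C * D1 a + 3 / 4 * D a)) <= d) ->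
  normc (D A) <= M * d.
Proof.
move=> A0; pose L := normc k * (A ^+ 2 + 3 * A + 1).
have L0 : 0 <= L.
  by rewrite mulr_ge0 ?normc_ge0//; have := sqr_ge0 A; lra.
(* 2 u v <= u^2 + v^2 bounds the derivative of the energy by twice the energy plus |D3|^2. The
   equation gives |D3| <= L (|D| + |D1| + |D2|) + d, and squaring four summands costs the factor
   4. *)
pose K := 2 + 4 * L ^+ 2.
have K2 : 2 <= K by rewrite /K; have := sqr_ge0 L; lra.
exists (Num.sqrt (4 * expR (K * A))); split; first exact: sqrtr_ge0.
move=> D D1 D2 D3 d dD dD1 dD2 D0 D10 D20 d0 hd.
pose n a := Re (D a) ^+ 2 + Im (D a) ^+ 2 + Re (D1 a) ^+ 2 + Im (D1 a) ^+ 2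
   + Re (D2 a) ^+ 2 + Im (D2 a) ^+ 2.
have nE a : n a = normc (D a) ^+ 2 + normc (D1 a) ^+ 2 + normc (D2 a) ^+ 2.
  by rewrite !sqr_normc_ReIm /n !addrA.
pose n' a := 2 * (Re (D a) * Re (D1 a) + Im (D a) * Im (D1 a)
  + Re (D1 a) * Re (D2 a) + Im (D1 a) * Im (D2 a)
  + Re (D2 a) * Re (D3 a) + Im (D2 a) * Im (D3 a)).
have dn (a : R) : is_derive a 1 n (n' a).
  have [r1 i1] := dD a; have [r2 i2] := dD1 a; have [r3 i3] := dD2 a.
  rewrite /n' !mulrDr.
  by do 5 ?[apply: is_derive_funD]; apply: is_derive_sqr.
have n'K a : 0 <= a <= A -> n' a <= K * n a + 4 * d ^+ 2.
  move=> aA.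
  have h3 : normc (D3 a) <= L * (normc (D a) + normc (D1 a) + normc (D2 a)) + d.
    rewrite -[D3 a](subrK (k * (a%:C ^+ 2 * D2 a + 3 * a%:C * D1 a + 3 / 4 * D a))).
    rewrite (le_trans (normcD _ _))// addrC lerD ?hd//.
    rewrite normcM /L -[leRHS]mulrA ler_wpM2l ?normc_ge0//.
    have na : normc (a%:C : R[i]) <= A.
      by rewrite normcR ler_norml; case/andP : aA => *; apply/andP; split; lra.
    have nq : normc (3 / 4 : R[i]) <= 1.
      rewrite (_ : 3 / 4 = (3 / 4 : R)%:C); last first.
        by rewrite rmorphM/= fmorphV !rmorph_nat.
      by rewrite normcR ger0_norm; lra.
    have [q0 [q1 q2]] := (normc_ge0 (D a), (normc_ge0 (D1 a), normc_ge0 (D2 a))).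
    have qa := normc_ge0 (a%:C : R[i]).
    have e1 : normc (a%:C ^+ 2 * D2 a) <= A ^+ 2 * normc (D2 a).
      by rewrite normcM normcX ler_wpM2r// ler_pXn2r.
    have e2 : normc (3 * a%:C * D1 a) <= 3 * A * normc (D1 a).
      by rewrite !normcM normc_nat ler_wpM2r// ler_wpM2l.
    have e3 : normc (3 / 4 * D a) <= normc (D a).
      by rewrite normcM ler_piMl.
    have e4 := normcD (a%:C ^+ 2 * D2 a + 3 * a%:C * D1 a) (3 / 4 * D a).
    have e5 := normcD (a%:C ^+ 2 * D2 a) (3 * a%:C * D1 a).
    have A20 := sqr_ge0 A.
    have p1 := mulr_ge0 A20 q0; have p2 := mulr_ge0 A20 q1.
    have p3 := mulr_ge0 A0 q0; have p4 := mulr_ge0 A0 q2.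
    nra.
  have h4 : normc (D3 a) ^+ 2 <= 4 * L ^+ 2 * n a + 4 * d ^+ 2.
    apply: (@le_trans _ _ ((L * (normc (D a) + normc (D1 a) + normc (D2 a)) + d) ^+ 2)).
      rewrite ler_pXn2r// ?nnegrE ?normc_ge0// (le_trans (normc_ge0 _) h3)//.
    rewrite nE.
    move: (normc (D a)) (normc (D1 a)) (normc (D2 a)) => x y z.
    have := sqr_ge0 (L * x - L * y); have := sqr_ge0 (L * x - L * z).
    have := sqr_ge0 (L * y - L * z); have := sqr_ge0 (L * x - d).
    have := sqr_ge0 (L * y - d); have := sqr_ge0 (L * z - d).
    lra.
  have h5 : normc (D3 a) ^+ 2 = Re (D3 a) ^+ 2 + Im (D3 a) ^+ 2 by rewrite sqr_normc_ReIm.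
  move: h4; rewrite h5 /K /n' /n.
  move: (Re (D a)) (Im (D a)) (Re (D1 a)) (Im (D1 a)) (Re (D2 a)) (Im (D2 a))
    (Re (D3 a)) (Im (D3 a)) => x1 x2 y1 y2 z1 z2 w1 w2 h4.
  have := sqr_ge0 (x1 - y1); have := sqr_ge0 (x2 - y2).
  have := sqr_ge0 (y1 - z1); have := sqr_ge0 (y2 - z2).
  have := sqr_ge0 (z1 - w1); have := sqr_ge0 (z2 - w2).
  have := sqr_ge0 x1; have := sqr_ge0 x2; have := sqr_ge0 z1; have := sqr_ge0 z2.
  lra.
(* The shift by 4 d^2 absorbs the forcing term, since K >= 1; hence q is nonincreasing, with q(0) =
   4 d^2. *)
pose q a := (n a + 4 * d ^+ 2) * expR (- (K * a)).
have dq (a : R) : is_derive a 1 q ((n' a - K * (n a + 4 * d ^+ 2)) * expR (- (K * a))).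
  have dne := dn a.
  have de : is_derive a 1 (fun a => expR (- (K * a))) (expR (- (K * a)) * - K).
    apply: (@is_derive1_comp _ expR (fun a => - (K * a))).
    rewrite (_ : (fun a => _) = - (K \*: id)); last by apply/funext.
    by apply: is_derive_eq; rewrite /GRing.scale/= mulr1.
  have dc : is_derive a 1 (fun=> 4 * d ^+ 2) 0 by exact: is_derive_cst.
  have := is_derive_funM (is_derive_funD dne dc) de.
  rewrite addr0 (_ : n' a * _ + _ =
    (n' a - K * (n a + 4 * d ^+ 2)) * expR (- (K * a)))//; ring.
have q0 : q 0 = 4 * d ^+ 2.
  by rewrite /q nE D0 D10 D20 !normc0 expr0n/= !addr0 add0r mulr0 oppr0 expR0 mulr1.
have qA : q A <= q 0.
  apply: (@ler0_derive1_nincr _ q 0 A) => //.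
  - move=> x; rewrite in_itv/= => /andP[x0 xA]; rewrite derive1E.
    have [_ ->] := dq x; rewrite mulr_le0_ge0 ?expR_ge0// subr_le0.
    rewrite (le_trans (n'K x _))//; first by rewrite !ltW.
    by have := sqr_ge0 d; nra.
  - apply: derivable_within_continuous => x _.
    by have [] := dq x.
have nA : n A <= 4 * expR (K * A) * d ^+ 2.
  move: qA; rewrite q0 /q expRN -ler_pdivlMr ?invr_gt0 ?expR_gt0// invrK.
  by have := sqr_ge0 d; lra.
rewrite -[leRHS]ger0_norm; last by rewrite mulr_ge0 ?sqrtr_ge0.
rewrite -(ger0_norm (normc_ge0 (D A))) -ler_sqr ?nnegrE//.
rewrite !real_normK ?num_real// exprMn sqr_sqrtr; last by rewrite mulr_ge0 ?expR_ge0.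
rewrite (le_trans _ nA)// nE.
by have := sqr_ge0 (normc (D1 A)); have := sqr_ge0 (normc (D2 A)); lra.
Qed.

End Gronwall.

(** * Partial sums of the power series solutions *)

Section PowerSeriesSolution.
Context {R : realType}.
Implicit Types (a A : R) (c d : nat -> R[i]).

(** The j-th derivative of a^n. The falling factorial vanishes for j > n, so the truncated exponent
    does no harm. *)
Definition dmon j n a : R[i] := (n ^_ j)%:R * a%:C ^+ (n - j).

Lemma cderiv_dmon j n a : cderiv (dmon j n) a (dmon j.+1 n a).
Proof.
apply: cderiv_eq.
  by apply: cderivZ; apply: cderivX; exact: cderiv_id.
by rewrite /dmon ffactnSr natrM subnS mulr1 mulrA.
Qed.

Lemma dmon_at0 j n : dmon j n 0 = (n == j)%:R * (j`!)%:R.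
Proof.
rewrite /dmon; case: (ltngtP n j) => [nj|jn|->].
- by rewrite ffact_small// !mul0r.
- by rewrite expr0n subn_eq0 leqNgt jn mulr0 mul0r.
- by rewrite ffactnn subnn expr0 mulr1 mul1r.
Qed.

Variable k : R[i].

(** The factor by which a^2 D^2 + 3 a D + 3/4 multiplies a^n; it equals (n + 1/2)(n + 3/2). *)
Definition euler_mult n : R[i] := n%:R ^+ 2 + 2 * n%:R + 3 / 4.

Lemma dmon_residual n a :
  dmon 3 n a - k * (a%:C ^+ 2 * dmon 2 n a + 3 * a%:C * dmon 1 n a + 3 / 4 * dmon 0 n a)
  = dmon 3 n a - k * euler_mult n * a%:C ^+ n.
Proof.
congr (_ - _); rewrite -[RHS]mulrA; congr (_ * _); rewrite /dmon /euler_mult.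
case: n => [|[|n]].
- by rewrite (@ffact_small 0 2)// (@ffact_small 0 1)// ffactn0 subn0 expr0; field.
- by rewrite (@ffact_small 1 2)// ffactn0 ffactn1 subn0 expr0 expr1; field.
- rewrite ffactn0 ffactn1 !ffactnS ffactn0 subn0 subn1 !subSS subn0 muln1 /=.
  by rewrite natrM !exprS -[n.+2]addn2 -[n.+1]addn1 !natrD; field.
Qed.

(** The exponents advance by three because the third derivative lowers the degree by three, while
    the right-hand operator preserves it. *)
Definition dpsum c r j M a := \sum_(m < M) c m * dmon j (3 * m + r) a.

Lemma cderiv_dpsum c r j M a : cderiv (dpsum c r j M) a (dpsum c r j.+1 M a).
Proof.
rewrite /dpsum; elim: M => [|M ih].
  rewrite big_ord0; apply: (@cderiv_ext _ (fun=> 0)).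
    by move=> t; rewrite big_ord0.
  exact: cderiv_cst.
rewrite big_ord_recr/=.
apply: (@cderiv_ext _ (fun t => \sum_(m < M) c m * dmon j (3 * m + r) t
  + c M * dmon j (3 * M + r) t)).
  by move=> t; rewrite big_ord_recr.
by apply: cderivD => //; apply: cderivZ; exact: cderiv_dmon.
Qed.

Lemma dpsum_at0 c r j M : (j < 3)%N -> (r < 3)%N ->
  dpsum c r j M.+1 0 = c 0 * ((r == j)%:R * (j`!)%:R).
Proof.
move=> j3 r3; rewrite /dpsum big_ord_recl/= muln0 add0n dmon_at0 big1 ?addr0//.
move=> i _; rewrite /bump leq0n dmon_at0 [_ == j]gtn_eqF ?mul0r ?mulr0//.
by rewrite (leq_trans j3)// mulnDr muln1 -addnA leq_addr.
Qed.

(** The recurrence makes the sum telescope. Only the top term of the right-hand operator stays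
    unmatched, and the recurrence rewrites it with the first omitted coefficient [c M]. *)
Lemma dpsum_residual c r M a : (r < 3)%N ->
  (forall m, c m.+1 * ((3 * m + r + 3) ^_ 3)%:R = k * euler_mult (3 * m + r) * c m) ->
  dpsum c r 3 M a - k * (a%:C ^+ 2 * dpsum c r 2 M a + 3 * a%:C * dpsum c r 1 M a
    + 3 / 4 * dpsum c r 0 M a) = - (c M * dmon 3 (3 * M + r) a).
Proof.
move=> r3 hc; elim: M => [|M ih].
  rewrite /dpsum !big_ord0 !mulr0 !addr0 mulr0 subr0 muln0 add0n /dmon.
  by rewrite ffact_small// mul0r mulr0 oppr0.
rewrite /dpsum !big_ord_recr/= -!/(dpsum _ _ _ _ _).
transitivity (dpsum c r 3 M a - k * (a%:C ^+ 2 * dpsum c r 2 M a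
    + 3 * a%:C * dpsum c r 1 M a + 3 / 4 * dpsum c r 0 M a)
  + c M * (dmon 3 (3 * M + r) a - k * (a%:C ^+ 2 * dmon 2 (3 * M + r) a
    + 3 * a%:C * dmon 1 (3 * M + r) a + 3 / 4 * dmon 0 (3 * M + r) a))).
  ring.
rewrite ih dmon_residual mulrBr addKr mulrA; congr (- _).
rewrite /dmon (_ : 3 * M.+1 + r = 3 * M + r + 3)%N; last first.
  by rewrite mulnS -addnA addnC.
by rewrite [RHS]mulrA hc addnK; congr (_ * _); exact: mulrC.
Qed.

(** With N = 3 M + r and r <= 2, N <= 3 * 2^M bounds the falling factorial by 27 * 8^M, and (1 +
    A)^(3 M + 2) bounds the power of a. With the factor 1/M! these form a term of an exponential
    series. *)
Definition psum_err A M := 27 * (1 + A) ^+ 2 * exp_coeff (8 * (1 + A) ^+ 3) M.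

Lemma psum_err_ge0 A M : 0 <= A -> 0 <= psum_err A M.
Proof.
move=> A0; rewrite /psum_err mulr_ge0//.
  by rewrite mulr_ge0// exprn_ge0// addr_ge0.
by apply: exp_coeff_ge0; rewrite mulr_ge0// exprn_ge0// addr_ge0.
Qed.

Lemma normc_psum_err c r M a A : (r < 3)%N -> 0 <= a <= A ->
  normc (c M.+1) <= (M.+1`!)%:R^-1 ->
  normc (c M.+1 * dmon 3 (3 * M.+1 + r) a) <= psum_err A M.+1.
Proof.
move=> r3 /andP[a0 aA] hc; have A0 : 0 <= A by exact: le_trans aA.
have A1 : 1 <= 1 + A by rewrite lerDl.
set N := (3 * M.+1 + r)%N.
have hN : (N ^_ 3 <= 27 * 8 ^ M.+1)%N.
  apply: (@leq_trans (N ^ 3)).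
    rewrite !ffactnS ffactn0 muln1 !expnS expn0 muln1 leq_mul// leq_mul//.
    by rewrite (leq_trans (leq_pred _))// leq_pred.
  have h2 : (N <= 3 * 2 ^ M.+1)%N.
    rewrite (@leq_trans (3 * M.+2)%N)//.
      by rewrite /N [(3 * M.+2)%N]mulnS addnC leq_add2r ltnW.
    by rewrite leq_mul2l/= ltn_expl.
  rewrite (_ : 27 * 8 ^ M.+1 = (3 * 2 ^ M.+1) ^ 3)%N ?leq_exp2r//.
  by rewrite expnMn -expnM [(M.+1 * 3)%N]mulnC expnM.
have ha : normc (a%:C ^+ (N - 3) : R[i]) <= (1 + A) ^+ 2 * (1 + A) ^+ (3 * M.+1).
  rewrite normcX normcR ger0_norm// -exprD.
  apply: (@le_trans _ _ ((1 + A) ^+ (N - 3))).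
    by apply: lerXn2r; rewrite ?nnegrE; lra.
  by rewrite ler_weXn2l// (leq_trans (leq_subr _ _))// /N addnC leq_add2r.
rewrite normcM /dmon normcM normc_nat.
have N0 : 0 <= (N ^_ 3)%:R :> R by [].
have h3 : (N ^_ 3)%:R <= 27 * 8 ^+ M.+1 :> R.
  by rewrite -natrX -natrM ler_nat.
have h4 := ler_pM N0 (normc_ge0 _) h3 ha.
have h5 := ler_pM (normc_ge0 _) (mulr_ge0 N0 (normc_ge0 _)) hc h4.
rewrite (le_trans h5)// /psum_err /exp_coeff /= exprMn -exprM.
rewrite le_eqVlt; apply/orP; left; apply/eqP; ring.
Qed.

Lemma cvg_psum_err A : psum_err A M.+1 @[M --> \oo] --> 0.
Proof.
rewrite -(mulr0 (27 * (1 + A) ^+ 2)); apply: cvgM; first exact: cvg_cst.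
have := @cvg_exp_coeff R (8 * (1 + A) ^+ 3).
by rewrite -(cvg_shiftS _ _).
Qed.

(** The condition [F2 0 = 0] excludes the solution with exponent 2. No convergence of derivatives of
    the series is used: each partial sum is compared with [F] by Gronwall's inequality, and its
    defect tends to 0. *)
Theorem ode_series_solution (F F1 F2 F3 : R -> R[i]) c d A : 0 <= A ->
  (forall a, cderiv F a (F1 a)) -> (forall a, cderiv F1 a (F2 a)) ->
  (forall a, cderiv F2 a (F3 a)) ->
  (forall a, F3 a = k * (a%:C ^+ 2 * F2 a + 3 * a%:C * F1 a + 3 / 4 * F a)) ->
  F2 0 = 0 ->
  c 0 = 1 -> (forall m, normc (c m) <= (m`!)%:R^-1) ->
  (forall m, c m.+1 * ((3 * m + 0 + 3) ^_ 3)%:R = k * euler_mult (3 * m + 0) * c m) ->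
  d 0 = 1 -> (forall m, normc (d m) <= (m`!)%:R^-1) ->
  (forall m, d m.+1 * ((3 * m + 1 + 3) ^_ 3)%:R = k * euler_mult (3 * m + 1) * d m) ->
  F A = F 0 * limn (series (fun m => c m * A%:C ^+ (3 * m)))
      + F1 0 * A%:C * limn (series (fun m => d m * A%:C ^+ (3 * m))).
Proof.
move=> A0 dF dF1 dF2 F3E F20 c0 cn hc d0 dn hd.
have [K [K0 gr]] := gronwall_ode k A0.
pose simpl0 := (@mulr1n R[i], @mulr0n R[i], @mul1r R[i], @mul0r R[i],
  @mulr0 R[i], @mulr1 R[i], @addr0 R[i], @add0r R[i]).
(* The j-th derivative of the difference between [F] and a partial sum. The index [M.+1] keeps the
   leading coefficients in the sum, so that the initial values cancel. *)
pose D j (G : R -> R[i]) M a :=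
  G a - (F 0 * dpsum c 0 j M.+1 a + F1 0 * dpsum d 1 j M.+1 a).
have dD j G G' M : (forall a, cderiv G a (G' a)) ->
    forall a, cderiv (D j G M) a (D j.+1 G' M a).
  move=> dG a; apply: cderivB => //.
  by apply: cderivD; apply: cderivZ; exact: cderiv_dpsum.
pose e M := (normc (F 0) + normc (F1 0)) * psum_err A M.+1.
have eM M : normc (D 0 F M A) <= K * e M.
  apply: (gr (D 0 F M) (D 1 F1 M) (D 2 F2 M) (D 3 F3 M)); do ?exact: dD.
  - by rewrite /D !dpsum_at0// c0 d0 /= !simpl0 subrr.
  - by rewrite /D !dpsum_at0// c0 d0 /= !simpl0 subrr.
  - by rewrite /D !dpsum_at0// F20 /= !simpl0 oppr0.
  - by rewrite /e mulr_ge0 ?psum_err_ge0// addr_ge0 ?normc_ge0.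
  move=> a aA.
  have -> : D 3 F3 M a - k * (a%:C ^+ 2 * D 2 F2 M a + 3 * a%:C * D 1 F1 M a
      + 3 / 4 * D 0 F M a) =
     F 0 * (c M.+1 * dmon 3 (3 * M.+1 + 0) a) + F1 0 * (d M.+1 * dmon 3 (3 * M.+1 + 1) a).
    have h1 := dpsum_residual M.+1 a (isT : (0 < 3)%N) hc.
    have h2 := dpsum_residual M.+1 a (isT : (1 < 3)%N) hd.
    rewrite -[c M.+1 * _]opprK -h1 -[d M.+1 * _]opprK -h2 /D F3E; ring.
  rewrite (le_trans (normcD _ _))// !normcM /e mulrDl -!normcM.
  by rewrite lerD// normcM ler_wpM2l ?normc_ge0// normc_psum_err.
have bound c' : (forall m, normc (c' m) <= (m`!)%:R^-1) ->
    ccvg \oo (series (fun m => c' m * A%:C ^+ (3 * m)))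
      (limn (series (fun m => c' m * A%:C ^+ (3 * m)))).
  move=> h; apply: (@ccvg_series _ _ (A ^+ 3)); first by rewrite exprn_ge0.
  move=> n; rewrite normcM normcX normcR ger0_norm// /exp_coeff/= mulrC -exprM.
  by rewrite ler_wpM2l// exprn_ge0.
have h1 := ccvgZ (F 0) (bound c cn).
have h2 := ccvgZ (F1 0 * A%:C) (bound d dn).
have E M : F 0 * series (fun m => c m * A%:C ^+ (3 * m)) M.+1
    + F1 0 * A%:C * series (fun m => d m * A%:C ^+ (3 * m)) M.+1 = F A - D 0 F M A.
  rewrite /D opprB [RHS]addrC subrK /series/= !big_mkord /dpsum; congr (_ + _).
    congr (_ * _); apply: eq_bigr => m _.
    by rewrite /dmon ffactn0 mul1r subn0 addn0.
  rewrite -mulrA; congr (_ * _); rewrite mulr_sumr; apply: eq_bigr => m _.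
  by rewrite /dmon ffactn0 mul1r subn0 addn1 exprS mulrCA.
have h3 : ccvg \oo (fun M => F A - D 0 F M A) (F A).
  apply: (@ccvg_normc _ _ _ _ _ _ (fun M => K * e M)).
    by apply: nearW => M; rewrite opprB addrC subrK eM.
  rewrite -(mulr0 K); apply: cvgM; first exact: cvg_cst.
  rewrite -(mulr0 (normc (F 0) + normc (F1 0))); apply: cvgM; first exact: cvg_cst.
  exact: cvg_psum_err.
apply: ccvg_unique h3 _; have := ccvg_shiftS (ccvgD (h1 _) (h2 _)).
rewrite (_ : (fun n => _) = (fun M => F A - D 0 F M A)); [exact|exact/funext].
Qed.

End PowerSeriesSolution.

(** * Reduction to a contour integral and deformation of the contour *)

Section ComplexFubini.
Context {R : realType}.
Local Notation Re := complex.Re.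
Local Notation Im := complex.Im.
Let mu := @lebesgue_measure R.

(** The product majorant makes [f] integrable on the plane by Tonelli's theorem and every slice
    integrable, not only almost every one. *)
Lemma Rintegral_fubini (f : R * R -> R) (g h : R -> R) :
  measurable_fun setT f -> lintegrable g -> lintegrable h ->
  (forall x, 0 <= g x) -> (forall x y, `|f (x, y)| <= g x * h y) ->
  lintegrable (fun x => \int[mu]_y f (x, y)) /\
  \int[(mu \x mu)%E]_p f p = \int[mu]_x \int[mu]_y f (x, y).
Proof.
move=> mf gi hi g0 fgh.
have mfE : measurable_fun setT (EFin \o f) by exact/measurable_EFinP.
have mfx x : measurable_fun setT (fun y => f (x, y)).
  by apply: measurableT_comp => //; exact: pair1_measurable.
have fx x : lintegrable (fun y => f (x, y)).
  apply: (@lintegrableP _ _ (fun y => g x * h y)); [exact: mfx|exact: lintegrableZ|].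
  by move=> y; exact: fgh.
have fi : (mu \x mu)%E.-integrable setT (EFin \o f).
  apply/integrable12ltyP => //.
  apply: (@le_lt_trans _ _ (\int[mu]_x ((g x * \int[mu]_y h y)%:E))%E).
    apply: ge0_le_integral => //.
    - by move=> x _; apply: integral_ge0.
    - have mab : measurable_fun setT (fun p => `|(f p)%:E|%E) by exact: measurableT_comp.
      exact: (@measurable_fun_fubini_tonelli_F _ _ _ _ _ mu _ mab).
    - apply/measurable_EFinP; apply: measurable_funM => //.
      by case/integrableP : gi => /measurable_EFinP.
    - move=> x _.
      have -> : (g x * \int[mu]_y h y)%:E = (\int[mu]_y (g x * h y)%:E)%E.
        rewrite -RintegralZl// /Rintegral fineK//.
        by apply: integrable_fin_num => //; exact: lintegrableZ.
      apply: ge0_le_integral => //.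
      + by apply/measurable_EFinP; apply: measurableT_comp => //; exact: mfx.
      + apply/measurable_EFinP; apply: measurable_funM => //.
        by case/integrableP : hi => /measurable_EFinP.
      + by move=> y _; rewrite lee_fin fgh.
  have : lintegrable (fun x => g x * \int[mu]_y h y).
    have := lintegrableZ (\int[mu]_y h y) gi.
    by under eq_fun do rewrite mulrC.
  by move=> /(integrable_fin_num measurableT); rewrite fin_numElt => /andP[].
have FE x : (\int[mu]_y (f (x, y))%:E)%E = (\int[mu]_y f (x, y))%:E.
  by rewrite /Rintegral fineK//; exact: integrable_fin_num (fx x).
have := integrable_fubini_F fi; rewrite /fubini_F => h1.
have h2 := integral12_prod_meas1 fi.
split.
  rewrite /lintegrable (_ : EFin \o _ = (fun x => \int[mu]_y (f (x, y))%:E)%E)//.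
  by apply/funext => x; rewrite /= FE.
rewrite [LHS]/Rintegral -h2 /fubini_F [RHS]/Rintegral; congr fine.
by apply: eq_integral => x _; exact: FE.
Qed.

Lemma cintegral_fubini (F : R * R -> R[i]) (C c : R) : 0 < c -> 0 <= C ->
  measurable_fun setT (fun p => Re (F p)) ->
  measurable_fun setT (fun p => Im (F p)) ->
  (forall x y, normc (F (x, y)) <= C * expR (- (c * x ^+ 2)) * expR (- (c * y ^+ 2))) ->
  cintegrable (fun x => cint (fun y => F (x, y))) /\
  cintegral (mu \x mu)%E F = cint (fun x => cint (fun y => F (x, y))).
Proof.
move=> c0 C0 m1 m2 FC.
have gi := lintegrable_gdom C c0.
have hi := lintegrable_gauss c0.
have g0 x : 0 <= C * expR (- (c * x ^+ 2)) by rewrite mulr_ge0 ?expR_ge0.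
have [|i1 e1] := Rintegral_fubini m1 gi hi g0.
  by move=> x y; rewrite (le_trans (normr_Re_le _)).
have [|i2 e2] := Rintegral_fubini m2 gi hi g0.
  by move=> x y; rewrite (le_trans (normr_Im_le _)).
by split => //; rewrite /cintegral e1 e2.
Qed.

Lemma cint_change_of_variable (G : R -> R[i]) (F F' : R -> R) :
  {homo F : x y / x < y} -> (forall x : R, is_derive x 1 F (F' x)) ->
  continuous F' -> ccont G ->
  F x @[x --> +oo] --> +oo -> F x @[x --> -oo] --> -oo ->
  cintegrable G -> cintegrable (fun x => G (F x) * (F' x)%:C) ->
  cint G = cint (fun x => G (F x) * (F' x)%:C).
Proof.
move=> incF dF cF' [cG1 cG2] Fy FNy [i1 i2].
have reE x : Re (G (F x) * (F' x)%:C) = Re (G (F x)) * F' x.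
  by rewrite cReM/= mulr0 subr0.
have imE x : Im (G (F x) * (F' x)%:C) = Im (G (F x)) * F' x.
  by rewrite cImM/= mulr0 add0r.
move=> [j1 j2]; apply: complex_ext => /=.
- under [RHS]eq_Rintegral do rewrite reE.
  apply: (@Rintegral_change_of_variable _ (fun x => Re (G x))) => //.
  by move: j1; under eq_fun do rewrite reE.
- under [RHS]eq_Rintegral do rewrite imE.
  apply: (@Rintegral_change_of_variable _ (fun x => Im (G x))) => //.
  by move: j2; under eq_fun do rewrite imE.
Qed.

End ComplexFubini.

(** * Estimates of the exponent along the contours *)

Section RealBounds.
Context {R : realType}.
Implicit Types (X Y m e a b : R).

Lemma quad_bound (A B C : R) : 0 < A ->
  exists K, forall X, - A * X ^+ 2 + B * X + C <= K - X.
Proof.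
move=> A0; exists (C + (B + 1) ^+ 2 / (4 * A)) => X.
have h : (B + 1) * X - A * X ^+ 2 <= (B + 1) ^+ 2 / (4 * A).
  rewrite ler_pdivlMr ?mulr_gt0//.
  have := sqr_ge0 (2 * A * X - (B + 1)); lra.
lra.
Qed.

Lemma sqrB_half_le (Y a : R) : Y ^+ 2 / 2 - a ^+ 2 <= (Y - a) ^+ 2.
Proof. have := sqr_ge0 (Y - 2 * a); lra. Qed.

(** The weight 1/2 would not suffice for the regularising term below: 3/4 * 9/16 exceeds (9/16)^2,
    but 1/2 * 9/16 does not. *)
Lemma sqrB_quarter_le (Y a : R) : 3 / 4 * Y ^+ 2 - 3 * a ^+ 2 <= (Y - a) ^+ 2.
Proof. have := sqr_ge0 (Y - 4 * a); lra. Qed.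

(* For fixed [e > 0] the regularising factor alone makes the integrand decay,
   uniformly along the deformation. *)
Lemma deformation_exponent_bound e a b : 0 < e ->
  exists K, forall X Y m, 0 <= X -> 0 <= m -> m <= 9 / 16 * (X + e) ->
    9 / 16 * (X * (X + e)) <= Y ^+ 2 ->
    m ^+ 3 - 3 * m * (Y - a) ^+ 2 + 9 / 4 * e * (m ^+ 2 - (Y - b) ^+ 2) <= K - X.
Proof.
move=> e0; pose K1 := e ^+ 2 + 3 * a ^+ 2.
have K10 : 0 <= K1 by rewrite /K1; have := sqr_ge0 e; have := sqr_ge0 a; lra.
(* 27/256 = 27/64 - 81/256 is what remains of the coefficient of - X^2 in the regularising term; the
   cubic term contributes only linear growth. *)
have A0 : 0 < 9 / 4 * e * (27 / 256) by lra.
have [K hK] := quad_bound (K1 + 9 / 4 * e * (54 / 256 * e))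
  (K1 * e + 9 / 4 * e * (81 / 256 * e ^+ 2 + 3 * b ^+ 2)) A0.
exists K => X Y m X0 m0 mX YX; apply: le_trans (hK X).
have Xe : 0 <= X * e by rewrite mulr_ge0// ltW.
have X2 := sqr_ge0 X; have e2 := sqr_ge0 e; have a2 := sqr_ge0 a.
have m2 : m ^+ 2 <= 81 / 256 * (X + e) ^+ 2.
  have : m ^+ 2 <= (9 / 16 * (X + e)) ^+ 2 by apply: lerXn2r; rewrite ?nnegrE; lra.
  lra.
have h1 : m ^+ 2 - 3 * (Y - a) ^+ 2 <= K1.
  by have := sqrB_half_le Y a; rewrite /K1; lra.
have h2 : m ^+ 2 - (Y - b) ^+ 2 <= 81 / 256 * (X + e) ^+ 2 - 27 / 64 * (X * (X + e)) + 3 * b ^+ 2.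
  by have := sqrB_quarter_le Y b; lra.
have h3 : m * (m ^+ 2 - 3 * (Y - a) ^+ 2) <= (X + e) * K1.
  apply: (@le_trans _ _ (m * K1)); first by rewrite ler_wpM2l.
  by rewrite ler_wpM2r//; lra.
have h4 : 9 / 4 * e * (m ^+ 2 - (Y - b) ^+ 2) <=
   9 / 4 * e * (81 / 256 * (X + e) ^+ 2 - 27 / 64 * (X * (X + e)) + 3 * b ^+ 2).
  by rewrite ler_wpM2l//; lra.
apply: le_trans (_ : (X + e) * K1 + 9 / 4 * e * (81 / 256 * (X + e) ^+ 2 - 27 / 64 * (X * (X + e)) + 3 * b ^+ 2) <= _).
  apply: le_trans (lerD h3 h4).
  by rewrite le_eqVlt; apply/orP; left; apply/eqP; ring.
by rewrite le_eqVlt; apply/orP; left; apply/eqP; field.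
Qed.

(* On the rotated contour the cubic term makes the integrand decay, uniformly
   in the regularisation. *)
Lemma rotated_exponent_bound a b :
  exists K, forall e X Y m, 0 <= e -> e <= 1 -> 0 <= X -> m = (X + e) / 2 ->
    Y ^+ 2 = 3 / 4 * (X * (X + e)) ->
    m ^+ 3 - 3 * m * (Y - a) ^+ 2 + 9 / 4 * e * (m ^+ 2 - (Y - b) ^+ 2) <= K - X.
Proof.
(* The cubic gain - 7/16 X^3 is replaced by - 7/4 X^2 + 7/4 X, using X (X - 2)^2 >= 0. The errors
   contribute (1/8 + 9/16) X^2, and 7/4 - 11/16 = 17/16. *)
have A0 : 0 < 17 / 16 :> R by lra.
have [K hK] := quad_bound (7 / 4 + 11 / 8 + 3 / 2 * a ^+ 2) (11 / 16 + 3 / 2 * a ^+ 2) A0.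
exists K => e X Y m e0 e1 X0 mE YE; apply: le_trans (hK X).
have m0 : 0 <= m by lra.
set S := X + e in mE YE *.
have S0 : 0 <= S by rewrite /S; lra.
have XS : X <= S by rewrite /S; lra.
have SX : S <= X + 1 by rewrite /S; lra.
have S2 : S ^+ 2 <= (X + 1) ^+ 2 by apply: lerXn2r; rewrite ?nnegrE; lra.
have S2X : X ^+ 2 <= S ^+ 2 by apply: lerXn2r; rewrite ?nnegrE; lra.
have h1 : m ^+ 2 - 3 * (Y - a) ^+ 2 <= S * (2 * e - 7 * X) / 8 + 3 * a ^+ 2.
  have := sqrB_half_le Y a.
  have -> : m ^+ 2 = S * (X + e) / 4 by rewrite mE -/S; field.
  rewrite YE; lra.
have h3 : m * (m ^+ 2 - 3 * (Y - a) ^+ 2) <= m * (S * (2 * e - 7 * X) / 8 + 3 * a ^+ 2).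
  by rewrite ler_wpM2l.
have h4 : m * (S * (2 * e - 7 * X) / 8 + 3 * a ^+ 2) =
   e * S ^+ 2 / 8 - 7 / 16 * (X * S ^+ 2) + 3 / 2 * a ^+ 2 * S.
  by rewrite mE; field.
have h5 : e * S ^+ 2 <= (X + 1) ^+ 2.
  by apply: le_trans S2; rewrite ler_piMl// sqr_ge0.
have h6 : X * X ^+ 2 <= X * S ^+ 2 by rewrite ler_wpM2l.
have h7 : 0 <= X * (X - 2) ^+ 2 by rewrite mulr_ge0// sqr_ge0.
have h8 : a ^+ 2 * S <= a ^+ 2 * (X + 1) by rewrite ler_wpM2l// sqr_ge0.
have h9 : e * (m ^+ 2 - (Y - b) ^+ 2) <= (X + 1) ^+ 2 / 4.
  apply: (@le_trans _ _ (e * m ^+ 2)); first by rewrite ler_wpM2l// gerBl sqr_ge0.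
  by rewrite (_ : e * m ^+ 2 = e * S ^+ 2 / 4); [lra|rewrite mE; field].
lra.
Qed.

End RealBounds.

(** * The family of hyperbolas and the exponent along it *)

Section Contour.
Context {R : realType}.
Variable z : R.
Implicit Types (k t x l : R).

Definition rad t x := Num.sqrt (x ^+ 2 + t ^+ 2).

(* [contour k t] runs through the points sigma with
   Re sigma = k sqrt (Im(sigma)^2 + 9 t^2 / 4). *)
Definition contour k t x : R[i] := 3 / 2 * ((k * rad t x)%:C + 'i%C * x%:C).
Definition contour_dx k t x : R[i] := 3 / 2 * ((k * (x / rad t x))%:C + 'i%C).

(* With eps = 9 t^2 / 4 and sigma^2 = eps + i (z + 3 xi), this is i (xi + z/3). *)
Definition height k t x : R[i] := (contour k t x ^+ 2 - (9 / 4 * t ^+ 2)%:C) / 3.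

(** At y = i (xi + z/3) this is i (xi - z/3)^3 - eps xi^2. Being a polynomial in y, it extends to
    every contour of the family. *)
Definition phase t (y : R[i]) : R[i] :=
  - (y - 'i%C * (2 / 3 * z)%:C) ^+ 3
  + (9 / 4 * t ^+ 2)%:C * (y - 'i%C * (z / 3)%:C) ^+ 2.
Definition phase_dy t (y : R[i]) : R[i] :=
  - (3 * (y - 'i%C * (2 / 3 * z)%:C) ^+ 2)
  + 2 * (9 / 4 * t ^+ 2)%:C * (y - 'i%C * (z / 3)%:C).

Definition wave k t x : R[i] := cexp (phase t (height k t x)).

Lemma rad_sqr t x : rad t x ^+ 2 = x ^+ 2 + t ^+ 2.
Proof. by rewrite sqr_sqrtr// addr_ge0 ?sqr_ge0. Qed.

Lemma rad_ge0 t x : 0 <= rad t x. Proof. exact: sqrtr_ge0. Qed.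

Lemma rad_gt0 t x : t != 0 -> 0 < rad t x.
Proof. by move=> t0; rewrite sqrtr_gt0 ltr_wpDl ?sqr_ge0// exprn_even_gt0. Qed.

Lemma rad_ge t x : `|x| <= rad t x.
Proof. by rewrite -sqrtr_sqr ler_wsqrtr// lerDl sqr_ge0. Qed.

Lemma rad_gt t x : t != 0 -> `|x| < rad t x.
Proof.
move=> t0; rewrite -sqrtr_sqr ltr_sqrt; first by rewrite ltrDl exprn_even_gt0.
by rewrite ltr_wpDl ?sqr_ge0// exprn_even_gt0.
Qed.

Lemma rad_ratio t x : `|x / rad t x| <= 1.
Proof.
(* At t = x = 0 the quotient is 0 by the convention for inverses; the bound is needed there too, for
   the limit t = 0. *)
have [r0|r0] := eqVneq (rad t x) 0; first by rewrite r0 invr0 mulr0 normr0.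
by rewrite normrM normfV ler_pdivrMr ?normr_gt0// mul1r [leRHS]ger0_norm ?rad_ge0 ?rad_ge.
Qed.

Lemma is_derive_rad t x : t != 0 -> is_derive x 1 (rad t) (x / rad t x).
Proof.
move=> t0; have p0 : 0 < x ^+ 2 + t ^+ 2.
  by rewrite ltr_wpDl ?sqr_ge0// exprn_even_gt0.
have dc : is_derive x 1 (fun=> t ^+ 2 : R) 0 by exact: is_derive_cst.
have h := @is_derive1_comp _ Num.sqrt (fun x => x ^+ 2 + t ^+ 2) x _ _
  (is_derive1_sqrt p0) (is_derive_funD (is_derive_sqr (is_derive_id x 1)) dc).
rewrite (_ : x / rad t x = (2 * Num.sqrt (x ^+ 2 + t ^+ 2))^-1 * (2 * (x * 1) + 0))//.
by rewrite addr0 mulr1 -/(rad t x) invfM mulrACA mulVf// mul1r mulrC.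
Qed.

Lemma continuous_ratio t : t != 0 -> continuous (fun x => x / rad t x).
Proof.
move=> t0 x; apply: cvgM; first exact: cvg_id.
apply: cvgV; first by rewrite gt_eqF// rad_gt0.
by apply: (is_derive1_continuous (f' := fun x => x / rad t x)) => y; exact: is_derive_rad.
Qed.

Lemma heightE k t x : height k t x =
  (- (3 / 4 * (1 - k ^+ 2) * (x ^+ 2 + t ^+ 2))) +i* (3 / 2 * (k * x * rad t x)).
Proof.
have h2 : (3 / 2 : R[i]) = (3 / 2)%:C by rewrite rmorphM/= fmorphV !rmorph_nat.
have h3 : (3^-1 : R[i]) = (3^-1)%:C by rewrite fmorphV rmorph_nat.
have := rad_sqr t x; rewrite /height /contour h2 h3; move: (rad t x) => r rE.
have tE : t ^+ 2 = r ^+ 2 - x ^+ 2 by rewrite rE addrC addKr.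
apply: complex_ext; rewrite expr2 !ReImE/= ?tE.
  by field.
by field.
Qed.

(** The height is - m + i Y, and this is the exponent estimated by [deformation_exponent_bound] and
    [rotated_exponent_bound], with e = t^2. *)
Lemma normc_wave k t x :
  let m := 3 / 4 * (1 - k ^+ 2) * (x ^+ 2 + t ^+ 2) in
  let Y := 3 / 2 * (k * x * rad t x) in
  normc (wave k t x) = expR (m ^+ 3 - 3 * m * (Y - 2 / 3 * z) ^+ 2
    + 9 / 4 * t ^+ 2 * (m ^+ 2 - (Y - z / 3) ^+ 2)).
Proof.
move=> m Y; rewrite normc_cexp heightE -/m -/Y; congr expR.
rewrite /phase !exprS expr0 !ReImE/=; ring.
Qed.

End Contour.

(** * Moving the contour at fixed regularisation *)

Section ContourDeformation.
Context {R : realType}.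
Variable z : R.
Implicit Types (k t x l : R).

Definition contour_dl l t x : R[i] := 3 / 2 * (- (2 * l) * rad t x)%:C.

Lemma cderiv_contour k t x : t != 0 ->
  cderiv (contour k t) x (contour_dx k t x).
Proof.
move=> t0; apply: cderivZ; apply: cderiv_eq.
  apply: cderivD; last by apply: cderivZ; exact: cderiv_id.
  apply: (@cderiv_ext _ (fun x => k%:C * (rad t x)%:C)).
    by move=> y; rewrite -rmorphM.
  by apply: cderivZ; exact: cderiv_real (is_derive_rad x t0).
by rewrite mulr1 -rmorphM.
Qed.

Lemma is_derive_1Bsqr l : is_derive l 1 (fun l => 1 - l ^+ 2) (- (2 * l)).
Proof.
have dc : is_derive l 1 (fun=> 1 : R) 0 by exact: is_derive_cst.
have d2 : is_derive l 1 (fun t : R => - t ^+ 2) (- (2 * (l * 1))).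
  exact: (is_deriveN (is_derive_sqr (is_derive_id l 1))).
have := is_derive_funD dc d2.
by rewrite add0r mulr1.
Qed.

Lemma cderiv_contour_l l t x :
  cderiv (fun l => contour (1 - l ^+ 2) t x) l (contour_dl l t x).
Proof.
apply: cderivZ; apply: cderiv_eq.
  apply: cderivD; last exact: cderiv_cst.
  apply: (@cderiv_ext _ (fun l => (rad t x)%:C * (1 - l ^+ 2)%:C)).
    by move=> y; rewrite -rmorphM mulrC.
  by apply: cderivZ; exact: cderiv_real (is_derive_1Bsqr l).
by rewrite addr0 -rmorphM [rad t x * _]mulrC.
Qed.

Lemma cderiv_contour_dx_l l t x :
  cderiv (fun l => contour_dx (1 - l ^+ 2) t x) l
    (3 / 2 * (- (2 * l) * (x / rad t x))%:C).
Proof.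
apply: cderivZ; apply: cderiv_eq.
  apply: cderivD; last exact: cderiv_cst.
  apply: (@cderiv_ext _ (fun l => (x / rad t x)%:C * (1 - l ^+ 2)%:C)).
    by move=> y; rewrite -rmorphM mulrC.
  by apply: cderivZ; exact: cderiv_real (is_derive_1Bsqr l).
by rewrite addr0 -rmorphM [x / rad t x * _]mulrC.
Qed.

(** The same value as in [cderiv_contour_dx_l]: this equality of mixed derivatives makes the
    l-derivative of the integrand an exact x-derivative. *)
Lemma cderiv_contour_dl l t x : t != 0 ->
  cderiv (contour_dl l t) x (3 / 2 * (- (2 * l) * (x / rad t x))%:C).
Proof.
move=> t0; apply: cderivZ; apply: cderiv_eq.
  apply: (@cderiv_ext _ (fun x => (- (2 * l))%:C * (rad t x)%:C)).
    by move=> y; rewrite -rmorphM.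
  by apply: cderivZ; exact: cderiv_real (is_derive_rad x t0).
by rewrite -rmorphM.
Qed.

(** The curve [f] is arbitrary, so the rule serves both along a contour and across the family at
    fixed x. *)
Lemma cderiv_wave t x d (f : R -> R[i]) :
  cderiv f x d ->
  cderiv (fun y => cexp (phase z t ((f y ^+ 2 - (9 / 4 * t ^+ 2)%:C) / 3))) x
    (phase_dy z t ((f x ^+ 2 - (9 / 4 * t ^+ 2)%:C) / 3) * (2 / 3 * f x * d)
      * cexp (phase z t ((f x ^+ 2 - (9 / 4 * t ^+ 2)%:C) / 3))).
Proof.
move=> df; apply: cderiv_cexp.
have dh : cderiv (fun y => (f y ^+ 2 - (9 / 4 * t ^+ 2)%:C) / 3) x (2 / 3 * f x * d).
  apply: (@cderiv_ext _ (fun y => 3^-1 * (f y ^+ 2 - (9 / 4 * t ^+ 2)%:C))).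
    by move=> y; rewrite mulrC.
  apply: cderiv_eq.
    by apply: cderivZ; apply: cderivB; [exact: cderivX df|exact: cderiv_cst].
  by rewrite subr0 /= expr1; field.
apply: cderiv_eq.
  apply: cderivD.
    by apply: cderivN; apply: cderivX; apply: cderivB dh _; exact: cderiv_cst.
  by apply: cderivZ; apply: cderivX; apply: cderivB dh _; exact: cderiv_cst.
by rewrite /phase_dy /= expr1; ring.
Qed.

Lemma ccont_ratio t : t != 0 -> ccont (fun x => (x / rad t x)%:C : R[i]).
Proof. by move=> t0; apply: ccont_real; exact: continuous_ratio. Qed.

Lemma ccont_contour k t : t != 0 -> ccont (contour k t).
Proof. by move=> t0; apply: cderiv_ccont => x; exact: cderiv_contour. Qed.

Lemma ccont_contour_dx k t : t != 0 -> ccont (contour_dx k t).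
Proof.
move=> t0; apply: ccontM; first exact: ccont_cst.
apply: ccontD; last exact: ccont_cst.
apply: (@ccont_ext _ (fun x => k%:C * (x / rad t x)%:C)).
  by move=> y; rewrite -rmorphM.
by apply: ccontM; [exact: ccont_cst|exact: ccont_ratio].
Qed.

Lemma ccont_wave k t : t != 0 -> ccont (wave z k t).
Proof.
by move=> t0; apply: cderiv_ccont => x; apply: cderiv_wave; exact: cderiv_contour.
Qed.

Lemma ccont_height k t : t != 0 -> ccont (height k t).
Proof.
move=> t0; apply: ccontM; last exact: ccont_cst.
apply: ccontD; last exact: ccont_cst.
by apply: ccontX; exact: ccont_contour.
Qed.

Lemma ccont_phase_dy t (f : R -> R[i]) : ccont f -> ccont (fun x => phase_dy z t (f x)).
Proof.
move=> cf; have cB c : ccont (fun x => f x - c).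
  by apply: ccontD => //; exact: ccont_cst.
apply: ccontD.
  by apply: ccontN; apply: ccontM; [exact: ccont_cst|exact: ccontX].
by apply: ccontM; [exact: ccont_cst|exact: cB].
Qed.

Section Bounds.
Variable t : R.
Hypothesis t0 : t != 0.
(** Large enough to contain sqrt (1 - 1/sqrt 3), about 0.65, and small enough to keep the slope 1 -
    l^2 above 1/2. *)
Let D l := - (7 / 10) < l < 7 / 10.

Lemma pbound_parameter (f : R -> R) (M : R) : (forall l, D l -> `|f l| <= M) ->
  pbound D (fun l _ => (f l)%:C : R[i]).
Proof. by move=> h; apply: (@pbound_param _ _ _ _ M) => l _ Dl; rewrite normcR h. Qed.

Lemma D_norm l : D l -> `|l| <= 1.
Proof. by rewrite /D => /andP[l1 l2]; rewrite ler_norml; apply/andP; split; lra. Qed.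

Lemma D_sqr l : D l -> 0 <= l ^+ 2 /\ l ^+ 2 <= 49 / 100.
Proof. by rewrite /D => /andP[l1 l2]; split; [exact: sqr_ge0|nra]. Qed.

Lemma pbound_rad : pbound D (fun _ x => (rad t x)%:C : R[i]).
Proof.
apply: (@pbound_le _ _ _ _ (fun _ x => x ^+ 2 + (t ^+ 2 + 1))).
  have := pboundD (pboundX 2 (@pbound_id R _ D)) (pbound_cst D ((t ^+ 2 + 1)%:C : R[i])).
  move=> [C [n h]]; exists C, n => l x /(h l x); apply: le_trans.
  by rewrite rmorphD rmorphXn.
move=> l x _; rewrite normcR ger0_norm ?rad_ge0//.
have := sqr_ge0 (rad t x - 1); have := rad_sqr t x; have := sqr_ge0 x; have := sqr_ge0 t.
lra.
Qed.

Lemma pbound_ratio : pbound D (fun _ x => (x / rad t x)%:C : R[i]).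
Proof.
by apply: (@pbound_param _ _ _ _ 1) => l x _; rewrite normcR rad_ratio.
Qed.

Lemma pbound_k : pbound D (fun l _ => (1 - l ^+ 2)%:C : R[i]).
Proof.
apply: (@pbound_parameter _ 1) => l /D_sqr[l1 l2].
by rewrite ler_norml; apply/andP; split; lra.
Qed.

Lemma pbound_2l : pbound D (fun l _ => (- (2 * l))%:C : R[i]).
Proof.
apply: (@pbound_parameter _ 2) => l /D_norm l1.
by rewrite normrN normrM ger0_norm// ler_piMr.
Qed.

Lemma pbound_ext (f g : R -> R -> R[i]) : (forall l x, f l x = g l x) ->
  pbound D f -> pbound D g.
Proof. by move=> fg [C [n h]]; exists C, n => l x; rewrite -fg; exact: h. Qed.

Lemma pbound_contour : pbound D (fun l x => contour (1 - l ^+ 2) t x).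
Proof.
apply: pboundM; first exact: pbound_cst.
apply: pboundD.
  apply: (@pbound_ext (fun l x => (1 - l ^+ 2)%:C * (rad t x)%:C)).
    by move=> l x; rewrite -rmorphM.
  by apply: pboundM; [exact: pbound_k|exact: pbound_rad].
by apply: pboundM; [exact: pbound_cst|exact: pbound_id].
Qed.

Lemma pbound_contour_dx : pbound D (fun l x => contour_dx (1 - l ^+ 2) t x).
Proof.
apply: pboundM; first exact: pbound_cst.
apply: pboundD; last exact: pbound_cst.
apply: (@pbound_ext (fun l x => (1 - l ^+ 2)%:C * (x / rad t x)%:C)).
  by move=> l x; rewrite -rmorphM.
by apply: pboundM; [exact: pbound_k|exact: pbound_ratio].
Qed.

Lemma pbound_contour_dl : pbound D (fun l x => contour_dl l t x).
Proof.
apply: pboundM; first exact: pbound_cst.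
apply: (@pbound_ext (fun l x => (- (2 * l))%:C * (rad t x)%:C)).
  by move=> l x; rewrite -rmorphM.
by apply: pboundM; [exact: pbound_2l|exact: pbound_rad].
Qed.

Lemma pbound_contour_dxl :
  pbound D (fun l x => 3 / 2 * (- (2 * l) * (x / rad t x))%:C).
Proof.
apply: pboundM; first exact: pbound_cst.
apply: (@pbound_ext (fun l x => (- (2 * l))%:C * (x / rad t x)%:C)).
  by move=> l x; rewrite -rmorphM.
by apply: pboundM; [exact: pbound_2l|exact: pbound_ratio].
Qed.

Lemma pbound_phase_dy :
  pbound D (fun l x => phase_dy z t (height (1 - l ^+ 2) t x)).
Proof.
have ph : pbound D (fun l x => height (1 - l ^+ 2) t x).
  apply: pboundM; last exact: pbound_cst.
  apply: pboundB; last exact: pbound_cst.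
  by apply: pboundX; exact: pbound_contour.
have pB c : pbound D (fun l x => height (1 - l ^+ 2) t x - c).
  by apply: pboundB => //; exact: pbound_cst.
apply: pboundD.
  by apply: pboundN; apply: pboundM; [exact: pbound_cst|exact: pboundX].
by apply: pboundM; [exact: pbound_cst|exact: pB].
Qed.

Lemma gbound_wave : gbound D (fun l x => wave z (1 - l ^+ 2) t x).
Proof.
have e0 : 0 < t ^+ 2 by rewrite exprn_even_gt0.
have [K hK] := deformation_exponent_bound (2 / 3 * z) (z / 3) e0.
exists (expR K), 1; split => // l x Dl.
rewrite normc_wave -expRD ler_expR mul1r.
have [l0 l1] := D_sqr Dl.
have X0 := sqr_ge0 x; have S0 := addr_ge0 X0 (ltW e0).
(* For the slope k, k^2 >= 1/4 yields both constants 9/16 of the exponent bound: 3/4 (1 - k^2) <=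
   9/16 and (3/2)^2 k^2 >= 9/16. *)
have k1 : 1 / 2 <= 1 - l ^+ 2 by lra.
have k2 : 1 / 4 <= (1 - l ^+ 2) ^+ 2 by nra.
have k3 : (1 - l ^+ 2) ^+ 2 <= 1 by nra.
apply: hK => //.
- by apply: mulr_ge0 => //; lra.
- by apply: ler_wpM2r => //; lra.
- rewrite !exprMn rad_sqr.
  have k4 : 0 <= (1 - l ^+ 2) ^+ 2 - 1 / 4 by lra.
  have := mulr_ge0 k4 (mulr_ge0 X0 S0); lra.
Qed.

End Bounds.

(* The slope is written 1 - l^2 so that l = 0, the original contour, is interior
   to an interval of parameters. *)
Lemma contour_deformation t l : t != 0 -> - (7 / 10) < l < 7 / 10 ->
  cint (fun x => contour_dx 1 t x * wave z 1 t x) =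
  cint (fun x => contour_dx (1 - l ^+ 2) t x * wave z (1 - l ^+ 2) t x).
Proof.
move=> t0 lD.
(* The wave w depends on sigma alone, so the l-derivative of sigma_x w and the x-derivative of
   sigma_l w agree; their common value is [q] times the wave. *)
pose h l x := contour_dx (1 - l ^+ 2) t x * wave z (1 - l ^+ 2) t x.
pose G l x := contour_dl l t x * wave z (1 - l ^+ 2) t x.
pose q l x := 3 / 2 * (- (2 * l) * (x / rad t x))%:C
  + contour_dx (1 - l ^+ 2) t x * (phase_dy z t (height (1 - l ^+ 2) t x)
      * (2 / 3 * contour (1 - l ^+ 2) t x * contour_dl l t x)).
have gw := gbound_wave t0.
have D0 : - (7 / 10) < (0 : R) < 7 / 10 by apply/andP; split; lra.
transitivity (cint (h 0)).
  by apply: eq_cint => x; rewrite /h expr0n subr0.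
refine (@cint_homotopy _ h (fun l x => q l x * wave z (1 - l ^+ 2) t x) G
  (- (7 / 10)) (7 / 10) _ _ _ _ _ _ _ 0 l D0 lD).
- by move=> s _; apply: ccontM; [exact: ccont_contour_dx|exact: ccont_wave].
- move=> s _; apply: ccontM; last exact: ccont_wave.
  apply: ccontD.
    apply: ccontM; first exact: ccont_cst.
    apply: (@ccont_ext _ (fun x => (- (2 * s))%:C * (x / rad t x)%:C)).
      by move=> y; rewrite -rmorphM.
    by apply: ccontM; [exact: ccont_cst|exact: ccont_ratio].
  apply: ccontM; first exact: ccont_contour_dx.
  apply: ccontM; first by apply: ccont_phase_dy; exact: ccont_height.
  apply: ccontM.
    by apply: ccontM; [exact: ccont_cst|exact: ccont_contour].
  by apply: cderiv_ccont => y; exact: cderiv_contour_dl.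
- move=> s x _; apply: cderiv_eq.
    apply: cderivM; first exact: cderiv_contour_dx_l.
    by apply: cderiv_wave; exact: cderiv_contour_l.
  by rewrite /q -/(height _ _ _) -/(wave _ _ _ _); ring.
- move=> s x _; apply: cderiv_eq.
    apply: cderivM; first exact: cderiv_contour_dl.
    by apply: cderiv_wave; exact: cderiv_contour.
  by rewrite /q -/(height _ _ _) -/(wave _ _ _ _); ring.
- by apply: pbound_gbound => //; exact: pbound_contour_dx.
- apply: pbound_gbound => //; apply: pboundD; first exact: pbound_contour_dxl.
  apply: pboundM; first exact: pbound_contour_dx.
  apply: pboundM; first exact: pbound_phase_dy.
  apply: pboundM; last exact: pbound_contour_dl.
  by apply: pboundM; [exact: pbound_cst|exact: pbound_contour].
- by apply: pbound_gbound => //; exact: pbound_contour_dl.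
Qed.

End ContourDeformation.

(** * Folding the line at the origin *)

Section Reflection.
Context {R : realType}.
Let mu := @lebesgue_measure R.

Lemma Rintegral_reflect (f : R -> R) : continuous f -> lintegrable f ->
  lintegrable (fun x => f (- x)) -> \int[mu]_x f x = \int[mu]_x f (- x).
Proof.
move=> cf fi fNi.
have ny : (n.+1%:R : R) @[n --> \oo] --> +oo.
  by apply/cvgryPge => A; near=> n; apply: le_trans (_ : n%:R <= _);
    [near: n; exact: nbhs_infty_ger|rewrite ler_nat].
have nNy : - (n.+1%:R : R) @[n --> \oo] --> -oo by move/cvgNrNy : ny.
have h1 := cvg_Rintegral_itv fi nNy ny.
have h2 := cvg_Rintegral_itv fNi nNy ny.
have E : (fun n : nat => \int[mu]_(x in `[- n.+1%:R, n.+1%:R]) f x) =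
    (fun n : nat => \int[mu]_(x in `[- n.+1%:R, n.+1%:R]) f (- x)).
  apply/funext => n; rewrite /Rintegral; congr fine.
  have nn : - n.+1%:R <= n.+1%:R :> R by rewrite lerNl (le_trans _ (ler0n _ _))// oppr_le0.
  have := @integration_by_substitution_oppr _ f _ _ nn.
  by rewrite opprK; apply; exact: continuous_subspaceT.
rewrite E in h1; apply: cvg_unique h1 h2; exact: norm_hausdorff.
Unshelve. all: end_near. Qed.

Lemma cint_reflect (f : R -> R[i]) : ccont f -> cintegrable f ->
  cintegrable (fun x => f (- x)) -> cint f = cint (fun x => f (- x)).
Proof.
move=> [c1 c2] [i1 i2] [j1 j2]; apply: complex_ext => /=.
  exact: Rintegral_reflect c1 i1 j1.
exact: Rintegral_reflect c2 i2 j2.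
Qed.

(** At t = 0 the contour has a corner at the origin. Folding turns its two rays into one even
    integrand on the whole line, so that no half-line integrals occur. *)
Lemma cint_symmetrize (f : R -> R[i]) : ccont f -> gdom f ->
  cint f = 2^-1 * cint (fun x => f x + f (- x)).
Proof.
move=> cf [C [c [c0 h]]].
have fi : cintegrable f by apply: gdom_cintegrable => //; exists C, c.
have cN : ccont (fun x => f (- x)).
  case: cf => c1 c2; split => x.
    by apply: (@continuous_comp _ _ _ -%R (fun t => complex.Re (f t))); [exact: opp_continuous|exact: c1].
  by apply: (@continuous_comp _ _ _ -%R (fun t => complex.Im (f t))); [exact: opp_continuous|exact: c2].
have fNi : cintegrable (fun x => f (- x)).
  apply: gdom_cintegrable => //; exists C, c; split => // x.
  by rewrite (le_trans (h _))// sqrrN.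
by rewrite cintD// -(cint_reflect cf fi fNi); field.
Qed.

End Reflection.

Section ParameterContinuity.
Context {R : realType}.
Local Notation Re := complex.Re.
Local Notation Im := complex.Im.

Lemma ccvg_cint (h : R -> R -> R[i]) (t0 u v C c : R) : u < t0 < v -> 0 < c ->
  (forall t, u < t < v -> cintegrable (h t)) ->
  (forall x, ccont (h ^~ x)) ->
  (forall t x, u < t < v -> normc (h t x) <= C * expR (- (c * x ^+ 2))) ->
  ccvg (nbhs t0) (fun t => cint (h t)) (cint (h t0)).
Proof.
move=> tI c0 hi ch hC; have gi := lintegrable_gdom C c0.
have uvI t : `]u, v[%classic t -> u < t < v by rewrite /= in_itv.
have I0 : t0 \in `]u, v[%classic by rewrite inE/= in_itv.
split => /=.
- have := @continuity_under_integral _ _ _ (@lebesgue_measure R)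
    (fun t x => Re (h t x)) setT measurableT u v.
  move=> /(_ _ _ _ gi _ _ I0); apply.
  + by move=> t /uvI tI'; have [] := hi t tI'.
  + by apply: aeW => x _ t _; have [cR _] := ch x; exact: cR.
  + by move=> t /uvI tI'; apply: aeW => x _; rewrite (le_trans (normr_Re_le _))// hC.
- have := @continuity_under_integral _ _ _ (@lebesgue_measure R)
    (fun t x => Im (h t x)) setT measurableT u v.
  move=> /(_ _ _ _ gi _ _ I0); apply.
  + by move=> t /uvI tI'; have [] := hi t tI'.
  + by apply: aeW => x _ t _; have [_ cI] := ch x; exact: cI.
  + by move=> t /uvI tI'; apply: aeW => x _; rewrite (le_trans (normr_Im_le _))// hC.
Qed.

End ParameterContinuity.

(** * The contour with asymptotes e^(+-i pi/3) and its limit *)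

Section RotatedContour.
Context {R : realType}.
Variable z : R.
Implicit Types (t x : R).

(** Re sigma = |Im sigma| / sqrt 3 describes the directions e^(+-i pi/3), which are [omega] and
    [omegaN]; there sigma^6 is positive. *)
Definition slope : R := (Num.sqrt 3)^-1.
Definition omega : R[i] := (1 / 2) +i* (Num.sqrt 3 / 2).
Definition omegaN : R[i] := (1 / 2) -i* (Num.sqrt 3 / 2).

Definition rotated t x : R[i] := contour_dx slope t x * wave z slope t x.

Lemma sqrt3_sqr : (Num.sqrt 3 : R) ^+ 2 = 3.
Proof. by rewrite sqr_sqrtr. Qed.

Lemma sqrt3_neq0 : (Num.sqrt 3 : R) != 0.
Proof. by rewrite sqrtr_eq0 -ltNge. Qed.

Lemma slope_sqr : slope ^+ 2 = 3^-1.
Proof. by rewrite /slope exprVn sqrt3_sqr. Qed.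

Lemma slopeE : slope = Num.sqrt 3 / 3.
Proof. by rewrite /slope -[X in _ / X]sqrt3_sqr; field; exact: sqrt3_neq0. Qed.

Lemma slope_gt0 : 0 < slope.
Proof. by rewrite invr_gt0 sqrtr_gt0. Qed.

Lemma slope_lt1 : slope < 1.
Proof. have := slope_sqr; have := slope_gt0 => ? ?; nra. Qed.

Lemma rotated_bound : exists C, forall t x, -1 < t < 1 ->
  normc (rotated t x) <= C * expR (- (1 * x ^+ 2)).
Proof.
have [K hK] := rotated_exponent_bound (2 / 3 * z) (z / 3).
exists (3 * expR K) => t x /andP[t1 t2].
rewrite normcM mul1r -mulrA -expRD; apply: ler_pM; rewrite ?normc_ge0//.
- rewrite /contour_dx normcM.
  have -> : (3 / 2 : R[i]) = (3 / 2)%:C by rewrite rmorphM/= fmorphV !rmorph_nat.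
  rewrite normcR ger0_norm; last by lra.
  have h1 := normcD ((slope * (x / rad t x))%:C : R[i]) 'i%C.
  have h2 : normc ((slope * (x / rad t x))%:C : R[i]) <= 1.
    rewrite normcR normrM (gtr0_norm slope_gt0).
    by have := rad_ratio t x; have := slope_lt1; have := slope_gt0; have := normr_ge0 (x / rad t x); nra.
  rewrite normcI in h1; lra.
- rewrite normc_wave ler_expR; apply: hK.
  + exact: sqr_ge0.
  + by nra.
  + exact: sqr_ge0.
  + by rewrite slope_sqr; field.
  + by rewrite !exprMn slope_sqr rad_sqr; field.
Qed.

Lemma ccont_rotated t : t != 0 -> ccont (rotated t).
Proof. by move=> t0; apply: ccontM; [exact: ccont_contour_dx|exact: ccont_wave]. Qed.

Lemma continuous_rad_l x : continuous (fun t : R => rad t x).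
Proof.
move=> t; apply: continuous_comp; last exact: sqrt_continuous.
by apply: cvgD; [exact: cvg_cst|exact: exprn_continuous].
Qed.

Lemma ccont_rotated_l x : ccont (rotated ^~ x).
Proof.
have cr := @continuous_rad_l x.
apply: ccontM.
  apply: ccontM; first exact: ccont_cst.
  apply: ccontD; last exact: ccont_cst.
  apply: ccont_real => t; apply: cvgM; first exact: cvg_cst.
  (* For x = 0 the quotient is 0 for every t, while its denominator vanishes at t = 0; continuity of
     the inverse is available only for x != 0. *)
  have [->|x0] := eqVneq x 0.
    by under eq_fun do rewrite mul0r; rewrite mul0r; exact: cvg_cst.
  apply: cvgM; first exact: cvg_cst.
  apply: cvgV; last exact: cr.
  by rewrite gt_eqF// (lt_le_trans _ (rad_ge _ _))// normr_gt0.
have ct : ccont (fun t : R => (9 / 4 * t ^+ 2)%:C : R[i]).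
  by apply: ccont_real => t; apply: cvgM; [exact: cvg_cst|exact: exprn_continuous].
have chh : ccont (fun t => height slope t x).
  apply: ccontM; last exact: ccont_cst.
  apply: ccontD; last exact: ccontN.
  apply: ccontX; apply: ccontM; first exact: ccont_cst.
  apply: ccontD; last exact: ccont_cst.
  by apply: ccont_real => t; apply: cvgM; [exact: cvg_cst|exact: cr].
apply: ccont_cexp; apply: ccontD.
  by apply: ccontN; apply: ccontX; apply: ccontD => //; exact: ccont_cst.
apply: ccontM => //.
by apply: ccontX; apply: ccontD => //; exact: ccont_cst.
Qed.

Definition rays x : R[i] := (Num.sqrt 3)%:C *
  (omega * cubexp ('i%C * omegaN ^+ 2) (2 / 3 * z) x
   - omegaN * cubexp ('i%C * omega ^+ 2) (2 / 3 * z) x).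

Lemma omega_cube : omega ^+ 3 = -1 /\ omegaN ^+ 3 = -1 /\ omega * omegaN = 1.
Proof.
have s3 := sqrt3_sqr.
have s4 : (Num.sqrt 3 : R) ^+ 3 = 3 * Num.sqrt 3 by rewrite exprSr s3.
rewrite /omega /omegaN; move: (Num.sqrt 3) s3 s4 => s s3 s4.
by split; [|split]; apply: complex_ext; rewrite ?exprS ?expr0 !ReImE/=; lra.
Qed.

(** The height is omega^2 x^2. Taking omega^2 out of the cube costs omega^6 = 1 and leaves x^2 - mu
    a with mu = i omegaN^2 and a = 2z/3. *)
Lemma rotated0_pos x : 0 < x -> rotated 0 x =
  (Num.sqrt 3)%:C * (omega * cubexp ('i%C * omegaN ^+ 2) (2 / 3 * z) x).
Proof.
move=> x0; have rE : rad 0 x = x by rewrite /rad expr0n addr0 sqrtr_sqr gtr0_norm.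
have s3 := sqrt3_sqr; have s0 := sqrt3_neq0.
rewrite /rotated [RHS]mulrA; congr (_ * _).
  rewrite /contour_dx rE divff ?gt_eqF// mulr1 slopeE /omega.
  have -> : (3 / 2 : R[i]) = (3 / 2)%:C by rewrite rmorphM/= fmorphV !rmorph_nat.
  move: (Num.sqrt 3) s3 => s s3.
  by apply: complex_ext; rewrite !ReImE/=; lra.
rewrite /wave /cubexp /phase; congr cexp.
rewrite expr0n/= mulr0 mul0r addr0; congr (- _).
have hE : height slope 0 x = omega ^+ 2 * (x ^+ 2)%:C.
  rewrite heightE slope_sqr rE expr0n addr0 slopeE /omega /omegaN.
  move: (Num.sqrt 3) s3 => s s3.
  have s4 : s ^+ 2 * x ^+ 2 = 3 * x ^+ 2 by rewrite s3.
  by apply: complex_ext; rewrite !expr2 !ReImE/=; lra.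
rewrite hE /cubarg.
have [w3 [n3 wn]] := omega_cube.
have -> : omega ^+ 2 * (x ^+ 2)%:C - 'i%C * (2 / 3 * z)%:C =
   omega ^+ 2 * ((x ^+ 2)%:C - 'i%C * omegaN ^+ 2 * (2 / 3 * z)%:C).
  rewrite mulrBr; congr (_ - _).
  transitivity ((omega * omegaN) ^+ 2 * ('i%C * (2 / 3 * z)%:C)); last by ring.
  by rewrite wn expr1n mul1r.
by rewrite exprMn -exprM (exprM _ 3 2) w3 sqrrN expr1n mul1r.
Qed.

Lemma rotated0_neg x : x < 0 -> rotated 0 x =
  - ((Num.sqrt 3)%:C * (omegaN * cubexp ('i%C * omega ^+ 2) (2 / 3 * z) x)).
Proof.
move=> x0; have rE : rad 0 x = - x by rewrite /rad expr0n addr0 sqrtr_sqr ltr0_norm.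
have s3 := sqrt3_sqr; have s0 := sqrt3_neq0.
rewrite /rotated -[RHS]mulNr [RHS]mulrA; congr (_ * _).
  rewrite /contour_dx rE invrN mulrN divff ?lt_eqF// slopeE /omegaN.
  have -> : (3 / 2 : R[i]) = (3 / 2)%:C by rewrite rmorphM/= fmorphV !rmorph_nat.
  move: (Num.sqrt 3) s3 => s s3.
  by apply: complex_ext; rewrite !ReImE/=; lra.
rewrite /wave /cubexp /phase; congr cexp.
rewrite expr0n/= mulr0 mul0r addr0; congr (- _).
have hE : height slope 0 x = omegaN ^+ 2 * (x ^+ 2)%:C.
  rewrite heightE slope_sqr rE expr0n addr0 slopeE /omega /omegaN.
  move: (Num.sqrt 3) s3 => s s3.
  have s4 : s ^+ 2 * x ^+ 2 = 3 * x ^+ 2 by rewrite s3.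
  by apply: complex_ext; rewrite !expr2 !ReImE/=; lra.
rewrite hE /cubarg.
have [w3 [n3 wn]] := omega_cube.
have -> : omegaN ^+ 2 * (x ^+ 2)%:C - 'i%C * (2 / 3 * z)%:C =
   omegaN ^+ 2 * ((x ^+ 2)%:C - 'i%C * omega ^+ 2 * (2 / 3 * z)%:C).
  rewrite mulrBr; congr (_ - _).
  transitivity ((omega * omegaN) ^+ 2 * ('i%C * (2 / 3 * z)%:C)); last by ring.
  by rewrite wn expr1n mul1r.
by rewrite exprMn -exprM (exprM _ 3 2) n3 sqrrN expr1n mul1r.
Qed.

Lemma cubexpN mu a x : cubexp mu a (- x) = cubexp mu a x :> R[i].
Proof. by rewrite /cubexp /cubarg sqrrN. Qed.

Lemma rotated0_sym x : rotated 0 x + rotated 0 (- x) = rays x.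
Proof.
rewrite /rays; have [x0|x0|->] := ltgtP x 0.
- have Nx0 : 0 < - x by rewrite oppr_gt0.
  by rewrite (rotated0_neg x0) (rotated0_pos Nx0) !cubexpN; ring.
- have Nx0 : - x < 0 by rewrite oppr_lt0.
  by rewrite (rotated0_pos x0) (rotated0_neg Nx0) !cubexpN; ring.
(* At x = 0 the quotient in [contour_dx] is 0, so each summand is 3i/2 times the wave. The two ray
   exponents agree there, and 3 i = sqrt 3 (omega - omegaN). *)
have [w3 [n3 wn]] := omega_cube.
rewrite oppr0 /rotated /contour_dx mul0r mulr0 add0r.
have hE : height slope 0 0 = 0.
  by rewrite heightE expr0n addr0 !(mulr0, mul0r) oppr0.
rewrite /wave /cubexp /phase /cubarg hE expr0n/= !mulr0 mul0r addr0 !sub0r.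
have e1 : (- ('i%C * omegaN ^+ 2 * (2 / 3 * z)%:C)) ^+ 3 = (- ('i%C * (2 / 3 * z)%:C)) ^+ 3.
  have -> : (- ('i%C * omegaN ^+ 2 * (2 / 3 * z)%:C)) ^+ 3 =
    (omegaN ^+ 3) ^+ 2 * (- ('i%C * (2 / 3 * z)%:C)) ^+ 3 by ring.
  by rewrite n3 sqrrN expr1n mul1r.
have e2 : (- ('i%C * omega ^+ 2 * (2 / 3 * z)%:C)) ^+ 3 = (- ('i%C * (2 / 3 * z)%:C)) ^+ 3.
  have -> : (- ('i%C * omega ^+ 2 * (2 / 3 * z)%:C)) ^+ 3 =
    (omega ^+ 3) ^+ 2 * (- ('i%C * (2 / 3 * z)%:C)) ^+ 3 by ring.
  by rewrite w3 sqrrN expr1n mul1r.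
rewrite e1 e2; move: (cexp _) => w.
have E : 3 * 'i%C = (Num.sqrt 3)%:C * (omega - omegaN) :> R[i].
  have -> : (3 : R[i]) = 3%:C by rewrite rmorph_nat.
  rewrite /omega /omegaN; have := sqrt3_sqr; move: (Num.sqrt 3) => s s3.
  by apply: complex_ext; rewrite !ReImE/=; lra.
by transitivity (3 * 'i%C * w); [field|rewrite E; ring].
Qed.

Lemma cvg_rotated : ccvg (nbhs (0 : R)) (fun t => cint (fun x => rotated t x + rotated t (- x)))
  ((Num.sqrt 3)%:C * (omega * cint (cubexp ('i%C * omegaN ^+ 2) (2 / 3 * z))
   - omegaN * cint (cubexp ('i%C * omega ^+ 2) (2 / 3 * z)))).
Proof.
have ci mu : cintegrable (cubexp mu (2 / 3 * z)).
  have := @cintegrable_cubint R mu 1 (2 / 3 * z).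
  by under eq_fun do rewrite hornerC mul1r.
have -> : (Num.sqrt 3)%:C * (omega * cint (cubexp ('i%C * omegaN ^+ 2) (2 / 3 * z))
   - omegaN * cint (cubexp ('i%C * omega ^+ 2) (2 / 3 * z))) =
   cint (fun x => rotated 0 x + rotated 0 (- x)).
  rewrite (eq_cint rotated0_sym) /rays cintZ.
    congr (_ * _); rewrite -mulNr -!cintZ// -cintD; [|exact: cintegrableZ..].
    by apply: eq_cint => x; rewrite mulNr.
  under eq_fun do rewrite -mulNr.
  by apply: cintegrableD; exact: cintegrableZ.
have [C hC] := rotated_bound.
have I0 : -1 < (0 : R) < 1 by rewrite ltrN10 ltr01.
have hC2 t x : -1 < t < 1 ->
    normc (rotated t x + rotated t (- x)) <= 2 * C * expR (- (1 * x ^+ 2)).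
  move=> tI; rewrite (le_trans (normcD _ _))//.
  by have := hC t x tI; have := hC t (- x) tI; rewrite sqrrN; lra.
apply: (@ccvg_cint _ (fun t x => rotated t x + rotated t (- x)) 0 (-1) 1 (2 * C) 1) => //.
(* At t = 0 continuity of the contour integrand fails at the corner; integrability is read off from
   the closed form [rays]. *)
- move=> t tI; have [->|t0] := eqVneq t 0.
    under eq_fun do rewrite rotated0_sym.
    apply: cintegrableZ; under eq_fun do rewrite -mulNr.
    by apply: cintegrableD; exact: cintegrableZ.
  apply: gdom_cintegrable; last by exists (2 * C), 1; split => // x; exact: hC2.
  have := ccont_rotated t0 => cr; apply: ccontD => //.
  case: cr => c1 c2; split => x.
    by apply: (@continuous_comp _ _ _ -%R (fun s => complex.Re (rotated t s))); [exact: opp_continuous|exact: c1].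
  by apply: (@continuous_comp _ _ _ -%R (fun s => complex.Im (rotated t s))); [exact: opp_continuous|exact: c2].
- by move=> x; apply: ccontD; exact: ccont_rotated_l.
Qed.

Lemma cint_contour_rotated t : t != 0 -> -1 < t < 1 ->
  cint (fun x => contour_dx 1 t x * wave z 1 t x) =
  2^-1 * cint (fun x => rotated t x + rotated t (- x)).
Proof.
move=> t0 tI; have [C hC] := rotated_bound.
have sE : 1 - (Num.sqrt (1 - slope)) ^+ 2 = slope.
  by rewrite sqr_sqrtr ?subr_ge0 ?ltW ?slope_lt1// opprB addrC subrK.
rewrite (@contour_deformation _ z t (Num.sqrt (1 - slope)))//.
  rewrite sE -/(rotated t) cint_symmetrize//; first exact: ccont_rotated.
  by exists C, 1; split => // x; exact: hC.
have q0 := sqrtr_ge0 (1 - slope).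
apply/andP; split; first by lra.
(* l = sqrt (1 - slope) is below 7/10 exactly when slope > 51/100, and (51/100)^2 < 1/3. *)
have s1 : 51 / 100 < slope.
  rewrite ltNge; apply/negP => h.
  have : slope ^+ 2 <= (51 / 100) ^+ 2.
    by apply: lerXn2r => //; rewrite nnegrE; have := slope_gt0; lra.
  by rewrite slope_sqr; lra.
rewrite ltNge; apply/negP => h.
have : (7 / 10) ^+ 2 <= Num.sqrt (1 - slope) ^+ 2 by apply: lerXn2r; rewrite ?nnegrE; lra.
by rewrite sqr_sqrtr; have := slope_lt1; lra.
Qed.

End RotatedContour.

(** * From the double integral to the contour integral *)

Section Regularized.
Context {R : realType}.
Variables (z eps : R).
Hypothesis eps0 : 0 < eps.
Implicit Types (xi eta x : R).
Local Notation Re := complex.Re.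
Local Notation Im := complex.Im.

Let t := 2 / 3 * Num.sqrt eps.

Let t_neq0 : t != 0.
Proof. by rewrite mulf_neq0// gt_eqF// ?sqrtr_gt0//; lra. Qed.

Let epsE : eps = 9 / 4 * t ^+ 2.
Proof. by rewrite /t exprMn sqr_sqrtr ?ltW//; field. Qed.

Definition integrand (p : R * R) : R[i] := let: (xi, eta) := p in
  cexp (- 'i%C * ((- (z ^+ 2 / 3)) * xi + 0 * eta)%:C
        - 'i%C * (z * (xi ^+ 2 + eta ^+ 2))%:C
        + 'i%C * (xi ^+ 3 - 3 * xi * eta ^+ 2)%:C)
  * (expR (- eps * (xi ^+ 2 + eta ^+ 2)))%:C.

Definition outer_exponent xi : R[i] :=
  (- (eps * xi ^+ 2)) +i* (xi ^+ 3 - z * xi ^+ 2 + z ^+ 2 / 3 * xi).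

Definition inner xi eta : R[i] := cexp (- ((eps +i* (z + 3 * xi)) * (eta ^+ 2)%:C)).

Lemma integrandE xi eta :
  integrand (xi, eta) = cexp (outer_exponent xi) * inner xi eta.
Proof.
rewrite /integrand /inner /outer_exponent -cexp_real -!cexpD; congr cexp.
by apply: complex_ext; rewrite !ReImE/=; field.
Qed.

Lemma normc_integrand xi eta : normc (integrand (xi, eta)) <=
  1 * expR (- (eps * xi ^+ 2)) * expR (- (eps * eta ^+ 2)).
Proof.
rewrite integrandE /inner /outer_exponent mul1r normcM !normc_cexp -!expRD ler_expR.
by rewrite !ReImE/=; lra.
Qed.

Lemma measurable_integrand :
  measurable_fun setT (fun p => Re (integrand p)) /\
  measurable_fun setT (fun p => Im (integrand p)).
Proof.
pose th (p : R * R) := p.1 ^+ 3 - 3 * p.1 * p.2 ^+ 2 - z * (p.1 ^+ 2 + p.2 ^+ 2)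
  + z ^+ 2 / 3 * p.1.
pose ex (p : R * R) := expR (- eps * (p.1 ^+ 2 + p.2 ^+ 2)).
have E p : integrand p = (ex p)%:C * (cos (th p) +i* sin (th p)).
  case: p => xi eta; rewrite /integrand mulrC /ex; congr (_ * _).
  rewrite /cexp (_ : Re _ = 0); last by rewrite !ReImE/=; ring.
  rewrite (_ : Im _ = th (xi, eta)); last by rewrite !ReImE/= /th/=; field.
  by rewrite expR0 mul1r.
have mth : measurable_fun setT th.
  rewrite /th.
  apply: measurable_funD; last by apply: measurable_funM => //; exact: measurable_fst.
  apply: measurable_funB; last first.
    apply: measurable_funM => //.
    by apply: measurable_funD; apply: measurable_funX; [exact: measurable_fst|exact: measurable_snd].
  apply: measurable_funB; first by apply: measurable_funX; exact: measurable_fst.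
  apply: measurable_funM; first by apply: measurable_funM => //; exact: measurable_fst.
  by apply: measurable_funX; exact: measurable_snd.
have mex : measurable_fun setT ex.
  apply: measurableT_comp => //; apply: measurable_funM => //.
  by apply: measurable_funD; apply: measurable_funX; [exact: measurable_fst|exact: measurable_snd].
split.
- under eq_fun do rewrite E cReRM /=.
  apply: measurable_funM => //; apply: measurableT_comp => //.
  exact: continuous_measurable_fun (@continuous_cos R).
- under eq_fun do rewrite E cImRM /=.
  apply: measurable_funM => //; apply: measurableT_comp => //.
  exact: continuous_measurable_fun (@continuous_sin R).
Qed.

Lemma cderiv_inner_l xi eta :
  cderiv (inner ^~ eta) xi (- (3 * 'i%C * eta%:C ^+ 2) * inner xi eta).
Proof.
apply: cderiv_cexp; apply: cderivN.
have d : cderiv (fun xi => eps +i* (z + 3 * xi)) xi (3 * 'i%C).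
  apply: (@cderiv_ext _ (fun s => (eps +i* z) + 3 * 'i%C * s%:C)).
    by move=> s; rewrite -(rmorph_nat (real_complex R)); apply: complex_ext; rewrite !ReImE/=; ring.
  apply: cderiv_eq.
    by apply: cderivD; [exact: cderiv_cst|apply: cderivZ; exact: cderiv_id].
  by rewrite add0r mulr1.
apply: cderiv_eq; first exact: cderivM d (cderiv_cst _ _).
by rewrite mulr0 addr0 rmorphXn.
Qed.

Lemma cderiv_inner_r xi eta :
  cderiv (inner xi) eta (- ((eps +i* (z + 3 * xi)) * (2 * eta%:C)) * inner xi eta).
Proof.
apply: cderiv_cexp; apply: cderivN; apply: cderivZ.
apply: (@cderiv_ext _ (fun s => s%:C ^+ 2)); first by move=> s; rewrite rmorphXn.
apply: cderiv_eq; first by apply: cderivX; exact: cderiv_id.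
by rewrite /= expr1 mulr1.
Qed.

Lemma inner_gbound (D : R -> Prop) : gbound D inner.
Proof.
exists 1, eps; split => // xi eta _; rewrite mul1r normc_cexp ler_expR.
by rewrite !ReImE/=; lra.
Qed.

(** The substitution in xi asks for a continuous outer integrand; continuity follows from
    differentiability under the integral sign. *)
Lemma ccont_cint_inner : ccont (fun xi => cint (inner xi)).
Proof.
apply: (@cderiv_ccont _ _ (fun xi => cint (fun eta => - (3 * 'i%C * eta%:C ^+ 2) * inner xi eta))).
move=> xi; have xiI : xi - 1 < xi < xi + 1 by apply/andP; split; lra.
apply: (@cderiv_cint_gbound _ inner
  (fun s eta => - (3 * 'i%C * eta%:C ^+ 2) * inner s eta) _ _ _ xiI).
- move=> s sI; apply: gdom_cintegrable; first exact: cderiv_ccont (cderiv_inner_r s).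
  exact: (gbound_gdom (inner_gbound (fun s => xi - 1 < s < xi + 1)) sI).
- by move=> s eta _; exact: cderiv_inner_l.
- apply: pbound_gbound; last exact: inner_gbound.
  apply: pboundN; apply: pboundM; first exact: pbound_cst.
  by apply: pboundX; exact: pbound_id.
Qed.

(** The solution xi of sigma^2 = eps + i (z + 3 xi) at sigma = [contour 1 t x]. *)
Definition xi_of x := 3 / 2 * (x * rad t x) - z / 3.
Definition xi_of' x := 3 / 2 * (rad t x + x * (x / rad t x)).

Lemma is_derive_xi_of x : is_derive x 1 xi_of (xi_of' x).
Proof.
have h := is_derive_funM (is_derive_id x 1) (is_derive_rad x t_neq0).
have d1 : is_derive x 1 (fun=> 3 / 2 : R) 0 by exact: is_derive_cst.
have d2 : is_derive x 1 (fun=> - (z / 3) : R) 0 by exact: is_derive_cst.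
have := is_derive_funD (is_derive_funM d1 h) d2.
by rewrite mul0r add0r addr0 mul1r.
Qed.

Lemma xi_of'_gt0 x : 0 < xi_of' x.
Proof.
have r0 := rad_gt0 x t_neq0.
rewrite /xi_of' mulr_gt0//.
by rewrite ltr_pwDl// mulrA -expr2 mulr_ge0 ?sqr_ge0// invr_ge0 ltW.
Qed.

Lemma xi_of_incr : {homo xi_of : x y / x < y}.
Proof.
move=> x y xy.
apply: (@gtr0_derive1_incr _ xi_of x y _ _ _ x y (lexx x) xy (lexx y)).
- by move=> s _; have [] := is_derive_xi_of s.
- move=> s _; rewrite derive1E; have [_ ->] := is_derive_xi_of s.
  exact: xi_of'_gt0.
- apply: derivable_within_continuous => s _.
  by have [] := is_derive_xi_of s.
Qed.

Lemma cvg_xi_of : xi_of x @[x --> +oo] --> +oo.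
Proof.
apply: (@ger_cvgy _ _ _ _ (fun x => x + - (z / 3))); last exact: cvg_addrr.
near=> x; rewrite /xi_of lerD2r.
have x1 : 1 <= x by near: x; exact: nbhs_pinfty_ge.
have := rad_ge t x; have := ler_norm x => h1 h2; nra.
Unshelve. all: end_near. Qed.

Lemma cvgNy_xi_of : xi_of x @[x --> -oo] --> -oo.
Proof.
have h : (fun x => x + z / 3) x @[x --> +oo] --> +oo by exact: cvg_addrr.
apply/cvgNry; apply/cvgNy_compNP.
apply: (@ger_cvgy _ _ _ _ _ _ _ h).
near=> x; change (x + z / 3 <= - xi_of (- x)).
rewrite /xi_of /rad sqrrN -/(rad t x) opprB.
have x1 : 1 <= x by near: x; exact: nbhs_pinfty_ge.
have := rad_ge t x; have := ler_norm x => h1 h2; nra.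
Unshelve. all: end_near. Qed.

Lemma continuous_xi_of' : continuous xi_of'.
Proof.
move=> x; apply: cvgM; first exact: cvg_cst.
apply: cvgD.
  by apply: (is_derive1_continuous (f' := fun x => x / rad t x)) => y; exact: is_derive_rad.
by apply: cvgM; [exact: cvg_id|exact: continuous_ratio].
Qed.

Lemma cint_inner_xi_of x : cint (inner (xi_of x)) =
  (Num.sqrt pi)%:C / contour 1 t x.
Proof.
have cE : contour 1 t x = (3 / 2 * rad t x) +i* (3 / 2 * x).
  rewrite /contour.
  have -> : (3 / 2 : R[i]) = (3 / 2)%:C by rewrite rmorphM/= fmorphV !rmorph_nat.
  by apply: complex_ext; rewrite !ReImE/=; ring.
(* [cint_gauss] asks for |Im sigma| < Re sigma, that is |x| < [rad t x], which is strict because t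
   != 0. *)
rewrite cE -cint_gauss; last first.
  rewrite normrM ger0_norm; last by lra.
  by rewrite ltr_pM2l ?rad_gt//; lra.
have E : eps +i* (z + 3 * xi_of x) = ((3 / 2 * rad t x) +i* (3 / 2 * x)) ^+ 2.
  have rs := rad_sqr t x; rewrite /xi_of.
  apply: complex_ext; rewrite expr2 !ReImE/=; last by field.
  rewrite epsE; have -> : t ^+ 2 = rad t x ^+ 2 - x ^+ 2 by rewrite rs addrC addKr.
  by field.
by apply: eq_cint => y; rewrite /inner E.
Qed.

Lemma cexp_outer_xi_of x : cexp (outer_exponent (xi_of x)) =
  cexp ('i%C * (z ^+ 3 / 27)%:C) * wave z 1 t x.
Proof.
rewrite /wave -cexpD; congr cexp.
pose Y := 3 / 2 * (x * rad t x).
have hE : height 1 t x = 0 +i* Y.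
  by rewrite heightE; apply: complex_ext => /=; rewrite /Y; ring.
have xE : xi_of x = Y - z / 3 by [].
rewrite hE xE /phase /outer_exponent -epsE; move: Y {hE xE} => Y.
have sub (u : R) : (0 +i* Y) - 'i%C * u%:C = 0 +i* (Y - u).
  by apply: complex_ext; rewrite !ReImE/=; ring.
have sq (u : R) : (0 +i* u) ^+ 2 = (- u ^+ 2) +i* 0.
  by apply: complex_ext; rewrite expr2 !ReImE/=; ring.
have cu (u : R) : (0 +i* u) ^+ 3 = 0 -i* u ^+ 3.
  by rewrite exprS sq; apply: complex_ext; rewrite !ReImE/=; ring.
rewrite !sub sq cu; apply: complex_ext; rewrite !ReImE/=; first by ring.
by field.
Qed.

(** From 3 i d xi = 2 sigma d sigma. The factor sigma cancels the denominator left by the inner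
    Gaussian integral, so no square root remains in the integrand. *)
Lemma xi_of'_contour x :
  (xi_of' x)%:C / contour 1 t x = 2 / (3 * 'i%C) * contour_dx 1 t x.
Proof.
have r0 := rad_gt0 x t_neq0; have rn0 : rad t x != 0 by rewrite gt_eqF.
have c0 : contour 1 t x != 0.
  rewrite /contour (_ : 3 / 2 = (3 / 2)%:C); last first.
    by rewrite rmorphM/= fmorphV !rmorph_nat.
  by apply/eqP => /(congr1 (@complex.Re R)); rewrite !ReImE/=; lra.
have i0 : 'i%C != 0 :> R[i] by apply/eqP => /(congr1 (@complex.Im R))/= /eqP; rewrite oner_eq0.
apply: (mulIf c0); rewrite mulfVK//.
have -> : (2 / (3 * 'i%C) : R[i]) = (2 / 3)%:C * - 'i%C.
  have -> : (2 / 3)%:C = 2 / 3 :> R[i] by rewrite rmorphM/= fmorphV !rmorph_nat.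
  apply: (mulIf (_ : 3 * 'i%C != 0)); first by rewrite mulf_neq0// pnatr_eq0.
  rewrite mulfVK; last by rewrite mulf_neq0// pnatr_eq0.
  transitivity (- 2 * 'i%C ^+ 2 : R[i]); first by rewrite sqr_i; ring.
  by field.
rewrite /contour /contour_dx.
have -> : (3 / 2 : R[i]) = (3 / 2)%:C by rewrite rmorphM/= fmorphV !rmorph_nat.
rewrite /xi_of'; move: (rad t x) rn0 => r rn0.
by apply: complex_ext; rewrite !ReImE/=; field.
Qed.

Lemma elliptic_umbilic_reg_contour :
  elliptic_umbilic_reg (- (z ^+ 2 / 3)) 0 z eps =
  (2 * pi)^-1%:C * cexp ('i%C * (z ^+ 3 / 27)%:C) * (Num.sqrt pi)%:C * (2 / (3 * 'i%C))
  * cint (fun x => contour_dx 1 t x * wave z 1 t x).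
Proof.
have [m1 m2] := measurable_integrand.
have [gi ge] := cintegral_fubini eps0 ler01 m1 m2 normc_integrand.
transitivity ((2 * pi)^-1%:C * cint (fun xi => cint (fun eta => integrand (xi, eta)))).
  by rewrite -ge.
pose G xi := cexp (outer_exponent xi) * cint (inner xi).
have ii xi : cintegrable (inner xi).
  apply: gdom_cintegrable; first exact: cderiv_ccont (cderiv_inner_r xi).
  exact: (gbound_gdom (inner_gbound (fun=> True)) I).
have GE xi : cint (fun eta => integrand (xi, eta)) = G xi.
  by under eq_cint do rewrite integrandE; rewrite cintZ.
have GEf : (fun xi => cint (fun eta => integrand (xi, eta))) = G by exact/funext.
rewrite GEf in gi *.
have GxE x : G (xi_of x) * (xi_of' x)%:C = (cexp ('i%C * (z ^+ 3 / 27)%:C) *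
    ((Num.sqrt pi)%:C * (2 / (3 * 'i%C)))) * (contour_dx 1 t x * wave z 1 t x).
  rewrite /G cint_inner_xi_of cexp_outer_xi_of.
  transitivity (cexp ('i%C * (z ^+ 3 / 27)%:C) * (Num.sqrt pi)%:C * wave z 1 t x
    * ((xi_of' x)%:C / contour 1 t x)); first by ring.
  by rewrite xi_of'_contour; ring.
have ci : cintegrable (fun x => contour_dx 1 t x * wave z 1 t x).
  apply: gdom_cintegrable.
    by apply: ccontM; [exact: ccont_contour_dx|exact: ccont_wave].
  (* The original contour is the member l = 0 of the deformed family, so its majorant is already
     available. *)
  have h := pbound_gbound (pbound_contour_dx t) (gbound_wave z t_neq0).
  have := gbound_gdom h (_ : - (7 / 10) < 0 < 7 / 10).
  by rewrite expr0n subr0; apply; apply/andP; split; lra.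
have cG : ccont G.
  apply: ccontM; last exact: ccont_cint_inner.
  apply: ccont_cexp; split => /=.
    by move=> x; apply: cvgN; apply: cvgM; [exact: cvg_cst|exact: exprn_continuous].
  move=> x; apply: cvgD.
    apply: cvgB; first exact: exprn_continuous.
    by apply: cvgM; [exact: cvg_cst|exact: exprn_continuous].
  by apply: cvgM; [exact: cvg_cst|exact: cvg_id].
have iG : cintegrable (fun x => G (xi_of x) * (xi_of' x)%:C).
  by under eq_fun do rewrite GxE; exact: cintegrableZ.
rewrite (cint_change_of_variable xi_of_incr is_derive_xi_of continuous_xi_of' cG
  cvg_xi_of cvgNy_xi_of gi iG).
under eq_cint do rewrite GxE.
rewrite cintZ//; move: (cexp _) (2 / _) (_%:C) (cint _) => e q p I.
by rewrite !mulrA.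
Qed.

End Regularized.

(** * Moments of [e^(-x^6)] *)

Section SexticIntegrals.
Context {R : realType}.
Implicit Types (x y s q : R).
Let mu := @lebesgue_measure R.

Definition sextic n : R := \int[mu]_x (x ^+ n * expR (- x ^+ 6)).

Lemma cubexp0E (m : R[i]) x : cubexp m 0 x = (expR (- x ^+ 6))%:C.
Proof.
rewrite /cubexp /cubarg mulr0 subr0 -cexp_real; congr cexp.
by rewrite -rmorphXn -rmorphN /= -exprM.
Qed.

Lemma lintegrable_sextic n : lintegrable (fun x => x ^+ n.*2 * expR (- x ^+ 6)).
Proof.
have [h _] := @cintegrable_cubint R 1 'X^n 0.
move: h; congr lintegrable; apply/funext => x.
rewrite cubexp0E hornerXn /cubarg mulr0 subr0 -rmorphXn -rmorphM /= -exprM mul2n.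
by [].
Qed.

Lemma cubint0E (m : R[i]) n : cubint m 'X^n 0 = (sextic n.*2)%:C.
Proof.
rewrite /cubint.
have E x : ('X^n).[cubarg m 0 x] * cubexp m 0 x = (x ^+ n.*2 * expR (- x ^+ 6))%:C.
  by rewrite cubexp0E hornerXn /cubarg mulr0 subr0 -rmorphXn -rmorphM /= -exprM mul2n.
rewrite (eq_cint E) /cint /cintegral /= Rintegral_cst//= mul0r.
by apply: complex_ext.
Qed.

Lemma continuous_sextic n : continuous (fun x => x ^+ n * expR (- x ^+ 6)).
Proof.
move=> x; apply: cvgM; first exact: exprn_continuous.
apply: continuous_comp; last exact: continuous_expR.
by apply: cvgN; exact: exprn_continuous.
Qed.

(* Integrate the derivative of [x e^(-x^6)]. *)
Lemma sextic6 : 6 * sextic 6 = sextic 0.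
Proof.
have dF x : is_derive x 1 (fun x => x ^+ 1 * expR (- x ^+ 6))
    (x ^+ 0 * expR (- x ^+ 6) + (- 6) * (x ^+ 6 * expR (- x ^+ 6))).
  have d6 : is_derive x 1 (fun x : R => - x ^+ 6) (- (6 * x ^+ 5)).
    have h : is_derive x 1 (id ^+ 6 : R -> R) (6%:R * (id : R -> R) x ^+ 5 *: 1).
      exact: is_deriveX.
    have -> : - (6 * x ^+ 5) = - (6%:R * (id : R -> R) x ^+ 5 *: 1) by rewrite /GRing.scale/= mulr1.
    exact: is_deriveN h.
  have de := @is_derive1_comp _ expR (fun x => - x ^+ 6) x _ _ (is_derive_expR _) d6.
  have := is_derive_funM (is_derive_id x 1) de.
  rewrite (_ : 1 * _ + _ = x ^+ 0 * expR (- x ^+ 6) + (- 6) * (x ^+ 6 * expR (- x ^+ 6))) //.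
  change (1 * expR (- x ^+ 6) + x * (expR (- x ^+ 6) * - (6 * x ^+ 5)) =
    x ^+ 0 * expR (- x ^+ 6) + (- 6) * (x ^+ 6 * expR (- x ^+ 6))).
  ring.
have i0 := lintegrable_sextic 0; have i6 := lintegrable_sextic 3.
have i6' := lintegrableZ (- 6) i6.
have : \int[mu]_x (x ^+ 0 * expR (- x ^+ 6) + (- 6) * (x ^+ 6 * expR (- x ^+ 6))) = 0.
  have li : lintegrable (fun x => x ^+ 0 * expR (- x ^+ 6) + (- 6) * (x ^+ 6 * expR (- x ^+ 6))).
    exact: lintegrableD i0 i6'.
  have cf : continuous (fun x : R => x ^+ 0 * expR (- x ^+ 6) + (- 6) * (x ^+ 6 * expR (- x ^+ 6))).
    move=> x; apply: cvgD; first exact: continuous_sextic.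
    by apply: cvgM; [exact: cvg_cst|exact: continuous_sextic].
  have [C [c [c0 hC]]] := @cubint_gbound R 0 1 'X.
  (* The available majorant is for x^2 e^(- x^6). It dominates when |x| > 1; for |x| <= 1 the left
     side is at most 1 <= e^c e^(- c x^2). *)
  have hb x : `|x ^+ 1 * expR (- x ^+ 6)| <= (C + expR c) * expR (- (c * x ^+ 2)).
    have D0 : - 1 < (0 : R) < 1 by rewrite ltrN10 ltr01.
    have := hC 0 x D0; rewrite hornerX cubexp0E /cubarg mulr0 subr0 -rmorphM normcR => h.
    have E0 := expR_gt0 (- (c * x ^+ 2)).
    have [x1|x1] := leP `|x| 1.
      rewrite normrM expr1 (ger0_norm (expR_ge0 _)) mulrDl -[leLHS]add0r lerD//.
        by rewrite (le_trans (normr_ge0 _) h).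
      rewrite -expRD (@le_trans _ _ 1)//.
        rewrite mulr_ile1 ?expR_ge0// -expR0 ler_expR oppr_le0.
        by rewrite (_ : x ^+ 6 = (x ^+ 3) ^+ 2) ?sqr_ge0// -exprM.
      have x2 : x ^+ 2 <= 1 by rewrite -[x ^+ 2]real_normK ?num_real// expr_le1.
      by rewrite -expR0 ler_expR; nra.
    rewrite mulrDl (@le_trans _ _ (C * expR (- (c * x ^+ 2))))//; last first.
      by rewrite lerDl mulr_ge0// expR_ge0.
    apply: le_trans h; rewrite [`|x ^+ 1 * _|]normrM [`|x ^+ 2 * _|]normrM.
    by rewrite ler_wpM2r// !normrX ler_weXn2l// ltW.
  have [F1 F2] := cvg0_gauss c0 hb.
  exact: (Rintegral_derive_vanish dF cf li F1 F2).
rewrite RintegralD// [X in _ + X]RintegralZl// -/(sextic 0) -/(sextic 6); lra.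
Qed.

(** The substitution t = x^6. For s < 1 the integrand is singular at 0, so the half-line is
    exhausted by compact intervals away from 0 and their images. The factor 3 is 6 halved by
    evenness. *)
Lemma Gamma_sextic (s : R) n : (forall x, 0 < x -> (x ^+ 6) `^ (s - 1) * (6 * x ^+ 5) = 6 * x ^+ n.*2) ->
  Gamma s = 3 * sextic n.*2.
Proof.
move=> hs.
pose G t := t `^ (s - 1) * expR (- t).
pose H x := 6 * (x ^+ n.*2 * expR (- x ^+ 6)).
pose I k : set R := [set` `[(k.+1%:R : R)^-1, k.+1%:R]].
pose J k : set R := [set` `[((k.+1%:R : R)^-1) ^+ 6, k.+1%:R ^+ 6]].
have d6 x : is_derive x 1 (fun x : R => x ^+ 6) (6 * x ^+ 5).
  have h : is_derive x 1 (id ^+ 6 : R -> R) (6%:R * (id : R -> R) x ^+ 5 *: 1).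
    exact: is_deriveX.
  have -> : 6 * x ^+ 5 = 6%:R * (id : R -> R) x ^+ 5 *: 1 by rewrite /GRing.scale/= mulr1.
  exact: h.
have D6 : derive1 (fun x : R => x ^+ 6) = (fun x => 6 * x ^+ 5).
  by apply/funext => x; rewrite derive1E; have [_ ->] := d6 x.
have c6 : continuous (fun x : R => x ^+ 6) by exact: exprn_continuous.
have c5 : continuous (fun x : R => 6 * x ^+ 5).
  by move=> x; apply: cvgM; [exact: cvg_cst|exact: exprn_continuous].
have Gc t : 0 < t -> {for t, continuous G}.
  move=> t0; apply: cvgM.
    have cp : {for t, continuous (fun u : R => u `^ (s - 1))}.
      apply: differentiable_continuous; apply/derivable1_diffP.
      by have [] := is_derive1_powR (s - 1) t0.
    exact: cp.
  apply: continuous_comp; last exact: continuous_expR.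
  exact: opp_continuous.
have k0 k : 0 < (k.+1%:R : R)^-1 by rewrite invr_gt0.
have kk k : (k.+1%:R : R)^-1 <= k.+1%:R.
  by rewrite (@le_trans _ _ 1)// ?invf_le1// ler1n.
have sub k : (\int[mu]_(x in J k) (G x)%:E = \int[mu]_(x in I k) (H x)%:E)%E.
  rewrite /J (@integration_by_substitution_increasing _ (fun x => x ^+ 6) G _ _ (kk k)).
  - apply: eq_integral => x; rewrite inE/= in_itv/= => /andP[x1 x2].
    have x0 : 0 < x := lt_le_trans (k0 k) x1.
    rewrite D6 !fctE /G /H /=; congr EFin.
    by rewrite mulrAC hs// mulrA.
  - move=> x y; rewrite !in_itv/= => /andP[x1 _] /andP[y1 _] xy.
    by rewrite ltr_pXn2r// nnegrE ltW// (lt_le_trans (k0 k)).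
  - by rewrite D6 => x _; exact: c5.
  - by rewrite D6; apply/cvg_ex; eexists; apply: cvg_at_right_filter; exact: c5.
  - by rewrite D6; apply/cvg_ex; eexists; apply: cvg_at_left_filter; exact: c5.
  - split.
    + by move=> x _; case: (d6 x).
    + by apply: cvg_at_right_filter; exact: c6.
    + by apply: cvg_at_left_filter; exact: c6.
  - apply: continuous_in_subspaceT => x; rewrite inE/= in_itv/= => /andP[x1 _].
    by apply: Gc; rewrite (lt_le_trans _ x1)// exprn_gt0.
have UI : \bigcup_k I k = [set` `]0, +oo[] :> set R.
  apply/seteqP; split => x /=; rewrite in_itv/= andbT.
    by move=> [k _]; rewrite /I/= in_itv/= => /andP[h _]; rewrite (lt_le_trans (k0 k)).
  move=> x0; near \oo => k; exists k => //; rewrite /I/= in_itv/=; apply/andP; split.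
    rewrite -[leRHS]invrK lef_pV2 ?posrE ?invr_gt0// (@le_trans _ _ k%:R) ?ler_nat//.
    by near: k; exact: nbhs_infty_ger.
  rewrite (@le_trans _ _ k%:R) ?ler_nat//.
  by near: k; exact: nbhs_infty_ger.
have UJ : \bigcup_k J k = [set` `]0, +oo[] :> set R.
  apply/seteqP; split => x /=; rewrite in_itv/= andbT.
    by move=> [k _]; rewrite /J/= in_itv/= => /andP[h _]; rewrite (lt_le_trans _ h)// exprn_gt0.
  move=> x0; near \oo => k; exists k => //; rewrite /J/= in_itv/=.
  have k1 : 1 <= k.+1%:R :> R by rewrite ler1n.
  apply/andP; split.
    rewrite (@le_trans _ _ (k.+1%:R)^-1)//.
      by rewrite exprS ler_piMr ?invr_ge0// exprn_ile1 ?invr_ge0// invf_le1.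
    rewrite -[leRHS]invrK lef_pV2 ?posrE ?invr_gt0// (@le_trans _ _ k%:R) ?ler_nat//.
    by near: k; exact: nbhs_infty_ger.
  rewrite (@le_trans _ _ k%:R)//; first by near: k; exact: nbhs_infty_ger.
  rewrite (@le_trans _ _ k.+1%:R) ?ler_nat// exprS ler_peMr// exprn_ege1//.
have ndI : nondecreasing_seq I.
  move=> i j ij; apply/subsetPset => x; rewrite /I/= !in_itv/= => /andP[h1 h2].
  apply/andP; split; first by rewrite (le_trans _ h1)// lef_pV2 ?posrE// ler_nat.
  by rewrite (le_trans h2)// ler_nat.
have ndJ : nondecreasing_seq J.
  move=> i j ij; apply/subsetPset => x; rewrite /J/= !in_itv/= => /andP[h1 h2].
  apply/andP; split.
    rewrite (le_trans _ h1)// ler_pXn2r ?nnegrE ?invr_ge0//.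
    by rewrite lef_pV2 ?posrE// ler_nat.
  by rewrite (le_trans h2)// ler_pXn2r ?nnegrE// ler_nat.
have mG : measurable_fun setT G.
  apply: measurable_funM; first exact: measurable_powR.
  by apply: measurableT_comp => //; exact: measurable_oppr.
have cH : continuous H.
  by move=> x; apply: cvgM; [exact: cvg_cst|exact: continuous_sextic].
have mH : measurable_fun setT H by exact: continuous_measurable_fun.
have H0 x : 0 <= H x.
  rewrite mulr_ge0// mulr_ge0 ?expR_ge0//.
  by rewrite -mul2n exprM exprn_ge0// sqr_ge0.
have e1 : (\int[mu]_(x in `]0%R, +oo[) (G x)%:E = \int[mu]_(x in `]0%R, +oo[) (H x)%:E)%E.
  rewrite -{1}UJ -UI.
  have mI k : measurable (I k) by exact: measurable_itv.
  have mJ k : measurable (J k) by exact: measurable_itv.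
  have mHI k : measurable_fun (I k) (EFin \o H).
    by apply: measurable_funTS; exact/measurable_EFinP.
  have mGJ k : measurable_fun (J k) (EFin \o G).
    by apply: measurable_funTS; exact/measurable_EFinP.
  have H0I k x : I k x -> (0 <= (EFin \o H) x)%E by rewrite lee_fin.
  have G0J k x : J k x -> (0 <= (EFin \o G) x)%E.
    by rewrite lee_fin mulr_ge0 ?powR_ge0 ?expR_ge0.
  have l1 := @ge0_nondecreasing_set_cvg_integral _ (measurableTypeR R) R I (EFin \o H) (@lebesgue_measure R)
    ndI mI mHI H0I.
  have l2 := @ge0_nondecreasing_set_cvg_integral _ (measurableTypeR R) R J (EFin \o G) (@lebesgue_measure R)
    ndJ mJ mGJ G0J.
  have E : (fun k => \int[mu]_(x in J k) (G x)%:E)%E = (fun k => \int[mu]_(x in I k) (H x)%:E)%E.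
    by apply/funext => k; exact: sub.
  rewrite /= E in l2; exact: (cvg_unique (@ereal_hausdorff R) l2 l1).
rewrite /Gamma /Rintegral -/mu.
have -> : (\int[mu]_(t in `]0%R, +oo[) (t `^ (s - 1) * expR (- t))%:E =
   \int[mu]_(t in `]0%R, +oo[) (G t)%:E)%E by [].
rewrite e1.
rewrite integral_itv_obnd_cbnd; last exact/measurable_EFinP/measurable_funTS.
have e3 : (\int[mu]_x (H x)%:E = (6 * sextic n.*2)%:E)%E.
  rewrite /sextic -RintegralZl//; last exact: lintegrable_sextic.
  rewrite /Rintegral fineK//.
  by apply: integrable_fin_num => //; apply: lintegrableZ; exact: lintegrable_sextic.
have HN : H =1 H \o -%R.
  by move=> x; rewrite /H /= -mul2n !exprM (_ : (- x) ^+ 6 = x ^+ 6) ?sqrrN//; ring.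
have := ge0_symfun_integralT H0 cH HN; rewrite -/mu e3.
have -> : [set x : R | 0 <= x] = `[0, +oo[%classic.
  by apply/seteqP; split => x/=; rewrite in_itv/= andbT.
case: (\int[mu]_(_ in `[0%R, +oo[) _)%E => [r| |].
- by rewrite -EFinM => -[] h /=; lra.
- by rewrite mulry gtr0_sg// mul1e.
- by rewrite mulrNy gtr0_sg// mul1e.
Unshelve. all: end_near. Qed.

End SexticIntegrals.

Section GammaValues.
Context {R : realType}.
Implicit Types (x y s q : R).
Let mu := @lebesgue_measure R.

Lemma powR_pow6 x (e : R) : 0 < x -> (x ^+ 6) `^ e = x `^ (6 * e).
Proof. by move=> x0; rewrite powRrM -[6]/(6%:R) powR_mulrn// ltW. Qed.

Lemma Gamma_5_6 : Gamma (5 / 6 : R) = 3 * sextic 4.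
Proof.
apply: (@Gamma_sextic R _ 2) => x x0; rewrite powR_pow6//.
have -> : 6 * (5 / 6 - 1) = -1 :> R by field.
rewrite powR_inv1 ?ltW// mulrCA; congr (_ * _).
by rewrite exprS mulrA mulVf ?gt_eqF// mul1r.
Qed.

Lemma Gamma_7_6 : Gamma (7 / 6 : R) = sextic 0 / 2.
Proof.
rewrite (@Gamma_sextic R _ 3) => [|x x0].
  by rewrite -sextic6; field.
rewrite powR_pow6//.
have -> : 6 * (7 / 6 - 1) = 1 :> R by field.
by rewrite powRr1 ?ltW// mulrCA -exprS.
Qed.

Lemma integral_even (f : R -> R) : (forall x, 0 <= f x) -> continuous f ->
  (forall x, f (- x) = f x) ->
  (\int[mu]_x (f x)%:E = 2%:E * \int[mu]_(x in `[0%R, +oo[) (f x)%:E)%E.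
Proof.
move=> f0 cf fN; rewrite ge0_symfun_integralT//; last by move=> x; rewrite /= fN.
congr (_ * _)%E.
have -> : [set x : R | 0 <= x] = `[0, +oo[%classic.
  by apply/seteqP; split => x/=; rewrite in_itv/= andbT.
by [].
Qed.

Lemma is_derive_pow n x : is_derive x 1 (fun x : R => x ^+ n) (n%:R * x ^+ n.-1).
Proof.
elim: n => [|n ih].
  by rewrite mul0r; exact: is_derive_cst.
have -> : (fun x : R => x ^+ n.+1) = (fun x => x * x ^+ n).
  by apply/funext => t; rewrite exprS.
have := is_derive_funM (is_derive_id x 1) ih.
rewrite mul1r; congr is_derive; rewrite mulrCA.
case: n {ih} => [|n]; first by rewrite mul0r addr0 mul1r.
by rewrite -exprS [n.+2%:R]mulrS mulrDl mul1r.
Qed.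

Lemma integral_abs5 q : 0 < q ->
  (\int[mu]_y (`|y| ^+ 5 * expR (- (q * y ^+ 6)))%:E = (1 / (3 * q))%:E)%E.
Proof.
move=> q0; pose f y := `|y| ^+ 5 * expR (- (q * y ^+ 6)).
have f0 y : 0 <= f y by rewrite mulr_ge0 ?expR_ge0// exprn_ge0.
have cf : continuous f.
  move=> y; apply: cvgM.
    apply: (@continuous_comp _ _ _ (fun y : R => `|y|) (fun u : R => u ^+ 5)).
      exact: norm_continuous.
    exact: exprn_continuous.
  apply: continuous_comp; last exact: continuous_expR.
  by apply: cvgN; apply: cvgM; [exact: cvg_cst|exact: exprn_continuous].
have fN y : f (- y) = f y.
  by rewrite /f normrN (exprM (- y) 2 3) sqrrN -exprM.
rewrite (integral_even f0 cf fN).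
pose F y := - (6 * q)^-1 * expR (- (q * y ^+ 6)).
have dF y : is_derive y 1 F (y ^+ 5 * expR (- (q * y ^+ 6))).
  have dc c : is_derive y 1 (fun=> c : R) 0 by exact: is_derive_cst.
  have d1 := is_derive_funM (dc (- q)) (is_derive_pow 6 y).
  have d2 := @is_derive1_comp _ expR _ y _ _ (is_derive_expR _) d1.
  have := is_derive_funM (dc (- (6 * q)^-1)) d2.
  have -> : (fun t => - (6 * q)^-1 * (expR \o (fun t => - q * t ^+ 6)) t) = F.
    by apply/funext => t; rewrite /F /= [- q * _]mulNr.
  rewrite !mul0r !add0r /= [- q * _]mulNr.
  rewrite (_ : _ * (_ * _) = y ^+ 5 * expR (- (q * y ^+ 6)))//.
  by field; rewrite gt_eqF.
have e := @ge0_continuous_FTC2y R f F 0 0.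
rewrite e.
- rewrite /F expr0n/= mulr0 oppr0 expR0 mulr1 -EFinD -EFinM; congr EFin.
  by field; rewrite gt_eqF.
- by move=> x _; exact: f0.
- exact: continuous_subspaceT.
- rewrite -(mulr0 (- (6 * q)^-1)); apply: cvgM; first exact: cvg_cst.
  apply: (cvg_comp (fun x => q * x ^+ 6) (fun x => expR (- x))); last exact: cvgr_expR.
  apply: gt0_cvgMry => //.
  apply: (@ger_cvgy _ _ _ _ (fun x : R => x)); last exact: cvg_id.
  near=> x; have x1 : 1 <= x by near: x; exact: nbhs_pinfty_ge.
  by rewrite exprS ler_peMr ?exprn_ege1// (le_trans _ x1).
- by move=> x _; have [] := dF x.
- apply: cvg_at_right_filter.
  exact: (is_derive1_continuous dF).
- move=> x; rewrite in_itv/= andbT => x0.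
  by rewrite derive1E; have [_ ->] := dF x; rewrite /f gtr0_norm.
Unshelve. all: end_near. Qed.

(** Since 1 + s^4 = (1 - s^2 + s^4) + s^2, the quotient (1 + s^4)/(1 + s^6) is 1/(1 + s^2) + s^2/(1
    + s^6). With the symmetric weight x^4 + y^4 two arctangents therefore suffice. *)
Lemma integral_rational :
  (\int[mu]_s ((1 + s ^+ 4) / (3 * (1 + s ^+ 6)))%:E = (4 * pi / 9)%:E)%E.
Proof.
pose f s := (1 + s ^+ 4) / (3 * (1 + s ^+ 6)).
have p6 s : 0 < 1 + s ^+ 6.
  by rewrite ltr_wpDr// (_ : s ^+ 6 = (s ^+ 3) ^+ 2) ?sqr_ge0// -exprM.
have p4 s : 0 < 1 + s ^+ 4.
  by rewrite ltr_wpDr// (_ : s ^+ 4 = (s ^+ 2) ^+ 2) ?sqr_ge0// -exprM.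
have p2 s : 0 < 1 + s ^+ 2 by rewrite ltr_wpDr// sqr_ge0.
have f0 s : 0 <= f s by rewrite divr_ge0// ltW// mulr_gt0.
have cf : continuous f.
  move=> s; apply: cvgM.
    by apply: cvgD; [exact: cvg_cst|exact: exprn_continuous].
  apply: cvgV; first by rewrite gt_eqF// mulr_gt0.
  apply: cvgM; first exact: cvg_cst.
  by apply: cvgD; [exact: cvg_cst|exact: exprn_continuous].
have fN s : f (- s) = f s.
  by rewrite /f (exprM (- s) 2 3) (exprM (- s) 2 2) sqrrN -!exprM.
rewrite (integral_even f0 cf fN).
pose F s : R := 3^-1 * (atan s + 3^-1 * atan (s ^+ 3)).
have dF s : is_derive s 1 F (f s).
  have dc c : is_derive s 1 (fun=> c : R) 0 by exact: is_derive_cst.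
  have d1 := @is_derive1_comp _ atan _ s _ _ (is_derive1_atan _) (is_derive_pow 3 s).
  have d2 := is_derive_funM (dc 3^-1) d1.
  have := is_derive_funM (dc 3^-1) (is_derive_funD (is_derive1_atan s) d2).
  rewrite (_ : 0 * _ + _ = f s)//.
  rewrite /f !mul0r !add0r -exprM /=.
  have := p2 s; have := p6 s => h6 h2.
  have e6 : 1 + s ^+ 6 = (1 + s ^+ 2) * (1 - s ^+ 2 + s ^+ 4) by ring.
  have h3 : 1 - s ^+ 2 + s ^+ 4 != 0.
    by apply/eqP => h; move: h6; rewrite e6 h mulr0 ltxx.
  rewrite e6; field; rewrite h3 gt_eqF//.
rewrite (@ge0_continuous_FTC2y R f F 0 (3^-1 * (pi / 2 + 3^-1 * (pi / 2)))).
- rewrite /F expr0n/= atan0 mulr0 addr0 mulr0 -EFinB -EFinM; congr EFin.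
  by field.
- by move=> x _; exact: f0.
- exact: continuous_subspaceT.
- apply: cvgM; first exact: cvg_cst.
  apply: cvgD; first exact: cvgy_atan.
  apply: cvgM; first exact: cvg_cst.
  apply: (cvg_comp (fun x => x ^+ 3) atan); last exact: cvgy_atan.
  apply: (@ger_cvgy _ _ _ _ (fun x : R => x)); last exact: cvg_id.
  near=> x; have x1 : 1 <= x by near: x; exact: nbhs_pinfty_ge.
  by rewrite exprS ler_peMr ?exprn_ege1// (le_trans _ x1).
- by move=> x _; have [] := dF x.
- by apply: cvg_at_right_filter; exact: (is_derive1_continuous dF).
- by move=> x _; rewrite derive1E; have [_ ->] := dF x.
Unshelve. all: end_near. Qed.

End GammaValues.

(** * The product of the two moments *)

Section SexticProduct.
Context {R : realType}.
Implicit Types (x y s q : R).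
Let mu := @lebesgue_measure R.

(** Under x = |y| s the weight x^4 + y^4 gives |y|^4 (1 + s^4), and the Jacobian supplies the fifth
    factor |y|. *)
Let polar y s := `|y| ^+ 5 * (1 + s ^+ 4) * expR (- ((1 + s ^+ 6) * y ^+ 6)).

Let pow4_ge0 x : 0 <= x ^+ 4.
Proof. by rewrite (exprM x 2 2) sqr_ge0. Qed.

Let pow6_ge0 x : 0 <= x ^+ 6.
Proof. by rewrite (exprM x 3 2) sqr_ge0. Qed.

Lemma integral_polar y : y != 0 ->
  (\int[mu]_x ((x ^+ 4 + y ^+ 4) * expR (- x ^+ 6) * expR (- y ^+ 6))%:E =
   \int[mu]_s (polar y s)%:E)%E.
Proof.
move=> y0; have y1 : 0 < `|y| by rewrite normr_gt0.
rewrite (integral_scale y1); last 2 first.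
- move=> x; apply: cvgM; last exact: cvg_cst.
  apply: cvgM.
    by apply: cvgD; [exact: exprn_continuous|exact: cvg_cst].
  apply: continuous_comp; last exact: continuous_expR.
  by apply: cvgN; exact: exprn_continuous.
- by move=> x; rewrite !mulr_ge0 ?expR_ge0// addr_ge0.
have y2 : `|y| ^+ 2 = y ^+ 2 by rewrite real_normK ?num_real.
have y4 : y ^+ 4 = `|y| ^+ 4 by rewrite (exprM _ 2 2) -y2 -exprM.
have y6 : y ^+ 6 = `|y| ^+ 6 by rewrite (exprM _ 2 3) -y2 -exprM.
apply: eq_integral => s _; congr EFin; rewrite /polar y4 y6.
have -> : - ((1 + s ^+ 6) * `|y| ^+ 6) = - (`|y| * s) ^+ 6 + - `|y| ^+ 6 by ring.
by rewrite expRD; ring.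
Qed.

Lemma integral_polar_l s :
  (\int[mu]_y (polar y s)%:E = ((1 + s ^+ 4) / (3 * (1 + s ^+ 6)))%:E)%E.
Proof.
have q0 : 0 < 1 + s ^+ 6 by rewrite ltr_wpDr.
transitivity (\int[mu]_y ((1 + s ^+ 4)%:E * (`|y| ^+ 5 * expR (- ((1 + s ^+ 6) * y ^+ 6)))%:E))%E.
  by apply: eq_integral => y _; rewrite -EFinM /polar; congr EFin; ring.
rewrite ge0_integralZl//; last 2 first.
- apply/measurable_EFinP; apply: continuous_measurable_fun => y; apply: cvgM.
    apply: (@continuous_comp _ _ _ (fun y : R => `|y|) (fun u : R => u ^+ 5)).
      exact: norm_continuous.
    exact: exprn_continuous.
  apply: continuous_comp; last exact: continuous_expR.
  by apply: cvgN; apply: cvgM; [exact: cvg_cst|exact: exprn_continuous].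
- by rewrite lee_fin addr_ge0.
by rewrite integral_abs5// -EFinM mul1r.
Qed.

Lemma measurable_polar : measurable_fun [set: R * R] (fun p => polar p.1 p.2).
Proof.
have m1 : measurable_fun [set: R * R] (fst : R * R -> R) by exact: measurable_fst.
have m2 : measurable_fun [set: R * R] (snd : R * R -> R) by exact: measurable_snd.
apply: measurable_funM.
  apply: measurable_funM.
    by apply: measurable_funX; apply: measurableT_comp.
  by apply: measurable_funD => //; exact: measurable_funX.
apply: measurableT_comp => //; apply: measurableT_comp => //.
apply: measurable_funM; last exact: measurable_funX.
by apply: measurable_funD => //; exact: measurable_funX.
Qed.

Lemma polar_ge0 y s : 0 <= polar y s.
Proof. by rewrite !mulr_ge0 ?expR_ge0 ?exprn_ge0 ?addr_ge0. Qed.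

Lemma integral_polar2 :
  (\int[mu]_y \int[mu]_s (polar y s)%:E = (4 * pi / 9)%:E)%E.
Proof.
have := @fubini_tonelli _ _ (measurableTypeR R) (measurableTypeR R) R mu mu
  (fun p => (polar p.1 p.2)%:E) => /= ->.
- by rewrite -integral_rational; apply: eq_integral => s _; exact: integral_polar_l.
- by apply/measurable_EFinP; exact: measurable_polar.
- by move=> p; rewrite lee_fin polar_ge0.
Qed.

Lemma integral_product4 y :
  (\int[mu]_x ((x ^+ 4 + y ^+ 4) * expR (- x ^+ 6) * expR (- y ^+ 6))%:E =
   (sextic 4 * (y ^+ 0 * expR (- y ^+ 6)) + sextic 0 * (y ^+ 4 * expR (- y ^+ 6)))%:E)%E.
Proof.
have i0 : lintegrable (fun x : R => x ^+ 0 * expR (- x ^+ 6)) := lintegrable_sextic 0.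
have i4 : lintegrable (fun x : R => x ^+ 4 * expR (- x ^+ 6)) := lintegrable_sextic 2.
have i4' := lintegrableZ (expR (- y ^+ 6)) i4.
have i0' := lintegrableZ (y ^+ 4 * expR (- y ^+ 6)) i0.
have e : (fun x => (x ^+ 4 + y ^+ 4) * expR (- x ^+ 6) * expR (- y ^+ 6)) =
  (fun x => expR (- y ^+ 6) * (x ^+ 4 * expR (- x ^+ 6)) +
    y ^+ 4 * expR (- y ^+ 6) * (x ^+ 0 * expR (- x ^+ 6))).
  by apply/funext => x; rewrite expr0 mul1r; ring.
rewrite (@integral_EFin R (fun x => (x ^+ 4 + y ^+ 4) * expR (- x ^+ 6) * expR (- y ^+ 6))).
  2: by rewrite e; exact: lintegrableD i4' i0'.
congr EFin.
transitivity (\int[mu]_x (expR (- y ^+ 6) * (x ^+ 4 * expR (- x ^+ 6)) +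
    y ^+ 4 * expR (- y ^+ 6) * (x ^+ 0 * expR (- x ^+ 6)))).
  by apply: eq_Rintegral => x _; rewrite expr0 mul1r; ring.
rewrite RintegralD// (RintegralZ _ i0) (RintegralZ _ i4) -/(sextic 0) -/(sextic 4).
by rewrite [y ^+ 0]expr0; ring.
Qed.

(* The double integral of [(x^4 + y^4) e^(-x^6 - y^6)] is computed in the
   coordinates [(y, s)], where [x = |y| s]. *)
Lemma sextic_product : sextic 0 * sextic 4 = 2 * pi / 9 :> R.
Proof.
have i0 : lintegrable (fun x : R => x ^+ 0 * expR (- x ^+ 6)) := lintegrable_sextic 0.
have i4 : lintegrable (fun x : R => x ^+ 4 * expR (- x ^+ 6)) := lintegrable_sextic 2.
have j0 := lintegrableZ (sextic 4) i0; have j4 := lintegrableZ (sextic 0) i4.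
have e1 : (\int[mu]_y \int[mu]_x ((x ^+ 4 + y ^+ 4) * expR (- x ^+ 6) * expR (- y ^+ 6))%:E
  = (2 * (sextic 0 * sextic 4))%:E)%E.
  under eq_integral do rewrite integral_product4.
  rewrite (integral_EFin (lintegrableD j0 j4)).
  congr EFin; rewrite RintegralD// (RintegralZ _ i0) (RintegralZ _ i4) -/(sextic 0) -/(sextic 4).
  by ring.
have e2 : (\int[mu]_y \int[mu]_x ((x ^+ 4 + y ^+ 4) * expR (- x ^+ 6) * expR (- y ^+ 6))%:E
  = \int[mu]_y \int[mu]_s (polar y s)%:E)%E.
  (* The substitution degenerates only at y = 0, a null set. *)
  apply: ae_eq_integral => //.
  - under eq_fun do rewrite integral_product4.
    by have /integrableP[] := lintegrableD j0 j4.
  - have mp : measurable_fun setT (fun p : R * R => (polar p.1 p.2)%:E).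
      by apply/measurable_EFinP; exact: measurable_polar.
    apply: (@measurable_fun_fubini_tonelli_F _ _ (measurableTypeR R) (measurableTypeR R)
      R mu _ mp).
    by move=> p; rewrite lee_fin polar_ge0.
  - exists [set 0]; split.
    + exact: measurable_set1.
    + exact: lebesgue_measure_set1.
    + move=> y /= h; apply: contrapT => /eqP y0; apply: h => _.
      exact: integral_polar.
move: e1; rewrite e2 integral_polar2 => -[] h; lra.
Qed.

End SexticProduct.

(** * Hypergeometric series *)

Section HypergeometricCoefficients.
Context {R : realType}.
Implicit Types (a b w k : R[i]).

Definition hypterm a1 a2 b1 b2 w n : R[i] :=
  (pochhammer a1 n * pochhammer a2 n) / (pochhammer b1 n * pochhammer b2 n)
  * (w ^+ n / n`!%:R).

Lemma pochhammerS (K : fieldType) (a : K) n :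
  pochhammer a n.+1 = pochhammer a n * (a + n%:R).
Proof. by rewrite /pochhammer big_ord_recr. Qed.

Lemma hypterm0 a1 a2 b1 b2 w : hypterm a1 a2 b1 b2 w 0 = 1.
Proof. by rewrite /hypterm /pochhammer !big_ord0 expr0 fact0 !mulr1 !divr1 mulr1. Qed.

Lemma hyptermS a1 a2 b1 b2 w n : hypterm a1 a2 b1 b2 w n.+1 =
  hypterm a1 a2 b1 b2 w n * ((a1 + n%:R) / (b1 + n%:R)) * ((a2 + n%:R) / (b2 + n%:R))
  * (w / n.+1%:R).
Proof.
rewrite /hypterm !pochhammerS exprS factS natrM !invfM.
have gen (p1 p2 p3 p4 q1 q2 q3 q4 f m v : R[i]) :
  p1 * q1 * (p2 * q2) * (p3 * q3 * (p4 * q4)) * (w * v * (f * m)) =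
  p1 * p2 * (p3 * p4) * (v * m) * (q1 * q3) * (q2 * q4) * (w * f) by ring.
exact: gen.
Qed.

Lemma hypterm_scale a1 a2 b1 b2 w x n :
  hypterm a1 a2 b1 b2 w n * x ^+ n = hypterm a1 a2 b1 b2 (w * x) n.
Proof. by rewrite /hypterm exprMn; ring. Qed.

Lemma normc_ratio (a b : R) n : 0 < a <= b ->
  normc ((a%:C + n%:R) / (b%:C + n%:R)) <= 1.
Proof.
move=> /andP[a0 ab]; have b0 := lt_le_trans a0 ab.
have n0 : 0 <= n%:R :> R by [].
have -> : (a%:C + n%:R) / (b%:C + n%:R) = ((a + n%:R) / (b + n%:R))%:C.
  by rewrite rmorphM/= fmorphV/= !rmorphD/= rmorph_nat.
have an : 0 <= a + n%:R by rewrite addr_ge0// ltW.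
have bn : 0 < b + n%:R by rewrite ltr_wpDr.
rewrite normcR ger0_norm ?(divr_ge0 _ (ltW bn))//.
by rewrite ler_pdivrMr// mul1r lerD2r.
Qed.

(** Pairing each upper parameter with a larger lower one makes every quotient of factors at most 1,
    so only 1/n! remains. *)
Lemma normc_hypterm (a1 a2 b1 b2 : R) w n : 0 < a1 <= b1 -> 0 < a2 <= b2 ->
  normc w <= 1 -> normc (hypterm a1%:C a2%:C b1%:C b2%:C w n) <= (n`!%:R)^-1.
Proof.
move=> h1 h2 w1; elim: n => [|n ih]; first by rewrite hypterm0 fact0 invr1 (normc_nat 1).
rewrite hyptermS 3!normcM factS natrM [leRHS]invfM.
have e : normc (w / n.+1%:R) <= (n.+1%:R)^-1.
  have -> : w / n.+1%:R = w * (n.+1%:R^-1)%:C by rewrite fmorphV rmorph_nat.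
  rewrite normcM normcR ger0_norm ?invr_ge0// -[leRHS]mul1r.
  by rewrite ler_wpM2r ?invr_ge0.
rewrite [leRHS]mulrC ler_pM ?mulr_ge0 ?normc_ge0//.
rewrite -[leRHS]mulr1 ler_pM ?mulr_ge0 ?normc_ge0 ?normc_ratio//.
by rewrite -[leRHS]mulr1 ler_pM ?normc_ge0 ?normc_ratio.
Qed.

(** The origin of the hypergeometric parameters. At degree 3n + r the two sides of the equation
    factor over n: (3n + r + 1/2)(3n + r + 3/2) yields the upper parameters, and the falling
    factorial yields n + 1 and the lower ones. *)
Lemma hypterm_ode (a1 a2 b1 b2 : R) w k (r n : nat) :
  0 < b1 -> 0 < b2 -> k * 9 = w * 27 ->
  euler_mult (3 * n + r) = 9 * ((a1%:C + n%:R) * (a2%:C + n%:R)) :> R[i] ->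
  ((3 * n + r + 3) ^_ 3)%:R = 27 * (n.+1%:R * (b1%:C + n%:R) * (b2%:C + n%:R)) :> R[i] ->
  hypterm a1%:C a2%:C b1%:C b2%:C w n.+1 * ((3 * n + r + 3) ^_ 3)%:R =
  k * euler_mult (3 * n + r) * hypterm a1%:C a2%:C b1%:C b2%:C w n.
Proof.
move=> b10 b20 kw -> ->; rewrite hyptermS.
have b1n : b1%:C + n%:R != 0 :> R[i].
  rewrite -(rmorph_nat (real_complex R)) -rmorphD fmorph_eq0 gt_eqF//.
  by rewrite ltr_wpDr.
have b2n : b2%:C + n%:R != 0 :> R[i].
  rewrite -(rmorph_nat (real_complex R)) -rmorphD fmorph_eq0 gt_eqF//.
  by rewrite ltr_wpDr.
have nn : n.+1%:R != 0 :> R[i] by rewrite pnatr_eq0.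
have -> : k = w * 3.
  by apply: (mulIf (_ : 9 != 0 :> R[i])); rewrite ?pnatr_eq0// kw; ring.
move: (hypterm _ _ _ _ _ _) b1n b2n nn => u.
move: (b1%:C + _) (b2%:C + _) (a1%:C + _) (a2%:C + _) (n.+1%:R) => B1 B2 A1 A2 N h1 h2 h3.
by field; rewrite h1 h2 h3.
Qed.

End HypergeometricCoefficients.

(** * Evaluation of the two ray integrals *)

Section EllipticUmbilic.
Context {R : realType}.
Implicit Types (a A z : R).

Lemma hyp2F2_series (a1 a2 b1 b2 w x : R[i]) (A : R) : x = w * A%:C ^+ 3 ->
  limn (series (fun n => hypterm a1 a2 b1 b2 w n * A%:C ^+ (3 * n))) =
  hyp2F2 a1 a2 b1 b2 x.
Proof.
move=> ->; rewrite /hyp2F2; congr (limn (series _)); apply/funext => n.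
by rewrite exprM hypterm_scale.
Qed.

Lemma cubint_X2 (m : R[i]) : cubint m (cubop 1) 0 = (3 * sextic 4)%:C.
Proof.
rewrite cubop1E /cubint.
have E x : (3 *: 'X^2).[cubarg m 0 x] * cubexp m 0 x =
    3 * (('X^2).[cubarg m 0 x] * cubexp m 0 x) by rewrite hornerZ mulrA.
rewrite (eq_cint E) cintZ; last exact: cintegrable_cubint.
by rewrite -/(cubint m 'X^2 0) cubint0E rmorphM/= rmorph_nat.
Qed.

Lemma cubint0_eq (m m' : R[i]) Q : cubint m Q 0 = cubint m' Q 0.
Proof.
by apply: eq_cint => x; rewrite !cubexp0E /cubarg !mulr0.
Qed.

Lemma sqr_i : ('i%C : R[i]) * 'i%C = -1.
Proof. by rewrite -expr2 sqr_i. Qed.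

Lemma omega_pair :
  omega - omegaN = 'i%C * (Num.sqrt 3)%:C :> R[i].
Proof. by rewrite /omega /omegaN; apply: complex_ext; rewrite !ReImE /=; field. Qed.

(** Both values of mu have cube - i, so the combination of the two integrals satisfies one equation;
    its values at 0 select the two series. *)
Lemma ray_integrals A : 0 <= A ->
  omega * cint (cubexp ('i%C * omegaN ^+ 2) A) - omegaN * cint (cubexp ('i%C * omega ^+ 2) A)
  = (Num.sqrt 3)%:C * ('i%C * (sextic 0)%:C *
      hyp2F2 (1 / 6)%:C (1 / 2)%:C (1 / 3)%:C (2 / 3)%:C (- 'i%C * A%:C ^+ 3)
    + 3 * (sextic 4)%:C * A%:C *
      hyp2F2 (1 / 2)%:C (5 / 6)%:C (2 / 3)%:C (4 / 3)%:C (- 'i%C * A%:C ^+ 3)) :> R[i].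
Proof.
move=> A0; have [w3 [v3 wv]] := @omega_cube R.
have ii : ('i%C : R[i]) ^+ 3 = - 'i%C by rewrite exprS expr2 sqr_i mulrN1.
set m1 : R[i] := 'i%C * omegaN ^+ 2; set m2 : R[i] := 'i%C * omega ^+ 2.
have m13 : m1 ^+ 3 = - 'i%C.
  by rewrite /m1 exprMn ii -exprM mulnC exprM v3 sqrrN expr1n mulr1.
have m23 : m2 ^+ 3 = - 'i%C.
  by rewrite /m2 exprMn ii -exprM mulnC exprM w3 sqrrN expr1n mulr1.
have wm1 : omega * m1 = 'i%C * omegaN.
  by rewrite /m1 mulrCA expr2 [omega * _]mulrA wv mul1r.
have wm2 : omegaN * m2 = 'i%C * omega.
  by rewrite /m2 mulrCA expr2 [omegaN * _]mulrA [omegaN * _]mulrC wv mul1r.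
(* Together with [wm22] this gives the two rays the same second derivative at 0, so the solution
   with exponent 2 cancels. *)
have wm12 : omega * m1 ^+ 2 = 1.
  rewrite expr2 mulrA wm1 /m1 mulrACA sqr_i -exprS v3; ring.
have wm22 : omegaN * m2 ^+ 2 = 1.
  rewrite expr2 mulrA wm2 /m2 mulrACA sqr_i -exprS w3; ring.
clearbody m1 m2.
(* [G j] is the j-th derivative of the left-hand side as a function of a. *)
pose G j (a : R) : R[i] := omega * (m1 ^+ j * cubint m1 (iter j cubop 1) a)
  - omegaN * (m2 ^+ j * cubint m2 (iter j cubop 1) a).
have dG j a : cderiv (G j) a (G j.+1 a).
  have h m : cderiv (fun a => m ^+ j * cubint m (iter j cubop 1) a) a
      (m ^+ j.+1 * cubint m (iter j.+1 cubop 1) a).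
    by rewrite exprSr -mulrA; apply: cderivZ; exact: cderiv_cubint.
  by apply: cderivB; apply: cderivZ; exact: h.
have ode a : G 3 a = (- 3 * 'i%C) * (a%:C ^+ 2 * G 2 a + 3 * a%:C * G 1 a + 3 / 4 * G 0 a).
  rewrite /G [iter 3 _ _]/= [iter 2 _ _]/= [iter 1 _ _]/= [iter 0 _ _]/=.
  rewrite !cubint_residual m13 m23 !expr0 !expr1.
  move: (cubint m1 _ _) (cubint m1 _ _) (cubint m1 _ _) (cubint m2 _ _) (cubint m2 _ _)
    (cubint m2 _ _) => p2 p1 p0 q2 q1 q0.
  move: (a%:C) ('i%C) => x i; ring.
have G00 : G 0 0 = (Num.sqrt 3)%:C * ('i%C * (sextic 0)%:C).
  rewrite /G !expr0 !mul1r /= (cubint0_eq m2 m1) -mulrBl omega_pair.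
  have -> : (1 : {poly R[i]}) = 'X^0 by rewrite expr0.
  by rewrite cubint0E double0 mulrC [RHS]mulrA mulrC ['i%C * _]mulrC.
have G10 : G 1 0 = (Num.sqrt 3)%:C * (3 * (sextic 4)%:C).
  rewrite /G !expr1 /= !cubint_X2 !mulrA wm1 wm2 -mulrBl -mulrBr -opprB omega_pair.
  rewrite mulrN mulrA sqr_i mulN1r opprK.
  by rewrite rmorphM/= rmorph_nat mulrA.
have G20 : G 2 0 = 0.
  by rewrite /G [omega * _]mulrA [omegaN * _]mulrA wm12 wm22 !mul1r (cubint0_eq m2 m1) subrr.
have iN : normc (- 'i%C : R[i]) <= 1 by rewrite normcN normcI.
have G0E a : G 0 a = omega * cint (cubexp m1 a) - omegaN * cint (cubexp m2 a).
  rewrite /G !expr0 !mul1r /= /cubint; congr (_ * _ - _ * _); apply: eq_cint => x.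
    by rewrite (hornerC 1) mul1r.
  by rewrite (hornerC 1) mul1r.
rewrite -G0E.
have num1 m : (3 * m)%:R = 3 * m%:R :> R[i] by rewrite natrM.
have ff n : ((n + 3) ^_ 3)%:R = (n%:R + 3) * (n%:R + 2) * (n%:R + 1) :> R[i].
  by rewrite !ffactnS ffactn0 muln1 /= !addnS addn0 /= !natrM -!natr1; ring.
have k9 : - 3 * 'i%C * 9 = - 'i%C * 27 :> R[i] by ring.
rewrite (@ode_series_solution R (- 3 * 'i%C) (G 0) (G 1) (G 2) (G 3)
  (hypterm (1 / 6)%:C (1 / 2)%:C (1 / 3)%:C (2 / 3)%:C (- 'i%C))
  (hypterm (1 / 2)%:C (5 / 6)%:C (2 / 3)%:C (4 / 3)%:C (- 'i%C)) A) //.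
- by rewrite !(hyp2F2_series _ _ _ _ erefl) G00 G10; ring.
- by rewrite hypterm0.
- by move=> m; apply: normc_hypterm => //; apply/andP; split; lra.
- move=> m; apply: hypterm_ode => //.
  + by rewrite /euler_mult addn0 num1 !rmorphM/= !fmorphV/= !rmorph_nat; field.
  + by rewrite ff addn0 num1 -natr1 !rmorphM/= !fmorphV/= !rmorph_nat; field.
- by rewrite hypterm0.
- by move=> m; apply: normc_hypterm => //; apply/andP; split; lra.
- move=> m; apply: hypterm_ode => //.
  + by rewrite /euler_mult natrD num1 !rmorphM/= !fmorphV/= !rmorph_nat; field.
  + by rewrite ff natrD num1 -natr1 !rmorphM/= !fmorphV/= !rmorph_nat; field.
Qed.

End EllipticUmbilic.

Section MainTheorem.
Context {R : realType}.

(** For small eps > 0 the regularised integral is a constant times the folded rotated integral at t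
    = (2/3) sqrt eps, and t -> 0 with eps. The factor 1/2 comes from the folding. *)
Lemma cvg_elliptic_umbilic_reg (z : R) :
  elliptic_umbilic_reg (- (z ^+ 2 / 3)) 0 z eps @[eps --> 0^'+] -->
  ((2 * pi)^-1)%:C * cexp ('i%C * (z ^+ 3 / 27)%:C) * (Num.sqrt pi)%:C * (2 / (3 * 'i%C))
  * (2^-1 * ((Num.sqrt 3)%:C * (omega * cint (cubexp ('i%C * omegaN ^+ 2) (2 / 3 * z))
       - omegaN * cint (cubexp ('i%C * omega ^+ 2) (2 / 3 * z))))).
Proof.
pose t (eps : R) := 2 / 3 * Num.sqrt eps.
have t0 : t eps @[eps --> 0^'+] --> (0 : R).
  have : {for (0 : R), continuous t}.
    apply: cvgM; first exact: cvg_cst.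
    exact: sqrt_continuous.
  rewrite /prop_for /continuous_at {2}/t sqrtr0 mulr0 => h.
  exact: cvg_at_right_filter h.
have [h1 h2] := cvg_rotated z.
have h : ccvg (0 : R)^'+ (fun eps => cint (fun x => rotated z (t eps) x + rotated z (t eps) (- x)))
    ((Num.sqrt 3)%:C * (omega * cint (cubexp ('i%C * omegaN ^+ 2) (2 / 3 * z))
       - omegaN * cint (cubexp ('i%C * omega ^+ 2) (2 / 3 * z)))).
  by split; [exact: cvg_comp t0 h1 | exact: cvg_comp t0 h2].
have t1 : \forall eps \near 0^'+, -1 < t eps < 1.
  move/cvgrPdist_lt : t0 => /(_ _ ltr01); apply: filterS => e.
  by rewrite sub0r normrN ltr_norml.
have h' := ccvg_cvg (ccvgZ (((2 * pi)^-1)%:C * cexp ('i%C * (z ^+ 3 / 27)%:C)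
  * (Num.sqrt pi)%:C * (2 / (3 * 'i%C))) (ccvgZ 2^-1 h)).
apply: cvg_trans (h' _ _ _); apply: near_eq_cvg; near=> eps.
have e0 : 0 < eps by [].
have et : t eps != 0 by rewrite mulf_neq0// gt_eqF// ?sqrtr_gt0//; lra.
rewrite (elliptic_umbilic_reg_contour z e0) -(cint_contour_rotated z et)//.
by near: eps.
Unshelve. all: end_near. Qed.

End MainTheorem.

Theorem mainTheorem3 (R : realType) (z : R) (hz : 0 <= z) :
  cvg (elliptic_umbilic_reg (- (z ^+ 2 / 3)) 0 z eps @[eps --> 0^'+]) /\
  elliptic_umbilic (- (z ^+ 2 / 3)) 0 z =
    (Num.sqrt pi / 3)%:C * cexp ('i%C * (z ^+ 3 / 27)%:C) *
    ((Gamma (5 / 6 : R))^-1%:C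
       * hyp2F2 (1 / 6) (1 / 2) (1 / 3) (2 / 3) (- (8 / 27) * 'i%C * (z ^+ 3)%:C)
     - 'i%C * z%:C / (3 * (Gamma (7 / 6 : R))%:C)
       * hyp2F2 (1 / 2) (5 / 6) (2 / 3) (4 / 3)
           (- (8 / 27) * 'i%C * (z ^+ 3)%:C)).
Proof.
have h := @cvg_elliptic_umbilic_reg R z.
split; first exact: cvgP h.
rewrite /elliptic_umbilic; have -> := cvg_lim (@norm_hausdorff _ R[i]) h.
have Eq (p q : nat) : (p%:R / q%:R : R[i]) = (p%:R / q%:R : R)%:C.
  by rewrite rmorphM/= fmorphV/= !rmorph_nat.
rewrite ray_integrals ?mulr_ge0//.
have -> : - 'i%C * (2 / 3 * z)%:C ^+ 3 = - (8 / 27) * 'i%C * (z ^+ 3)%:C :> R[i].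
  by rewrite -rmorphXn/= exprMn rmorphM/= rmorphXn/= rmorphM/= fmorphV/= !rmorph_nat; field.
rewrite !(Eq 1 6, Eq 1 2, Eq 1 3, Eq 2 3, Eq 5 6, Eq 4 3).
rewrite Gamma_5_6 Gamma_7_6.
move: (hyp2F2 _ _ _ _ _) (hyp2F2 _ _ _ _ _) (cexp _) => C D ex.
have pi0 : (pi : R) != 0 by rewrite gt_eqF// pi_gt0.
(* The moments are [sextic 0] = 2 Gamma(7/6) and [sextic 4] = Gamma(5/6)/3. Eliminating [sextic 0]
   by the product puts both sides in terms of [sextic 4] and pi. *)
have S := @sextic_product R.
have S4 : sextic 4 != 0 :> R.
  apply/eqP => e; move/eqP: S; rewrite e mulr0 eq_sym mulf_eq0 invr_eq0 mulf_eq0.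
  by rewrite (negbTE pi0) !pnatr_eq0.
have S0 : sextic 0 = 2 * pi / (9 * sextic 4) :> R.
  apply: (mulIf S4); rewrite S; field; exact: S4.
rewrite {}S0; clear S.
have s3 : ((Num.sqrt 3)%:C : R[i]) ^+ 2 = 3 by rewrite -rmorphXn/= sqrt3_sqr rmorph_nat.
have i2 : ('i%C : R[i]) ^+ 2 = -1 by exact: sqr_i.
have i0 : 'i%C != 0 :> R[i] by apply/eqP => /eqP; rewrite eq_complex /= oner_eq0 andbF.
have piC : (pi%:C : R[i]) != 0 by rewrite fmorph_eq0.
have S4C : ((sextic 4)%:C : R[i]) != 0 by rewrite fmorph_eq0.
rewrite !(rmorphM, fmorphV, rmorph_nat)/=.
move: ((Num.sqrt 3)%:C) ((Num.sqrt pi)%:C) (pi%:C) ((sextic 4)%:C) (z%:C) 'i%C s3 i2 i0 piC S4C.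
move=> s p P q x i s3 i2 i0 P0 q0.
(* [i] and [s] are now atoms for [field], so i^2 = -1 and s^2 = 3 are applied beforehand. *)
have iV : i * x = - i^-1 * x.
  by congr (_ * _); apply: (mulfI i0); rewrite mulrN mulfV// -expr2.
by rewrite iV [s * (s * _)]mulrA -expr2 s3; field; rewrite i0 P0 q0.
Qed.
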